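(* Let $(M,\Omega)$ be a symplectic manifold ($M$ paracompact), let $A$ be a local algebra in the sense of Weil, and let $M^A$ be the manifold of infinitely near points on $M$ of kind $A$. Then $(M^A,\Omega^A)$ is a symplectic $A$-manifold.
   Context: A local algebra in the sense of Weil is a real commutative unital algebra $A$ of finite dimension with a unique maximal ideal $\mathfrak m$, of codimension $1$ over $\mathbb R$, so $A=\mathbb R\oplus\mathfrak m$. A near point of $x\in M$ of kind $A$ is a morphism of algebras $\xi:C^\infty(M)\to A$ with $\xi(f)-f(x)\in\mathfrak m$ for all $f\in C^\infty(M)$; $M^A_x$ is the set of these and $M^A=\bigcup_{x\in M}M^A_x$, a smooth manifold of dimension $\dim M\cdot\dim A$ whose charts come from the maps $U^A\to A^n$, $\xi\mapsto(\xi(x_1),\dots,\xi(x_n))$, for local charts $(U;x_1,\dots,x_n)$ of $M$. $C^\infty(M^A,A)$ is the commutative unital $A$-algebra of smooth $A$-valued functions on $M^A$; it contains $C^\infty(M^A)=C^\infty(M^A,\mathbb R)$. For $f\in C^\infty(M)$, $f^A\in C^\infty(M^A,A)$ is $f^A(\xi)=\xi(f)$. A vector field on $M^A$ is regarded as an $\mathbb R$-linear map $X:C^\infty(M)\to C^\infty(M^A,A)$ with $X(fg)=X(f)\cdot g^A+f^A\cdot X(g)$ for all $f,g\in C^\infty(M)$; the set $\mathfrak X(M^A)$ of these is a $C^\infty(M^A,A)$-module. To such an $X$ is associated the unique derivation $\widetilde X:C^\infty(M^A,A)\to C^\infty(M^A,A)$ which is $A$-linear, satisfies $\widetilde X[C^\infty(M^A)]\subset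 C^\infty(M^A)$, and $\widetilde X(f^A)=X(f)$ for all $f\in C^\infty(M)$. The bracket on $\mathfrak X(M^A)$ is $[X,Y]=\widetilde X\circ Y-\widetilde Y\circ X$. For a vector field $\theta$ on $M$, its prolongation to $M^A$ is the vector field $\theta^A:f\mapsto[\theta(f)]^A$. $\Lambda^p(M^A,A)$ is the $C^\infty(M^A,A)$-module of skew-symmetric $C^\infty(M^A,A)$-multilinear forms of degree $p$ on $\mathfrak X(M^A)$ with values in $C^\infty(M^A,A)$ (differential $A$-forms). For a differential form $\omega$ of degree $p$ on $M$, $\omega^A\in\Lambda^p(M^A,A)$ is the unique differential $A$-form of degree $p$ with $\omega^A(\theta_1^A,\dots,\theta_p^A)=[\omega(\theta_1,\dots,\theta_p)]^A$ for all vector fields $\theta_i$ on $M$. For $\eta\in\Lambda^p(M^A,A)$, $$(d^A\eta)(X_1,\dots,X_{p+1})=\sum_{i=1}^{p+1}(-1)^{i-1}\widetilde{X_i}[\eta(X_1,\dots,\widehat{X_i},\dots,X_{p+1})]+\sum_{i<j}(-1)^{i+j}\eta([X_i,X_j],X_1,\dots,\widehat{X_i},\dots,\widehat{X_j},\dots,X_{p+1}).$$ $(M^A,\Omega^A)$ being a symplectic $A$-manifold means: the differential $A$-form $\Omega^A$ of degree $2$ satisfies $d^A\Omega^A=0$ and the map $\mathfrak X(M^A)\to\Lambda^1(M^A,A)$, $X\mapsto i_X\Omega^A=\Omega^A(X,\cdot)$, is an isomorphism of $C^\infty(M^A,A)$-modules. *)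

(* Defs.v *)
From HB Require Import structures.
From mathcomp Require Import all_boot all_order all_algebra.
From mathcomp Require Import fingroup perm.
From mathcomp Require Import all_classical all_reals all_analysis.
Set Implicit Arguments.
Unset Strict Implicit.
Unset Printing Implicit Defensive.
Import Order.TTheory GRing.Theory Num.Theory.
Import numFieldNormedType.Exports.
Local Open Scope classical_set_scope.
Local Open Scope ring_scope.

Section Smoothness.
Context {R : realType}.

(* For finite-dimensional V, continuity of all iterated directional derivatives
   up to order k on the open set O is the usual C^k condition on O. *)
Fixpoint Ck {V W : normedModType R} (k : nat) (O : set V) (f : V -> W) : Prop :=
  (forall x, O x -> {for x, continuous f}) /\
  if k is k'.+1 then
    forall v : V, (forall x, O x -> derivable f x v) /\ Ck k' O ('D_v f)
  else True.

(* Only used for sets D that are in fact open, where O can be taken to be D. *)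
Definition smooth_on {V W : normedModType R} (D : set V) (f : V -> W) : Prop :=
  exists O : set V, [/\ open O, D `<=` O & forall k, Ck k O f].

Lemma CkP {V W : normedModType R} k (O : set V) (f : V -> W) :
  Ck k.+1 O f <-> (forall x, O x -> {for x, continuous f}) /\
    forall v : V, (forall x, O x -> derivable f x v) /\ Ck k O ('D_v f).
Proof. by []. Qed.

Lemma Ck0 {V W : normedModType R} k (O : set V) (f : V -> W) :
  Ck k O f -> forall x, O x -> {for x, continuous f}.
Proof. by case: k => [|k] []. Qed.

Lemma Ck_pred {V W : normedModType R} k (O : set V) (f : V -> W) :
  Ck k.+1 O f -> Ck k O f.
Proof.
elim: k f => [|k IH] f; first by case.
move=> /CkP[cf df]; apply/CkP; split=> // v.
by have [dfv Cf] := df v; split=> //; exact: IH.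
Qed.

Lemma Ck_sub {V W : normedModType R} k (O O' : set V) (f : V -> W) :
  O' `<=` O -> Ck k O f -> Ck k O' f.
Proof.
move=> sO; elim: k f => [|k IH] f.
  by case=> cf _; split=> // x /sO; exact: cf.
move=> /CkP[cf df]; apply/CkP; split=> [x /sO|v]; first exact: cf.
have [dfv Cf] := df v; split=> [x /sO|]; [exact: dfv|exact: IH].
Qed.

Lemma Ck_eq {V W : normedModType R} k (O : set V) (f g : V -> W) :
  open O -> (forall x, O x -> f x = g x) -> Ck k O f -> Ck k O g.
Proof.
move=> oO; elim: k f g => [|k IH] f g fg Cf.
  split=> // x Ox; rewrite /prop_for /continuous_at -fg//.
  apply: cvg_trans (Ck0 Cf Ox); apply: near_eq_cvg.
  by apply: filterS (open_nbhs_nbhs (conj oO Ox)) => y; exact: fg.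
have nfg x : O x -> {near nbhs x, f =1 g}.
  by move=> Ox; apply: filterS (open_nbhs_nbhs (conj oO Ox)) => y; exact: fg.
move/CkP: Cf => [cf df]; apply/CkP; split=> [x Ox|v].
  rewrite /prop_for /continuous_at -fg//.
  by apply: cvg_trans (cf _ Ox); apply: near_eq_cvg; exact: nfg.
have [dfv Cf] := df v; split=> [x Ox|].
  exact: near_eq_derivable (nfg _ Ox) (dfv _ Ox).
by apply: IH Cf => x Ox; apply: near_eq_derive; exact: nfg.
Qed.

Lemma Ck_cst {V W : normedModType R} k (O : set V) (c : W) :
  Ck k O (cst c : V -> W).
Proof.
elim: k c => [|k IH] c; first by split=> // x _; exact: cvg_cst.
apply/CkP; split=> [x _|v]; first exact: cvg_cst.
split=> [x _|]; first exact: derivable_cst.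
rewrite (_ : 'D_v _ = cst 0) ?funeqE; first exact: IH.
by move=> x; exact: derive_cst.
Qed.

Lemma CkD {V W : normedModType R} k (O : set V) (f g : V -> W) :
  open O -> Ck k O f -> Ck k O g -> Ck k O (f + g).
Proof.
move=> oO; elim: k f g => [|k IH] f g Cf Cg.
  by split=> // x Ox; apply: cvgD; [exact: Ck0 Cf _ Ox|exact: Ck0 Cg _ Ox].
move/CkP: Cf => [cf df]; move/CkP: Cg => [cg dg].
apply/CkP; split=> [x Ox|v]; first by apply: cvgD; [exact: cf|exact: cg].
have [dfv Cf] := df v; have [dgv Cg] := dg v.
split=> [x Ox|]; first by apply: derivableD; [exact: dfv|exact: dgv].
apply: Ck_eq (IH _ _ Cf Cg) => // x Ox; rewrite deriveD//; [exact: dfv|exact: dgv].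
Qed.

Lemma CkM {V : normedModType R} k (O : set V) (f g : V -> R) :
  open O -> Ck k O f -> Ck k O g -> Ck k O (f * g).
Proof.
move=> oO; elim: k f g => [|k IH] f g Cf Cg.
  by split=> // x Ox; apply: cvgM; [exact: Ck0 Cf _ Ox|exact: Ck0 Cg _ Ox].
have [Cf' Cg'] := (Ck_pred Cf, Ck_pred Cg).
move/CkP: Cf => [cf df]; move/CkP: Cg => [cg dg].
apply/CkP; split=> [x Ox|v]; first by apply: cvgM; [exact: cf|exact: cg].
have [dfv Cf] := df v; have [dgv Cg] := dg v.
split=> [x Ox|]; first by apply: derivableM; [exact: dfv|exact: dgv].
apply: Ck_eq (CkD oO (IH _ _ Cf' Cg) (IH _ _ Cg' Cf)) => // x Ox.
by rewrite deriveM//; [exact: dfv|exact: dgv].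
Qed.

(* A chart (U, phi) is the pair of its domain and its (total) coordinate map,
   only meaningful on U. *)
Definition chart (T : Type) (V : normedModType R) : Type := set T * (T -> V).

(* f o phi^-1 is smooth on phi(D), for D included in the domain of the chart. *)
Definition smooth_in_chart {T : Type} {V W : normedModType R}
    (c : chart T V) (D : set T) (f : T -> W) : Prop :=
  exists2 G : V -> W, smooth_on (c.2 @` D) G & forall x, D x -> f x = G (c.2 x).

Definition smooth_wrt {T : Type} {V W : normedModType R}
    (F : set (chart T V)) (f : T -> W) : Prop :=
  forall c, F c -> smooth_in_chart c c.1 f.

Lemma smooth_wrt_cst {T : Type} {V W : normedModType R}
    (F : set (chart T V)) (c : W) : smooth_wrt F (fun=> c).
Proof.
move=> ch _; exists (cst c) => //.
by exists setT; split=> // [|k]; [exact: openT|exact: Ck_cst].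
Qed.

Lemma smooth_wrtD {T : Type} {V W : normedModType R} (F : set (chart T V))
    (f g : T -> W) :
  smooth_wrt F f -> smooth_wrt F g -> smooth_wrt F (fun x => f x + g x).
Proof.
move=> sf sg c Fc; have [f' [Q [oQ sQ Cf]] ff'] := sf c Fc.
have [g' [P [oP sP Cg]] gg'] := sg c Fc.
exists (f' + g') => [|x cx]; last by rewrite ff'// gg'.
have oI := openI oQ oP.
exists (Q `&` P); split=> // [x cx|k]; first by split; [exact: sQ|exact: sP].
by apply: CkD => //; [exact: Ck_sub (Cf k)|exact: Ck_sub (Cg k)].
Qed.

Lemma smooth_wrtM {T : Type} {V : normedModType R} (F : set (chart T V))
    (f g : T -> R) :
  smooth_wrt F f -> smooth_wrt F g -> smooth_wrt F (fun x => f x * g x).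
Proof.
move=> sf sg c Fc; have [f' [Q [oQ sQ Cf]] ff'] := sf c Fc.
have [g' [P [oP sP Cg]] gg'] := sg c Fc.
exists (f' * g') => [|x cx]; last by rewrite ff'// gg'.
have oI := openI oQ oP.
exists (Q `&` P); split=> // [x cx|k]; first by split; [exact: sQ|exact: sP].
by apply: CkM => //; [exact: Ck_sub (Cf k)|exact: Ck_sub (Cg k)].
Qed.

Lemma smooth_wrt_sum {T I : Type} {V W : normedModType R} (F : set (chart T V))
    (r : seq I) (f : I -> T -> W) :
  (forall i, smooth_wrt F (f i)) ->
  smooth_wrt F (fun x => \sum_(i <- r) f i x).
Proof.
move=> sf; elim: r => [|i r IH].
  by rewrite (_ : (fun _ => _) = fun=> 0); [exact: smooth_wrt_cst|
    apply/funext => x; rewrite big_nil].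
rewrite (_ : (fun _ => _) = fun x => f i x + \sum_(j <- r) f j x).
  exact: smooth_wrtD.
by apply/funext => x; rewrite big_cons.
Qed.

End Smoothness.

Section VectorValued.
Context {R : realType} {T : Type} {V : normedModType R} {E : vectType R}.

(* E carries no norm: smoothness is tested on the coordinates in a basis. *)
Definition smooth_vect (F : set (chart T V)) (f : T -> E) : Prop :=
  forall j, smooth_wrt F (fun x => coord (vbasis {:E}) j (f x)).

Lemma smooth_vect_cst (F : set (chart T V)) (e : E) : smooth_vect F (fun=> e).
Proof. by move=> j; exact: smooth_wrt_cst. Qed.

Lemma smooth_vectD (F : set (chart T V)) (f g : T -> E) :
  smooth_vect F f -> smooth_vect F g -> smooth_vect F (fun x => f x + g x).
Proof.
move=> sf sg j; have := smooth_wrtD (sf j) (sg j).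
by under eq_fun do rewrite -linearD.
Qed.

Lemma smooth_vect_sum (I : Type) (r : seq I) (F : set (chart T V))
    (f : I -> T -> E) :
  (forall i, smooth_vect F (f i)) ->
  smooth_vect F (fun x => \sum_(i <- r) f i x).
Proof.
move=> sf j; have := smooth_wrt_sum r (fun i => sf i j).
by under eq_fun do rewrite -linear_sum.
Qed.

Lemma smooth_vectZ (F : set (chart T V)) (a : T -> R) (e : E) :
  smooth_wrt F a -> smooth_vect F (fun x => a x *: e).
Proof.
move=> sa j; have := smooth_wrtM sa (smooth_wrt_cst (F := F) (coord (vbasis {:E}) j e)).
by under eq_fun do rewrite -/(_ *: _) -linearZ.
Qed.

End VectorValued.

#[short(type="comVectAlgType")]
HB.structure Definition ComVectAlgebra (R : nzRingType) :=
  {A of GRing.ComAlgebra R A & Vector R A}.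

Lemma smooth_vectM {R : realType} {T : Type} {V : normedModType R}
    {A : comVectAlgType R} (F : set (chart T V)) (f g : T -> A) :
  smooth_vect F f -> smooth_vect F g -> smooth_vect F (fun x => f x * g x).
Proof.
move=> sf sg; pose e := vbasis {:A}.
have -> : (fun x => f x * g x) = fun x => \sum_(i < \dim {:A})
    \sum_(j < \dim {:A}) (coord e i (f x) * coord e j (g x)) *: (e`_i * e`_j).
  apply/funext => x; rewrite {1}(coord_vbasis (memvf (f x))).
  rewrite {1}(coord_vbasis (memvf (g x))) mulr_suml; apply: eq_bigr => i _.
  rewrite mulr_sumr; apply: eq_bigr => j _.
  by rewrite -scalerAl -scalerAr scalerA.
by do 2 (apply: smooth_vect_sum => ?); apply/smooth_vectZ/smooth_wrtM.
Qed.

(* All subspaces of A are finite-dimensional, and every ideal is a subspace. *)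
Definition ideal_of {R : realType} (A : comVectAlgType R) (I : {vspace A}) : Prop :=
  forall a x, x \in I -> a * x \in I.

Definition maximal_ideal_of {R : realType} (A : comVectAlgType R)
    (I : {vspace A}) : Prop :=
  [/\ ideal_of I, I <> fullv &
    forall J : {vspace A}, ideal_of J -> (I <= J)%VS -> J = I \/ J = fullv].

Record weilAlgebra (R : realType) := WeilAlgebra {
  weil_sort :> comVectAlgType R;
  weil_max : {vspace weil_sort};
  weil_maximal : maximal_ideal_of weil_max;
  weil_unique : forall I : {vspace weil_sort}, maximal_ideal_of I -> I = weil_max;
  weil_codim : (\dim weil_max + 1 = \dim {:weil_sort})%N }.

Section AlternatingForms.
Context {S : comPzRingType} {V : lmodType S}.

Definition multilinear p (w : ('I_p -> V) -> S) : Prop :=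
  forall (v : 'I_p -> V) (i : 'I_p) (a : S) (x y : V),
    w (dfwith v i (a *: x + y)) = a * w (dfwith v i x) + w (dfwith v i y).

Definition skew_symmetric p (w : ('I_p -> V) -> S) : Prop :=
  forall (v : 'I_p -> V) (i j : 'I_p), i != j -> w (v \o tperm i j) = - w v.

Definition form_pred p : {pred ('I_p -> V) -> S^o} :=
  fun w => `[< multilinear w /\ skew_symmetric w >].
Arguments form_pred : clear implicits.

Lemma form_pred_closed p : GRing.subsemimod_closed (form_pred p).
Proof.
split; first split.
- apply/asboolP; split=> [v i a x y|v i j _]; rewrite /= ?mulr0 ?addr0 ?oppr0//.
- move=> f g /asboolP[mf af] /asboolP[mg ag]; apply/asboolP.
  split=> [v i a x y|v i j ij].
    by rewrite !fctE mf mg mulrDr addrACA.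
  by rewrite !fctE af// ag// opprD.
- move=> a f /asboolP[mf af]; apply/asboolP.
  split=> [v i b x y|v i j ij]; rewrite !fctE.
    by rewrite mf scalerDr /GRing.scale/= mulrCA.
  by rewrite af// scalerN.
Qed.
HB.instance Definition _ p :=
  GRing.isSubmodClosed.Build S _ (form_pred p) (form_pred_closed p).

Record altform p := AltForm {
  form_fun :> ('I_p -> V) -> S^o;
  formP : form_fun \in form_pred p }.
HB.instance Definition _ p := [isSub for @form_fun p].
HB.instance Definition _ p := [Choice of altform p by <:].
HB.instance Definition _ p := [SubChoice_isSubLmodule of altform p by <:].

Definition cons_vect p (x : V) (v : 'I_p -> V) : 'I_p.+1 -> V :=
  fun k => oapp v x (unlift ord0 k).

Lemma interior_subproof p (x : V) (w : altform p.+1) :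
  (fun v => w (cons_vect x v)) \in form_pred p.
Proof.
case: w => w /= /asboolP[mw aw]; apply/asboolP.
have cD v i y : cons_vect x (dfwith v i y) =
    dfwith (cons_vect x v) (lift ord0 i) y :> ('I_p.+1 -> V).
  apply/funext => k; rewrite /cons_vect; case: unliftP => [k' ->|->]/=.
    have [->|ne] := eqVneq i k'; first by rewrite !dfwithin.
    by rewrite !dfwithout ?liftK// (inj_eq lift_inj).
  by rewrite dfwithout ?unlift_none.
split=> [v i a y z|v i j ij]; first by rewrite !cD mw.
have -> : cons_vect x (v \o tperm i j) =
    cons_vect x v \o tperm (lift ord0 i) (lift ord0 j).
  apply/funext => k; rewrite /cons_vect /=; case: (unliftP ord0 k) => [k' ->|->]/=.
    case: tpermP => [->|->|/eqP ni /eqP nj]; first by rewrite tpermL liftK.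
      by rewrite tpermR liftK.
    by rewrite tpermD ?liftK// (inj_eq lift_inj) eq_sym.
  by rewrite tpermD ?unlift_none.
by rewrite aw// (inj_eq lift_inj).
Qed.

Definition interior_product p (w : altform p.+1) (x : V) : altform p :=
  AltForm (interior_subproof x w).

(* Indices start at 0, so (-1)^(i-1) becomes (-1)^i while (-1)^(i+j) is
   unchanged; the arguments in the second sum are [X_i, X_j] followed by the
   X_l, l <> i, j, in increasing order of l. *)
Definition cochain_diff (act : V -> S -> S) (br : V -> V -> V) p (w : altform p)
    (X : 'I_p.+1 -> V) : S :=
  \sum_(i < p.+1) (-1) ^+ i * act (X i) (w (fun k => X (lift i k)))
  + \sum_(i < p.+1) \sum_(j < p.+1 | (i < j)%N) (-1) ^+ (i + j) *
      w (fun k => nth 0 (br (X i) (X j) ::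
        [seq X l | l <- enum 'I_p.+1 & (l != i) && (l != j)]) k).

Definition closed_form (act : V -> S -> S) (br : V -> V -> V) p (w : altform p) :
    Prop :=
  forall X, cochain_diff act br w X = 0.

End AlternatingForms.
Arguments altform {S} V p.

Definition locally_finite_family (T : topologicalType) (F : set (set T)) : Prop :=
  forall x : T, exists2 U, nbhs x U & finite_set [set W | F W /\ W `&` U !=set0].

Definition paracompact (T : topologicalType) : Prop :=
  forall C : set (set T), (forall U, C U -> open U) ->
    (forall x : T, exists2 U, C U & U x) ->
  exists F : set (set T),
    [/\ forall W, F W -> open W, forall x : T, exists2 W, F W & W x,
        forall W, F W -> exists2 U, C U & W `<=` U & locally_finite_family F].

(* Each chart is a homeomorphism of its open domain onto an open set: it is
   injective, continuous and open there. *)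
Record manifold (R : realType) (n : nat) := Manifold {
  points :> topologicalType;
  atlas : set (chart points 'rV[R]_n);
  manifold_hausdorff : hausdorff_space points;
  manifold_paracompact : paracompact points;
  atlas_cover : forall x, exists2 c, atlas c & c.1 x;
  atlas_open : forall c, atlas c -> open c.1;
  atlas_inj : forall c, atlas c ->
    forall x y, c.1 x -> c.1 y -> c.2 x = c.2 y -> x = y;
  atlas_cont : forall c, atlas c ->
    forall x, c.1 x -> {for x, continuous c.2};
  atlas_open_map : forall c, atlas c ->
    forall O, open O -> O `<=` c.1 -> open (c.2 @` O);
  atlas_smooth : forall c d, atlas c -> atlas d ->
    smooth_in_chart c (c.1 `&` d.1) d.2 }.
Arguments atlas {R n}.

Section SmoothFunctions.
Context {R : realType} {n : nat} (M : manifold R n).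

Definition smooth_pred : {pred M -> R} := fun f => `[< smooth_wrt (atlas M) f >].

Lemma smooth_pred_subring : subring_closed smooth_pred.
Proof.
split.
- by apply/asboolP; exact: smooth_wrt_cst.
- move=> f g /asboolP sf /asboolP sg; apply/asboolP.
  have := smooth_wrtD sf (smooth_wrtM (smooth_wrt_cst (-1 : R)) sg).
  by under eq_fun do rewrite mulN1r.
- by move=> f g /asboolP sf /asboolP sg; apply/asboolP; exact: smooth_wrtM.
Qed.
HB.instance Definition _ :=
  GRing.isSubringClosed.Build (M -> R) smooth_pred smooth_pred_subring.

Lemma smooth_pred_scale : GRing.scaler_closed smooth_pred.
Proof.
move=> a f /asboolP sf; apply/asboolP.
exact: smooth_wrtM (smooth_wrt_cst (a : R)) sf.
Qed.
HB.instance Definition _ :=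
  GRing.isScaleClosed.Build R (M -> R) smooth_pred smooth_pred_scale.

Record smooth := Smooth { smooth_fun :> M -> R; smoothP : smooth_fun \in smooth_pred }.
HB.instance Definition _ := [isSub for smooth_fun].
HB.instance Definition _ := [Choice of smooth by <:].
HB.instance Definition _ := GRing.SubChoice_isSubComPzRing.Build
  (M -> R) smooth_pred smooth smooth_pred_subring.
HB.instance Definition _ := [SubZmodule_isSubLmodule of smooth by <:].

(* Vector fields on M are derivations of C^oo(M), and p-forms on M are the
   C^oo(M)-multilinear skew-symmetric maps altform vfield p. *)
Definition derivation (X : smooth -> smooth) : Prop :=
  [/\ forall f g, X (f + g) = X f + X g,
      forall (r : R) f, X (r *: f) = r *: X f &
      forall f g, X (f * g) = X f * g + f * X g].

Definition vfield_pred : {pred smooth -> smooth^o} :=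
  fun X => `[< derivation X >].

Lemma smooth_scalerAl (r : R) (f g : smooth) : r *: (f * g) = (r *: f) * g.
Proof. by apply/val_inj/funext => x; exact: mulrA. Qed.

Lemma vfield_pred_closed : GRing.subsemimod_closed vfield_pred.
Proof.
split; first split.
- apply/asboolP; split=> [f g|r f|f g].
  + by change (0 = 0 + 0 :> smooth); rewrite addr0.
  + by change (0 = r *: 0 :> smooth); rewrite scaler0.
  + by change (0 = 0 * g + f * 0 :> smooth); rewrite mul0r mulr0 addr0.
- move=> X Y /asboolP[aX sX lX] /asboolP[aY sY lY]; apply/asboolP.
  split=> [f g|r f|f g].
  + change (X (f + g) + Y (f + g) = X f + Y f + (X g + Y g)).
    by rewrite aX aY addrACA.
  + change (X (r *: f) + Y (r *: f) = r *: ((X f + Y f) : smooth)).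
    by rewrite sX sY scalerDr.
  + change (X (f * g) + Y (f * g) = (X f + Y f : smooth) * g + f * (X g + Y g : smooth)).
    by rewrite lX lY mulrDl mulrDr addrACA.
- move=> a X /asboolP[aX sX lX]; apply/asboolP.
  split=> [f g|r f|f g].
  + change (a * X (f + g) = a * X f + a * X g).
    by rewrite aX mulrDr.
  + change (a * X (r *: f) = r *: (a * X f : smooth)).
    by rewrite sX mulrC -smooth_scalerAl mulrC.
  + change (a * X (f * g) = a * X f * g + f * (a * X g)).
    by rewrite lX mulrDr mulrA mulrCA.
Qed.
HB.instance Definition _ :=
  GRing.isSubmodClosed.Build smooth _ vfield_pred vfield_pred_closed.

Record vfield := VField {
  vfield_fun :> smooth -> smooth^o;
  vfieldP : vfield_fun \in vfield_pred }.
HB.instance Definition _ := [isSub for vfield_fun].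
HB.instance Definition _ := [Choice of vfield by <:].
HB.instance Definition _ := [SubChoice_isSubLmodule of vfield by <:].

Lemma bracket_subproof (X Y : vfield) :
  (fun f => X (Y f) - Y (X f)) \in vfield_pred.
Proof.
case: X Y => X /= /asboolP[aX sX lX] [Y /= /asboolP[aY sY lY]].
apply/asboolP; split=> [f g|r f|f g].
- by rewrite aX aY aX aY opprD addrACA.
- by rewrite sX sY sX sY scalerBr.
- rewrite lX lY aX aY !lX !lY mulrBl mulrBr.
  set a := X (Y f) * g; set b := Y f * X g; set c := X f * Y g.
  set d := f * X (Y g); set e := Y (X f) * g; set h := f * Y (X g).
  have ab : a + b - (e + b) = a - e by rewrite opprD addrACA subrr addr0.
  have cd : c + d - (c + h) = d - h by rewrite opprD addrACA subrr add0r.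
  by rewrite [e + c + _]addrACA opprD addrACA ab cd.
Qed.
Definition vbracket (X Y : vfield) : vfield := VField (bracket_subproof X Y).

Definition pair_vect {T : Type} (x y : T) : 'I_2 -> T :=
  fun k => tnth [tuple x; y] k.

(* (M, Omega) is symplectic: Omega is closed, and nondegenerate at each point x;
   tangent vectors at x are evaluations at x of vector fields. *)
Definition symplectic (Omega : altform vfield 2) : Prop :=
  closed_form (fun X : vfield => (X : smooth -> smooth)) vbracket Omega /\
  forall (x : M) (X : vfield),
    (forall Y : vfield, (Omega (pair_vect X Y) : smooth) x = 0) ->
    forall f, (X f : smooth) x = 0.

End SmoothFunctions.

Section NearPoints.
Context {R : realType} {n : nat} (M : manifold R n) (A : weilAlgebra R).

Definition near_at (xi : smooth M -> A) (x : M) : Prop :=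
  forall f : smooth M, xi f - (f x)%:A \in weil_max A.

Record near_point := NearPoint {
  near_fun :> {rmorphism smooth M -> A};
  near_scalable : scalable near_fun;
  near_base : exists x, near_at near_fun x }.

(* xi(u) for u only smooth near the base point x of xi (e.g. a local
   coordinate): the common value of xi at all g in C^oo(M) with the same germ
   as u at x. *)
Definition near_germ (xi : near_point) (u : M -> R) : A :=
  xget 0 [set a | exists x (g : smooth M),
    [/\ near_at xi x, \forall y \near x, g y = u y & a = xi g]].

(* (U; x_1, ..., x_n) |-> (U^A; xi |-> (xi(x_1), ..., xi(x_n))), where A^n is
   identified with R^(n * dim A) through a basis of A. *)
Definition near_chart (c : chart M 'rV[R]_n) :
    chart near_point 'M[R]_(n, \dim {:A}) :=
  ([set xi : near_point | exists2 x, c.1 x & near_at xi x],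
   fun xi => \matrix_(i, j)
     coord (vbasis {:A}) j (near_germ xi (fun y => c.2 y ord0 i))).

Definition near_atlas : set (chart near_point 'M[R]_(n, \dim {:A})) :=
  near_chart @` atlas M.

Definition smoothA_pred : {pred near_point -> A^o} :=
  fun F => `[< smooth_vect near_atlas (F : near_point -> A) >].

Lemma smoothA_pred_subring : subring_closed smoothA_pred.
Proof.
split.
- by apply/asboolP; exact: smooth_vect_cst.
- move=> f g /asboolP sf /asboolP sg; apply/asboolP.
  have := smooth_vectD sf (smooth_vectM (smooth_vect_cst (-1 : A)) sg).
  by under eq_fun do rewrite mulN1r.
- by move=> f g /asboolP sf /asboolP sg; apply/asboolP; exact: smooth_vectM.
Qed.
HB.instance Definition _ :=
  GRing.isSubringClosed.Build (near_point -> A^o) smoothA_pred smoothA_pred_subring.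

Lemma smoothA_pred_scale : GRing.scaler_closed smoothA_pred.
Proof.
move=> a f /asboolP sf; apply/asboolP.
exact: smooth_vectM (smooth_vect_cst (a : A)) sf.
Qed.
HB.instance Definition _ :=
  GRing.isScaleClosed.Build A (near_point -> A^o) smoothA_pred smoothA_pred_scale.

(* C^oo(M^A, A), as a commutative ring and an A-module. *)
Record smoothA := SmoothA {
  smoothA_fun :> near_point -> A^o;
  smoothAP : smoothA_fun \in smoothA_pred }.
HB.instance Definition _ := [isSub for smoothA_fun].
HB.instance Definition _ := [Choice of smoothA by <:].
HB.instance Definition _ := GRing.SubChoice_isSubComPzRing.Build
  (near_point -> A^o) smoothA_pred smoothA smoothA_pred_subring.
HB.instance Definition _ := [SubZmodule_isSubLmodule of smoothA by <:].

(* f^A. The default value 0 of insubd is irrelevant, as xi |-> xi(f) is smooth. *)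
Definition prolong_fun (f : smooth M) : smoothA :=
  insubd (0 : smoothA) (fun xi => xi f).

(* The real scalars act on C^oo(M^A, A) through R -> A. *)
Definition derivationA (X : smooth M -> smoothA) : Prop :=
  [/\ forall f g, X (f + g) = X f + X g,
      forall (r : R) f, X (r *: f) = (r%:A : A) *: X f &
      forall f g, X (f * g) = X f * prolong_fun g + prolong_fun f * X g].

Definition vfieldA_pred : {pred smooth M -> smoothA^o} :=
  fun X => `[< derivationA X >].

Lemma smoothA_scalerAr (a : A) (F G : smoothA) : a *: (F * G) = F * (a *: G).
Proof. by apply/val_inj/funext => xi; exact: mulrCA. Qed.

Lemma vfieldA_pred_closed : GRing.subsemimod_closed vfieldA_pred.
Proof.
split; first split.
- apply/asboolP; split=> [f g|r f|f g].
  + by change (0 = 0 + 0 :> smoothA); rewrite addr0.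
  + by change (0 = (r%:A : A) *: 0 :> smoothA); rewrite scaler0.
  + change (0 = 0 * prolong_fun g + prolong_fun f * 0 :> smoothA).
    by rewrite mul0r mulr0 addr0.
- move=> X Y /asboolP[aX sX lX] /asboolP[aY sY lY]; apply/asboolP.
  split=> [f g|r f|f g].
  + change (X (f + g) + Y (f + g) = X f + Y f + (X g + Y g)).
    by rewrite aX aY addrACA.
  + change (X (r *: f) + Y (r *: f) = (r%:A : A) *: (X f + Y f : smoothA)).
    by rewrite sX sY scalerDr.
  + change (X (f * g) + Y (f * g) =
      (X f + Y f : smoothA) * prolong_fun g + prolong_fun f * (X g + Y g : smoothA)).
    by rewrite lX lY mulrDl mulrDr addrACA.
- move=> F X /asboolP[aX sX lX]; apply/asboolP.
  split=> [f g|r f|f g].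
  + change (F * X (f + g) = F * X f + F * X g).
    by rewrite aX mulrDr.
  + change (F * X (r *: f) = (r%:A : A) *: (F * X f : smoothA)).
    by rewrite sX smoothA_scalerAr.
  + change (F * X (f * g) = F * X f * prolong_fun g + prolong_fun f * (F * X g)).
    by rewrite lX mulrDr mulrA mulrCA.
Qed.
HB.instance Definition _ :=
  GRing.isSubmodClosed.Build smoothA _ vfieldA_pred vfieldA_pred_closed.

Record vfieldA := VFieldA {
  vfieldA_fun :> smooth M -> smoothA^o;
  vfieldAP : vfieldA_fun \in vfieldA_pred }.
HB.instance Definition _ := [isSub for vfieldA_fun].
HB.instance Definition _ := [Choice of vfieldA by <:].
HB.instance Definition _ := [SubChoice_isSubLmodule of vfieldA by <:].

(* theta^A; the map is always a derivation, so the default is irrelevant. *)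
Definition prolong_vfield (theta : vfield M) : vfieldA :=
  insubd (0 : vfieldA) (fun f => prolong_fun (theta f)).

(* C^oo(M^A) inside C^oo(M^A, A). *)
Definition real_valued (F : smoothA) : Prop :=
  forall xi, exists r : R, F xi = (r%:A : A).

Record is_extension (X : vfieldA) (D : smoothA -> smoothA) : Prop := {
  extension_linear : linear D;
  extension_leibniz : forall F G, D (F * G) = D F * G + F * D G;
  extension_real : forall F, real_valued F -> real_valued (D F);
  extension_prolong : forall f, D (prolong_fun f) = X f }.

(* The definite description of the unique such D; fun=> 0 is a dummy default. *)
Definition extension (X : vfieldA) : smoothA -> smoothA :=
  xget (fun=> 0) [set D | is_extension X D].

(* The map is always a derivation, so the default is irrelevant. *)
Definition vbracketA (X Y : vfieldA) : vfieldA :=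
  insubd (0 : vfieldA) (fun f => extension X (Y f) - extension Y (X f)).

Definition is_prolong_form p (w : altform (vfield M) p) (wA : altform vfieldA p)
    : Prop :=
  forall theta : 'I_p -> vfield M,
    wA (fun k => prolong_vfield (theta k)) = prolong_fun (w theta).

(* The definite description of w^A; 0 is a dummy default. *)
Definition prolong_form p (w : altform (vfield M) p) : altform vfieldA p :=
  xget 0 [set wA | is_prolong_form w wA].

Definition symplecticA (OmegaA : altform vfieldA 2) : Prop :=
  [/\ closed_form extension vbracketA OmegaA,
      linear (interior_product OmegaA) & bijective (interior_product OmegaA)].

End NearPoints.

(* Main.v *)
(* A near point at [x] depends only on the Taylor expansion at [x] truncated at
   the nilpotency order of the maximal ideal (Hadamard's lemma), so that a chart of
   M identifies the near points over its domain with the tuples of elements of [A]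
   whose real parts are the coordinates of a point. A derivation along a near point
   is likewise determined by its values on local coordinates; hence a vector field
   X on M^A satisfies X = sum_i X(x_i) d_i^A, and it extends to functions on M^A as
   the directional derivative with components X(x_i).

   Locally Omega^A(X, Y) = sum_ij X(x_i) Y(x_j) omega_ij^A. The real part of the
   matrix omega_ij^A is invertible, which makes X |-> Omega^A(X, .) bijective. In
   d^A Omega^A the derivatives of the components X(x_i) cancel, and what remains is
   the prolongation of the local coefficients of d Omega, which vanish. *)
Require Import Defs.
From HB Require Import structures.
From mathcomp Require Import all_boot all_order all_algebra.
From mathcomp Require Import fingroup perm.
From mathcomp Require Import all_classical all_reals all_analysis.
From mathcomp Require Import zify ring lra.
Set Implicit Arguments.
Unset Strict Implicit.
Unset Printing Implicit Defensive.
Import Order.TTheory GRing.Theory Num.Theory.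
Import numFieldNormedType.Exports.
Local Open Scope classical_set_scope.
Local Open Scope ring_scope.

(** * Calculus of C^k maps *)

Section Calculus.
Context {R : realType}.

(** Vector fields and near points act only on globally defined functions, and forms only on globally
    defined fields. Local computations are therefore phrased with global objects: functions and
    fields that agree with coordinates and coordinate fields near a point, and expansions that
    become global identities after multiplication by a bump function. Smoothness is given as
    continuity of iterated directional derivatives. The chain rule is thus derived from the mean
    value theorem, one coordinate at a time, and the remainders in Hadamard's lemma are integrals to
    be differentiated under the integral sign. The extension of a field and the prolongation of the
    form are definite descriptions; each is reached by constructing one object with the defining
    properties. The form is built at each near point from an arbitrarily chosen frame, and
    independence of the frame makes it smooth. Injectivity of X |-> Omega^A(X, .) is proved at every
    single near point, so that local solutions of Omega^A(X, .) = eta agree where they meet. *)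

Lemma is_derive_line {V W : normedModType R} (f : V -> W) (z v : V) (k : R) :
  derivable f (z + k *: v) v ->
  is_derive k 1 (fun t => f (z + t *: v)) ('D_v f (z + k *: v)).
Proof.
have e : (fun h : R => h^-1 *: (((fun t => f (z + t *: v)) \o shift k) (h *: 1)
    - f (z + k *: v))) =
  (fun h : R => h^-1 *: ((f \o shift (z + k *: v)) (h *: v) - f (z + k *: v))).
  apply/funext => h /=; do 3 f_equal.
  by rewrite [h *: 1]mulr1 scalerDl addrCA addrA.
by move=> df; apply: DeriveDef; rewrite /derivable /derive e.
Qed.

(** The intermediate parameter is located only by |c| <= |s|, so that one statement covers both
    signs of [s]. *)
Lemma mean_value_dir {V : normedModType R} (f : V -> R) (z v : V) (s : R) :
  (forall c : R, `|c| <= `|s| -> derivable f (z + c *: v) v) ->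
  exists2 c : R, `|c| <= `|s| & f (z + s *: v) - f z = s * 'D_v f (z + c *: v).
Proof.
move=> df; pose g (t : R) := f (z + t *: v).
have g0 : g 0 = f z by rewrite /g scale0r addr0.
have dg (c : R) : `|c| <= `|s| -> is_derive c 1 g ('D_v f (z + c *: v)).
  by move=> cs; apply: is_derive_line; exact: df.
have [s0|s0] := leP 0 s.
- have [||c] := @MVT_segment R g (fun c => 'D_v f (z + c *: v)) 0 s s0.
  + move=> x /[!in_itv]/= /andP[x0 xs]; apply: dg.
    by rewrite ger0_norm 1?ltW// ger0_norm// ltW.
  + apply: derivable_within_continuous => x /[!in_itv]/= /andP[x0 xs].
    by apply: ex_derive; apply: dg; rewrite !ger0_norm.
  rewrite in_itv/= => /andP[c0 cs]; rewrite subr0 g0 mulrC => e.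
  by exists c => //; rewrite !ger0_norm.
- have [||c] := @MVT_segment R g (fun c => 'D_v f (z + c *: v)) s 0 (ltW s0).
  + move=> x /[!in_itv]/= /andP[x0 xs]; apply: dg.
    by rewrite !ltr0_norm// lerN2 ltW.
  + apply: derivable_within_continuous => x /[!in_itv]/= /andP[x0 xs].
    by apply: ex_derive; apply: dg; rewrite ler0_norm// ltr0_norm// lerN2.
  rewrite in_itv/= => /andP[c0 cs]; rewrite sub0r g0 mulrN mulrC => e.
  exists c; first by rewrite ler0_norm// ltr0_norm// lerN2.
  by rewrite -opprB e opprK.
Qed.

(** The mean value theorem writes the increment as [s t] times ['D_v f] at a point that tends to
    [b], and ['D_v f] is continuous there. The base point [z t] moves because, in an increment along
    several directions, the other directions have already been travelled. *)
Lemma increment_cvg {V : normedModType R} (O : set V) (f : V -> R) (b v : V)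
    (z : R -> V) (s : R -> R) (c : R) :
  open O -> Ck 1 O f -> O b -> z t @[t --> 0^'] --> b ->
  t^-1 * s t @[t --> 0^'] --> c ->
  t^-1 * (f (z t + s t *: v) - f (z t)) @[t --> 0^'] --> c * 'D_v f b.
Proof.
move=> oO /CkP[_ df] Ob zb sc; have [dfv /Ck0 cDf] := df v.
have s0 : s t @[t --> 0^'] --> 0.
  have E : {near (0 : R)^', (fun t => t * (t^-1 * s t)) =1 s}.
    near=> t; rewrite mulrA divff ?mul1r//; near: t; exact: nbhs_dnbhs_neq.
  apply: cvg_trans (near_eq_cvg E) _.
  have := cvgM (@nbhs_dnbhs _ (0 : R)) sc; rewrite mul0r; exact.
(* All points between [z t] and [z t + s t *: v] are close to [b]; this serves both to stay inside
   [O] and to control the mean value point. *)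
have Q d : 0 < d -> \forall t \near 0^', forall x, `|x| <= `|s t| ->
    `|b - (z t + x *: v)| < d.
  move=> d0; have d20 : 0 < d / 2 by rewrite divr_gt0.
  have sv0 : s t *: v @[t --> (0:R)^'] --> (0 : V).
    by rewrite -(scale0r v); exact: cvgZr_tmp.
  have zd := (cvgrPdist_lt _ _).1 zb _ d20.
  have svd := (cvgrPdist_lt _ _).1 sv0 _ d20.
  near=> t => x xs.
  rewrite opprD addrA (le_lt_trans (ler_normB _ _))// (splitr d) ltrD//.
    by near: t; exact: zd.
  rewrite normrZ (le_lt_trans (ler_wpM2r _ xs))//.
  rewrite -normrZ -normrN -sub0r.
  by near: t; exact: svd.
have /nbhs_ballP[r/= r0 rO] : nbhs b O by exact: open_nbhs_nbhs.
have inO : \forall t \near (0 : R)^', forall x, `|x| <= `|s t| -> O (z t + x *: v).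
  by apply: filterS (Q _ r0) => t H x /H; rewrite -ball_normE in rO; exact: rO.
(* The mean value formula holds only once the segment lies in [O]; keeping that as a premise makes
   the choice of [x] total in [t]. *)
have X t : exists x, `|x| <= `|s t| /\
    ((forall x, `|x| <= `|s t| -> O (z t + x *: v)) ->
    f (z t + s t *: v) - f (z t) = s t * 'D_v f (z t + x *: v)).
  have [P|nP] := pselect (forall x, `|x| <= `|s t| -> O (z t + x *: v)).
    by have [x xs e] := mean_value_dir (fun c cs => dfv _ (P c cs)); exists x.
  by exists 0; rewrite normr0; split.
have [x xP] := boolp.choice X.
have E : {near (0 : R)^', (fun t => (t^-1 * s t) * 'D_v f (z t + x t *: v)) =1
     (fun t => t^-1 * (f (z t + s t *: v) - f (z t)))}.
  by apply: filterS inO => t /(xP t).2 ->; rewrite mulrA.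
apply: cvg_trans (near_eq_cvg E) _; apply: cvgM sc _.
apply: (cvg_comp (fun t => z t + x t *: v) ('D_v f)); last exact: cDf.
apply/cvgrPdist_lt => d d0; near=> t.
have := near (Q _ d0) t; apply => //; exact: (xP t).1.
Unshelve. all: by end_near. Qed.

(** Telescoping: the increments are added one at a time, and each step is [increment_cvg] at a base
    point that still depends on [t]. *)
Lemma increment_sum_cvg {V : normedModType R} (I : Type) (r : seq I)
    (O : set V) (f : V -> R) (b : V) (v : I -> V) (s : I -> R -> R) (c : I -> R) :
  open O -> Ck 1 O f -> O b ->
  (forall i, t^-1 * s i t @[t --> (0 : R)^'] --> c i) ->
  t^-1 * (f (b + \sum_(i <- r) s i t *: v i) - f b) @[t --> (0 : R)^'] -->
    \sum_(i <- r) c i * 'D_(v i) f b.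
Proof.
move=> oO Cf Ob sc.
have s0 i : s i t @[t --> (0 : R)^'] --> (0 : R).
  have E : {near (0 : R)^', (fun t => t * (t^-1 * s i t)) =1 s i}.
    near=> t; rewrite mulrA divff ?mul1r//; near: t; exact: nbhs_dnbhs_neq.
  apply: cvg_trans (near_eq_cvg E) _.
  have := cvgM (@nbhs_dnbhs _ (0 : R)) (sc i); rewrite mul0r; exact.
have z0 (q : seq I) : b + \sum_(i <- q) s i t *: v i @[t --> (0 : R)^'] --> b.
  elim: q => [|i q IH].
    by under eq_fun do rewrite big_nil addr0; exact: cvg_cst.
  under eq_fun do rewrite big_cons addrCA.
  have sv0 : s i t *: v i @[t --> (0 : R)^'] --> (0 : V).
    by rewrite -(scale0r (v i)); exact: cvgZr_tmp.
  have := cvgD sv0 IH; rewrite add0r; exact.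
elim: r => [|i r IH].
  under eq_fun do rewrite !big_nil addr0 subrr mulr0.
  by rewrite big_nil; exact: cvg_cst.
rewrite big_cons.
have -> : (fun t => t^-1 * (f (b + \sum_(j <- i :: r) s j t *: v j) - f b)) =
  (fun t => t^-1 * (f (b + \sum_(j <- r) s j t *: v j + s i t *: v i)
       - f (b + \sum_(j <- r) s j t *: v j))) +
  (fun t => t^-1 * (f (b + \sum_(j <- r) s j t *: v j) - f b)).
  apply/funext => t; rewrite fctE -mulrDr subrKA; congr (_ * (f _ - _)).
  by rewrite big_cons addrCA addrC.
apply: cvgD IH; exact: increment_cvg oO Cf Ob (z0 r) (sc i).
Unshelve. all: by end_near. Qed.

(** The increment of [T] is split along the elementary matrices, so that continuity of the
    directional derivatives of [f] replaces total differentiability. *)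
Lemma is_derive_comp_mx {V : normedModType R} {m n : nat}
    (T : V -> 'M[R]_(m, n)) (O : set 'M[R]_(m, n)) (f : 'M[R]_(m, n) -> R)
    (x v : V) :
  open O -> Ck 1 O f -> O (T x) ->
  (forall i j, derivable (fun y => T y i j) x v) ->
  is_derive x v (f \o T)
    (\sum_i \sum_j 'D_v (fun y => T y i j) x * 'D_(delta_mx i j) f (T x)).
Proof.
move=> oO Cf OTx dT.
pose s (p : 'I_m * 'I_n) (t : R) := T (t *: v + x) p.1 p.2 - T x p.1 p.2.
have := @increment_sum_cvg _ _ (index_enum _) O f (T x) (fun p => delta_mx p.1 p.2)
  s (fun p => 'D_v (fun y => T y p.1 p.2) x) oO Cf OTx.
have -> : (fun t : R => t^-1 * (f (T x + \sum_p s p t *: delta_mx p.1 p.2) - f (T x)))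
  = (fun t : R => t^-1 *: (((f \o T) \o shift x) (t *: v) - (f \o T) x)).
  apply/funext => t /=; congr (_ * (f _ - _)).
  rewrite -(pair_bigA _ (fun i j => s (i, j) t *: delta_mx i j))/=.
  rewrite -[X in X = _]addrC -[RHS](subrK (T x)); congr (_ + _).
  rewrite [RHS]matrix_sum_delta; do 2 (apply: eq_bigr => ? _).
  by rewrite !mxE.
rewrite -(pair_bigA _ (fun i j => 'D_v (fun y => T y i j) x * 'D_(delta_mx i j) f (T x)))/=.
move=> H; have {}H := H (fun p => dT p.1 p.2).
by apply: DeriveDef; [apply/cvg_ex; eexists; exact: H | exact/cvg_lim].
Qed.

Lemma Ck_sum {V : normedModType R} (I : Type) (r : seq I) k (O : set V)
    (f : I -> V -> R) :
  open O -> (forall i, Ck k O (f i)) -> Ck k O (fun x => \sum_(i <- r) f i x).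
Proof.
move=> oO Cf; elim: r => [|i r IH].
  by under eq_fun do rewrite big_nil; exact: Ck_cst.
by under eq_fun do rewrite big_cons; exact: CkD.
Qed.

Lemma cvg_mx {T : Type} (F : set_system T) {FF : Filter F} {m n : nat}
    (f : T -> 'M[R]_(m, n)) (l : 'M[R]_(m, n)) :
  (forall i j, f x i j @[x --> F] --> l i j) -> f @ F --> l.
Proof.
move=> fl; apply/cvgrPdist_le => /= e e0; near=> x.
rewrite [leLHS]mx_normrE (bigmax_le _ (ltW e0))//= => i _; rewrite !mxE/=.
move: i; near: x; apply: filter_forall => /= i.
exact: (cvgrPdist_le _ _).1 (fl i.1 i.2) _ e0.
Unshelve. all: by end_near. Qed.

(** By the chain rule the derivative is a sum of products of derivatives of entries of [T] with
    composites of partial derivatives of [f]. Smoothness of every order is asked of [f] so that the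
    hypothesis passes unchanged to these partial derivatives. *)
Lemma Ck_comp {V : normedModType R} {m n : nat} k (Q : set V)
    (T : V -> 'M[R]_(m, n)) (O : set 'M[R]_(m, n)) (f : 'M[R]_(m, n) -> R) :
  open Q -> open O -> (forall x, Q x -> O (T x)) ->
  (forall i j, Ck k Q (fun y => T y i j)) -> (forall k, Ck k O f) ->
  Ck k Q (f \o T).
Proof.
move=> oQ oO QO.
elim: k f => [|k IH] f CT Cf.
  split=> // x Qx; apply: (cvg_comp T f); last exact: Ck0 (Cf 0) _ (QO _ Qx).
  by apply: cvg_mx => i j; exact: Ck0 (CT i j) x Qx.
have dT x v : Q x -> is_derive x v (f \o T)
    (\sum_i \sum_j 'D_v (fun y => T y i j) x * 'D_(delta_mx i j) f (T x)).
  move=> Qx; apply: is_derive_comp_mx oO (Cf 1) (QO _ Qx) _ => i j.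
  by have /CkP[_ /(_ v)[dTv _]] := CT i j; exact: dTv.
apply/CkP; split=> [x Qx|v].
  apply: (cvg_comp T f); last exact: Ck0 (Cf 0) _ (QO _ Qx).
  by apply: cvg_mx => i j; exact: Ck0 (CT i j) x Qx.
split=> [x Qx|]; first by case: (dT x v Qx).
apply: (@Ck_eq _ _ _ _ _ (fun x => \sum_i \sum_j
    'D_v (fun y => T y i j) x * 'D_(delta_mx i j) f (T x))) => // [x Qx|].
  by case: (dT x v Qx) => _ ->.
apply: Ck_sum => // i; apply: Ck_sum => // j; apply: CkM => //.
  by have /CkP[_ /(_ v)[]] := CT i j.
apply: (IH ('D_(delta_mx i j) f)) => [i' j'|k']; first exact: Ck_pred.
by have /CkP[_ /(_ (delta_mx i j))[]] := Cf k'.+1.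

Qed.
End Calculus.

(** * Smoothness of entries, inverses and the flat functions x^-j exp(-1/x) *)

Section FlatFunctions.
Context {R : realType}.

(** Restriction to the line through [x] along [v] reduces this to the one-variable chain rule. *)
Lemma is_derive_comp1 {V : normedModType R} (g : V -> R) (e : R -> R)
    (x v : V) (dg de : R) :
  is_derive x v g dg -> is_derive (g x) 1 e de -> is_derive x v (e \o g) (dg * de).
Proof.
move=> [cg <-] He.
pose l (h : R) := g (x + h *: v).
have [cl Dl] : is_derive (0 : R) 1 l ('D_v g x).
  rewrite -[X in 'D_v g X](addr0 x) -(scale0r v); apply: is_derive_line.
  by rewrite scale0r addr0.
have [ce De] : is_derive (l 0) 1 e de by rewrite /l scale0r addr0.
have [cel Del] : is_derive (0 : R) 1 (e \o l) ('D_v g x * de).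
  by rewrite mulrC; exact: is_derive1_comp (DeriveDef ce De) (DeriveDef cl Dl).
have E : (fun h : R => h^-1 *: (((e \o l) \o shift 0) (h *: 1) - (e \o l) 0)) =
    (fun h : R => h^-1 *: (((e \o g) \o shift x) (h *: v) - (e \o g) x)).
  apply/funext => h /=; rewrite addr0 /l scale0r addr0 [h *: 1]mulr1.
  by rewrite [x + _]addrC.
by apply: DeriveDef; rewrite /derivable /derive -E.
Qed.

Lemma is_derive_coord {m n : nat} i j (x v : 'M[R]_(m, n)) :
  is_derive x v (fun y : 'M[R]_(m, n) => y i j) (v i j).
Proof.
apply: DeriveDef; first exact: (derivable_mxP id _ _).1.
have := @derive_mx R _ _ _ (id : 'M[R]_(m, n) -> _) x v (@derivable_id _ _ _ _).
by rewrite derive_id => /matrixP/(_ i j); rewrite mxE.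
Qed.

Lemma derive_coord {m n : nat} i j (x v : 'M[R]_(m, n)) :
  'D_v (fun y : 'M[R]_(m, n) => y i j) x = v i j.
Proof. by case: (is_derive_coord i j x v). Qed.

Lemma derive_sum_coord {m n : nat} (O : set 'M[R]_(m, n)) (F : 'M[R]_(m, n) -> R)
    (x v : 'M[R]_(m, n)) : open O -> Ck 1 O F -> O x ->
  'D_v F x = \sum_i \sum_j v i j * 'D_(delta_mx i j) F x.
Proof.
move=> oO CF Ox; have := @is_derive_comp_mx _ _ _ _ id O F x v oO CF Ox.
move=> [|_ /= ->]; first by move=> i j; case: (is_derive_coord i j x v).
by apply: eq_bigr => i _; apply: eq_bigr => j _; rewrite derive_coord.
Qed.

Lemma Ck_coord {m n : nat} k (O : set 'M[R]_(m, n)) i j :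
  Ck k O (fun x : 'M[R]_(m, n) => x i j).
Proof.
case: k => [|k]; first by split=> // x _; exact: coord_continuous.
apply/CkP; split=> [x _|v]; first exact: coord_continuous.
split=> [x _|]; first by case: (is_derive_coord i j x v).
rewrite (_ : 'D_v _ = cst (v i j)); first exact: Ck_cst.
by apply/funext => x; exact: derive_coord.
Qed.

Lemma Ck_entry {V : normedModType R} {m n : nat} k (O : set V)
    (f : V -> 'M[R]_(m, n)) i j :
  open O -> Ck k O f -> Ck k O (fun x => f x i j).
Proof.
move=> oO; elim: k f => [|k IH] f Cf.
  by split=> // x Ox; apply: (cvg_comp f (fun y => y i j));
    [exact: Ck0 Cf _ Ox|exact: coord_continuous].
have [cf df] := (Ck0 Cf, Cf.2); apply/CkP; split=> [x Ox|v].
  by apply: (cvg_comp f (fun y => y i j)); [exact: cf|exact: coord_continuous].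
have [dfv Cfv] := df v; split=> [x Ox|]; first exact: (derivable_mxP _ _ _).1 (dfv _ Ox) i j.
apply: Ck_eq (IH _ Cfv) => // x Ox.
by rewrite derive_mx ?mxE//; exact: dfv.
Qed.

Lemma Ck_inv {V : normedModType R} k (O : set V) (f : V -> R) :
  open O -> (forall x, O x -> f x != 0) -> Ck k O f -> Ck k O (fun x => (f x)^-1).
Proof.
move=> oO f0; elim: k => [|k IH] Cf.
  by split=> // x Ox; apply: cvgV; [exact: f0|exact: Ck0 Cf _ Ox].
have [cf df] := (Ck0 Cf, Cf.2); apply/CkP; split=> [x Ox|v].
  by apply: cvgV; [exact: f0|exact: cf].
have [dfv Cfv] := df v; split=> [x Ox|].
  by apply: derivableV; [exact: f0|exact: dfv].
apply: (@Ck_eq _ _ _ _ _ (fun x => (-1) * ((f x)^-1 * (f x)^-1 * 'D_v f x))) => //.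
  move=> x Ox; rewrite deriveV; [|exact: f0|exact: dfv].
  by rewrite /GRing.scale/= expr2 invfM mulN1r mulNr.
have Ci := IH (Ck_pred Cf).
by apply: CkM => //; [exact: Ck_cst|do 2 apply: CkM => //].
Qed.

(* A family of flat functions closed under differentiation. *)
Definition flat (j : nat) (x : R) : R :=
  if 0 < x then x^-1 ^+ j * expR (- x^-1) else 0.

Lemma flat_le0 j x : x <= 0 -> flat j x = 0.
Proof. by rewrite /flat leNgt => /negbTE ->. Qed.

Lemma flat_gt0 j x : 0 < x -> 0 < flat j x.
Proof. by rewrite /flat => x0; rewrite x0 mulr_gt0 ?expR_gt0 ?exprn_gt0 ?invr_gt0. Qed.

(** With y = 1/x > 0, the exponential series gives e^y >= y^(j+1)/(j+1)!, hence y^j e^(-y) <=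
    (j+1)!/y. The bound is linear in x, which gives the limit 0 at the origin. *)
Lemma norm_flat_le j x : `|flat j x| <= j.+1`!%:R * `|x|.
Proof.
have [x0|x0] := leP x 0; first by rewrite flat_le0// normr0 mulr_ge0.
rewrite !gtr0_norm// ?flat_gt0// /flat x0 expRN.
have y0 : 0 < x^-1 by rewrite invr_gt0.
rewrite ler_pdivrMr ?expR_gt0//.
have /(le_trans _) := expR_ge1Dxn j (ltW y0) => H.
apply: (@le_trans _ _ (j.+1`!%:R * x * (x^-1 ^+ j.+1 / j.+1`!%:R))); last first.
  by rewrite ler_pM2l ?mulr_gt0 ?ltr0n ?fact_gt0//; apply: H; rewrite lerDr.
rewrite exprS; have : j.+1`!%:R != 0 :> R by rewrite pnatr_eq0 -lt0n fact_gt0.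
move: (x^-1 ^+ j) (j.+1`!%:R) => y c c0; rewrite le_eqVlt; apply/orP; left; apply/eqP.
by field; rewrite c0 gt_eqF.
Qed.

Lemma cvg_flat0 j : flat j x @[x --> (0 : R)] --> (0 : R).
Proof.
apply: norm_cvg0; apply: (@squeeze_cvgr _ _ _ _ (cst 0) (fun x => j.+1`!%:R * `|x|)).
- by apply: nearW => x; rewrite normr_ge0 norm_flat_le.
- exact: cvg_cst.
- rewrite -[X in _ --> X](mulr0 j.+1`!%:R); apply: cvgM; first exact: cvg_cst.
  by rewrite -[X in _ --> X](normr0 R); exact: cvg_norm.
Qed.

Lemma is_derive_flat j (x : R) : is_derive x 1 (flat j) (flat j.+2 x - j%:R * flat j.+1 x).
Proof.
have [x0|x0|->] := ltgtP x 0.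
- rewrite !flat_le0 ?ltW// mulr0 subrr.
  apply: (@near_eq_is_derive _ _ _ (cst 0)).
    by near=> y; rewrite flat_le0// ltW//; near: y; exact: lt_nbhsl.
- apply: (@near_eq_is_derive _ _ _ (fun y : R => (y^-1 ^+ j * expR (- y^-1) : R)) _ x 1).

  + by near=> y; rewrite /flat ifT//; near: y; exact: lt_nbhsr.
  have dV : is_derive x 1 (fun y : R => y^-1) (- x ^- 2 *: 1).
    by apply: is_deriveV; rewrite ?gt_eqF.
  have dN : is_derive x 1 (fun y : R => - y^-1) (- (- x ^- 2 *: 1)).
    exact: is_deriveN.
  have dE := is_derive_comp1 dN (is_derive_expR (- x^-1)).
  have dX := is_deriveX j dV.
  have := is_deriveM dX dE.
  rewrite (_ : _ * (expR \o _) = fun y : R => (y^-1 ^+ j * expR (- y^-1) : R)); last first.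
    by apply/funext => y; rewrite !fctE.
  case=> H1 H2; apply: DeriveDef; first exact: H1.
  rewrite H2.
  rewrite /flat x0 !fctE /= /GRing.scale/= !mulr1 opprK.
  case: (j) => [|i]; rewrite ?mul0r ?subr0 ?addr0 ?mulr0 ?expr0 ?mul1r -?exprVn ?expr2//.
    by rewrite addr0.
  rewrite -pred_Sn !exprS; ring.
- rewrite !flat_le0// mulr0 subrr.
  (* At the origin the difference quotient of [flat j] is [flat j.+1] itself, which tends to 0. *)
  have L : h^-1 *: ((flat j \o shift 0) (h *: 1) - flat j 0) @[h --> (0:R)^'] --> (0:R).
    have E : {near (0 : R)^', flat j.+1 =1
        (fun h => h^-1 *: ((flat j \o shift 0) (h *: 1) - flat j 0))}.
      near=> h; rewrite /= (flat_le0 j (lexx 0)) subr0 addr0 [h *: 1]mulr1.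
      by rewrite /flat; case: ifP; rewrite ?scaler0// exprS -mulrA.
    apply: cvg_trans (near_eq_cvg E) _.
    exact: cvg_within_filter (@cvg_flat0 _).
  by apply: DeriveDef; [apply/cvg_ex; exists 0; exact: L | exact/cvg_lim].
Unshelve. all: by end_near. Qed.

Lemma continuous_flat j : continuous (flat j).
Proof.
move=> x; apply/differentiable_continuous/derivable1_diffP.
by case: (is_derive_flat j x).
Qed.

Lemma Ck_flat {V : normedModType R} k j (O : set V) (g : V -> R) :
  open O -> Ck k O g -> Ck k O (flat j \o g).
Proof.
move=> oO; elim: k j => [|k IH] j Cg.
  split=> // x Ox; apply: (cvg_comp g (flat j)); first exact: Ck0 Cg _ Ox.
  exact: continuous_flat.
have [cg dg] := (Ck0 Cg, Cg.2); apply/CkP; split=> [x Ox|v].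
  apply: (cvg_comp g (flat j)); first exact: cg.
  exact: continuous_flat.
have [dgv Cgv] := dg v; have C' := Ck_pred Cg.
have H x : O x -> is_derive x v (flat j \o g)
    ('D_v g x * (flat j.+2 (g x) - j%:R * flat j.+1 (g x))).
  move=> Ox; apply: is_derive_comp1; last exact: is_derive_flat.
  by apply: DeriveDef => //; exact: dgv.
split=> [x Ox|]; first by case: (H x Ox).
apply: (@Ck_eq _ _ _ _ _ ('D_v g * ((flat j.+2 \o g) +
    (cst (- j%:R)) * (flat j.+1 \o g)))) => //.
  by move=> x Ox; case: (H x Ox) => _ ->; rewrite !fctE mulNr.
by apply: CkM => //; apply: CkD => //; [exact: IH|apply: CkM => //; [exact: Ck_cst|exact: IH]].
Qed.

End FlatFunctions.

(** * Bump functions and Hadamard's lemma *)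

Section BumpMx.
Context {R : realType} {m n : nat}.

Lemma bump_mx (p : 'M[R]_(m, n)) (r : R) : 0 < r ->
  exists b : 'M[R]_(m, n) -> R, [/\ forall k O, open O -> Ck k O b,
    \forall x \near p, b x = 1 & forall x, r <= `|x - p| -> b x = 0].
Proof.
(* The norm of matrices is the maximum of the entries and is not smooth; [q] is smooth and dominates
   its square. *)
move=> r0; pose q (x : 'M[R]_(m, n)) : R := \sum_i \sum_j (x i j - p i j) ^+ 2.
have Cq k O : open O -> Ck k O q.
  move=> oO; apply: Ck_sum => // i; apply: Ck_sum => // j.
  have C : Ck k O (fun x : 'M[R]_(m, n) => x i j - p i j).
    by apply: CkD => //; [exact: Ck_coord|exact: Ck_cst].
  have := CkM oO C C; exact.
pose s := r ^+ 2 / 2.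
have r20 : 0 < r ^+ 2 by rewrite exprn_gt0.
have sr : s < r ^+ 2 by rewrite /s; lra.
have s0 : 0 < s by rewrite divr_gt0// exprn_gt0.
(* The bump is flat(r^2 - q) divided by [D]. Since s < r^2, the two terms of [D] never vanish
   together, and the second one vanishes where q <= s, so that the quotient is 1 near [p]. *)
pose D x := flat 0 (r ^+ 2 - q x) + flat 0 (q x - s).
have D0 x : 0 < D x.
  have fge t : 0 <= flat 0 t :> R.
    by have [/flat_le0->|/(flat_gt0 0)/ltW] := leP t 0.
  have [h|h] := ltP (q x) (r ^+ 2).
    by rewrite ltr_pwDl// flat_gt0// subr_gt0.
  by rewrite ltr_pwDr// flat_gt0// subr_gt0 (lt_le_trans sr h).
have CN k O : open O -> Ck k O (fun x => flat 0 (r ^+ 2 - q x)).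
  move=> oO; apply: (@Ck_flat _ _ k 0 O (fun x => r ^+ 2 - q x)) => //.
  apply: (@CkD _ _ _ k O (cst (r ^+ 2)) (- q)) => //; first exact: Ck_cst.
  have := CkM oO (Ck_cst k O (-1 : R)) (Cq k O oO).
  by rewrite (_ : cst (-1) * q = - q)// funeqE => y; rewrite !fctE mulN1r.
exists (fun x => flat 0 (r ^+ 2 - q x) * (D x)^-1); split.
- move=> k O oO; apply: CkM => //; first exact: CN.
  apply: Ck_inv => // [x _|]; first by rewrite gt_eqF.
  apply: CkD => //; first exact: CN.
  apply: (@Ck_flat _ _ k 0 O (fun x => q x - s)) => //.
  by apply: CkD => //; [exact: Cq|exact: Ck_cst].
- have qp : q p = 0.
    by rewrite /q big1// => i _; rewrite big1// => j _; rewrite subrr expr0n.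
  have : q x @[x --> p] --> q p by exact: Ck0 (Cq 0 setT openT) p I.
  rewrite qp => qp0; near=> x.
  have qs : q x < s by near: x; exact: (cvgr_lt 0).
  have h0 : flat 0 (q x - s) = 0 by rewrite flat_le0// subr_le0 ltW.
  by rewrite /D h0 addr0 divff// gt_eqF// flat_gt0// subr_gt0 (lt_trans qs).
- move=> x rx; rewrite flat_le0 ?mul0r// subr_le0.
  have xp0 : `|x - p| != 0 by rewrite gt_eqF// (lt_le_trans r0).
  have [ij e] := mx_norm_neq0 xp0.
  have rx' : r <= `|x ij.1 ij.2 - p ij.1 ij.2|.
    by apply: le_trans rx _; rewrite [leLHS]e !mxE.
  apply: (@le_trans _ _ ((x ij.1 ij.2 - p ij.1 ij.2) ^+ 2)).
    by rewrite -[leRHS]real_normK ?num_real// ler_pXn2r// nnegrE ltW.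
  rewrite /q (bigD1 ij.1)//= (bigD1 ij.2)//= -addrA lerDl.
  by rewrite addr_ge0// sumr_ge0// => *; rewrite ?sumr_ge0// => *; rewrite sqr_ge0.
Unshelve. all: by end_near. Qed.

End BumpMx.

Section Hadamard.
Context {R : realType} {V : normedModType R}.
Local Notation mu := (@lebesgue_measure R).
Variables (O : set V) (p : V).
Hypothesis oO : open O.
Hypothesis starO : forall x (t : R), O x -> 0 <= t <= 1 -> O (p + t *: (x - p)).

(** The weight t^j closes the family under differentiation: each derivative under the integral sign
    brings out one factor t. *)
Definition radial_mean (j : nat) (F : V -> R) (x : V) : R :=
  \int[mu]_(t in `[0, 1]) (t ^+ j * F (p + t *: (x - p))).

(** Uniformity in [t] comes from compactness of [0, 1], used in its near-covering form. *)
Lemma near_segment (F : V -> R) (x : V) (e : R) :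
  (forall y, O y -> {for y, continuous F}) -> O x -> 0 < e ->
  \forall y \near x, forall t : R, 0 <= t <= 1 ->
    `|F (p + t *: (y - p)) - F (p + t *: (x - p))| < e.
Proof.
move=> cF Ox e0.
have K : near_covering (`[0 : R, 1] : set R).
  exact/compact_near_coveringP/segment_compact.
have := K V (nbhs x) (fun y t => `|F (p + t *: (y - p)) - F (p + t *: (x - p))| < e) _.
move=> H; apply: filterS (H _ _) => [y Hy t t01|t].
  by apply: Hy; rewrite /= in_itv.
rewrite /= in_itv/= => t01.
have C (g : R * V -> V) : g z @[z --> (t, x)] --> x ->
    F (p + z.1 *: (g z - p)) @[z --> (t, x)] --> F (p + t *: (x - p)).
  move=> gx; apply: (cvg_comp (fun z : R * V => p + z.1 *: (g z - p)) F).
    by apply: cvgD; [exact: cvg_cst|apply: cvgZ; [exact: cvg_fst|exact: cvgB gx (cvg_cst _)]].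
  exact: cF (starO Ox t01).
have e20 : 0 < e / 2 by rewrite divr_gt0.
have C1 := (cvgrPdist_lt _ _).1 (C snd cvg_snd) _ e20.
have C2 := (cvgrPdist_lt _ _).1 (C (cst x) (@cvg_cst _ _ _ _ _)) _ e20.
near=> z.
rewrite -(subrKA (F (p + t *: (x - p)))) (le_lt_trans (ler_normD _ _))//.
rewrite (splitr e) ltrD//; first by rewrite distrC; near: z; exact: C1.
by near: z; exact: C2.
Unshelve. all: by end_near. Qed.

Lemma continuous_segment (j : nat) (F : V -> R) (x : V) :
  (forall y, O y -> {for y, continuous F}) -> O x ->
  {within `[0, 1], continuous (fun t : R => t ^+ j * F (p + t *: (x - p)) : R)}.
Proof.
move=> cF Ox; apply: continuous_in_subspaceT => t; rewrite inE/= in_itv/= => t01.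
apply: cvgM; first exact: exprn_continuous.
apply: (cvg_comp (fun t : R => p + t *: (x - p)) F); last exact: cF (starO Ox t01).
by apply: cvgD; [exact: cvg_cst|exact: cvgZr_tmp].
Qed.

Lemma integrable_segment (j : nat) (F : V -> R) (x : V) :
  (forall y, O y -> {for y, continuous F}) -> O x ->
  mu.-integrable `[0, 1] (EFin \o (fun t : R => t ^+ j * F (p + t *: (x - p)) : R)).
Proof.
move=> cF Ox; apply: continuous_compact_integrable; first exact: segment_compact.
exact: continuous_segment.
Qed.

Lemma continuous_radial_mean j (F : V -> R) (x : V) :
  (forall y, O y -> {for y, continuous F}) -> O x ->
  {for x, continuous (radial_mean j F)}.
Proof.
move=> cF Ox; apply/cvgrPdist_le => /= e e0; near=> y.
have Oy : O y by near: y; exact: open_nbhs_nbhs.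
rewrite /radial_mean -RintegralB//; [|exact: integrable_segment..].
pose a t := t ^+ j * F (p + t *: (x - p)).
pose b t := t ^+ j * F (p + t *: (y - p)).
have IB : mu.-integrable `[0, 1] (EFin \o (fun t => a t - b t)).
  rewrite (_ : _ \o _ = fun t => ((a t)%:E - (b t)%:E)%E)//.
  by apply: integrableB => //; exact: integrable_segment.
apply: le_trans (le_normr_Rintegral _ IB) _ => //.
have -> : e = \int[mu]_(t in `[0, 1]) e.
  by rewrite Rintegral_cst//= lebesgue_measure_itv/= lte_fin ltr01 oppr0 adde0 mulr1.
apply: le_Rintegral => //.
- rewrite (_ : _ \o _ = abse \o (EFin \o (fun t => a t - b t)))//.
  exact: integrable_abse.
- apply: continuous_compact_integrable; first exact: segment_compact.
  exact: continuous_subspaceT (fun=> cvg_cst _).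
- move=> t; rewrite /= in_itv/= => t01.
  rewrite /a /b -mulrBr normrM (le_trans (ler_wpM2r (normr_ge0 _) (_ : _ <= 1)))//.
    by case/andP: t01 => t0 t1; rewrite ger0_norm ?exprn_ge0// exprn_ile1.
  rewrite mul1r distrC ltW//; move: t t01; near: y.
  exact: near_segment.
Unshelve. all: by end_near. Qed.

(** Differentiation under the integral sign in the one-parameter family x + h v; the inner
    derivative of p + t (x + h v - p) contributes the additional factor t. *)
Lemma is_derive_radial_mean j (F : V -> R) (x v : V) :
  Ck 1 O F -> O x ->
  is_derive x v (radial_mean j F) (radial_mean j.+1 ('D_v F) x).
Proof.
move=> CF Ox; have [cF dF] := (Ck0 CF, CF.2); have [dFv [cDF _]] := dF v.
pose f (h t : R) := t ^+ j * F (p + t *: (x + h *: v - p)).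
have df (h t : R) : O (x + h *: v) -> 0 <= t <= 1 ->
    is_derive h 1 (f ^~ t) (t ^+ j.+1 * 'D_v F (p + t *: (x + h *: v - p))).
  move=> Oh t01.
  have E k : p + t *: (x + k *: v - p) = p + t *: (x - p) + (t * k) *: v.
    by rewrite [x + _ - p]addrAC scalerDr scalerA addrA.
  have H1 : is_derive h 1 (fun k : R => t * k) t.
    by have := is_deriveZ t (is_derive_id h (1 : R)); rewrite [t *: 1]mulr1; exact.
  have H2 : is_derive (t * h) 1 (fun k : R => F (p + t *: (x - p) + k *: v))
      ('D_v F (p + t *: (x + h *: v - p))).
    by rewrite E; apply: is_derive_line; apply: dFv; rewrite -E; exact: starO.
  have [c3 D3] := is_deriveZ (t ^+ j) (is_derive_comp1 H1 H2).
  rewrite (_ : f ^~ t = (t ^+ j \*: ((fun k : R => F (p + t *: (x - p) + k *: v)) \o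
      (fun k : R => t * k)) : R -> R)).
    by apply: DeriveDef => //; rewrite D3 /GRing.scale/= exprSr -mulrA.
  by apply/funext => k; rewrite /f E.
(* The integrand must be dominated uniformly for small [h]: [near_segment] with tolerance 1 bounds
   the derivative by its absolute value at h = 0 plus 1, which is the function [G] below. *)
have [d d0 dO] : exists2 d : R, 0 < d & forall h : R, `|h| < d -> O (x + h *: v) /\
    forall t : R, 0 <= t <= 1 -> `|'D_v F (p + t *: (x + h *: v - p)) -
       'D_v F (p + t *: (x - p))| < 1.
  have L : x + h *: v @[h --> (0 : R)] --> x + (0 : R) *: v.
    by apply: cvgD; [exact: cvg_cst|exact: cvgZr_tmp].
  rewrite scale0r addr0 in L.
  have N : \forall y \near x, O y /\ forall t : R, 0 <= t <= 1 ->
      `|'D_v F (p + t *: (y - p)) - 'D_v F (p + t *: (x - p))| < 1.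
    by apply: filterI; [exact: open_nbhs_nbhs|exact: near_segment cDF Ox ltr01].
  have {}N := L _ N.
  move/nbhs_ballP : N => [d /= d0 dN]; exists d => // h hd; apply: dN.
  by rewrite -ball_normE /= sub0r normrN.
have I0 : (`]-d, d[%classic : set R) 0 by rewrite /= in_itv/= oppr_lt0 d0.
have dh (h : R) : (`]-d, d[%classic : set R) h -> `|h| < d by rewrite /= in_itv/= ltr_norml.
pose G (t : R) := `|'D_v F (p + t *: (x - p))| + 1.
have H := @cvg_differentiation_under_integral R _ _ mu f `[0, 1] _ 0 (-d) d I0 _ _ G _ _ _.
have {}H : h^-1 *: ((radial_mean j F \o shift x) (h *: v) - radial_mean j F x)
    @[h --> (0 : R)^'] --> radial_mean j.+1 ('D_v F) x.
  have -> : (fun h : R => h^-1 *: ((radial_mean j F \o shift x) (h *: v) - radial_mean j F x))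
    = fun h => h^-1 *: (\int[mu]_(t in `[0, 1]) f (h + 0) t - \int[mu]_(t in `[0, 1]) f 0 t).
    by apply/funext => h; rewrite /radial_mean /f /= scale0r !addr0 [h *: v + x]addrC.
  have -> : radial_mean j.+1 ('D_v F) x = \int[mu]_(t in `[0, 1]) partial1of2 f 0 t.
    apply: eq_Rintegral => t; rewrite inE /= in_itv/= => t01.
    have O0 : O (x + (0 : R) *: v) by rewrite scale0r addr0.
    rewrite partial1of2E; case: (df 0 t O0 t01) => _ ->.
    by rewrite scale0r addr0.
  apply: H => //.
  - move=> h /dh/dO[Oh _]; exact: integrable_segment.
  - by move=> h t /dh/dO[Oh _] t01; case: (df h t Oh t01).
  - by move=> t; rewrite addr_ge0.
  - apply: continuous_compact_integrable; first exact: segment_compact.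
    apply: continuous_in_subspaceT => t; rewrite inE/= in_itv/= => t01.
    apply: cvgD; last exact: cvg_cst.
    have C0 : p + s *: (x - p) @[s --> t] --> p + t *: (x - p).
      by apply: cvgD; [exact: cvg_cst|exact: cvgZr_tmp].
    have C1 := cvg_norm (cvg_comp _ _ C0 (cDF _ (starO Ox t01))).
    exact: C1.
  - move=> h t /dh/dO[Oh Dt] /= t01; rewrite partial1of2E; case: (df h t Oh t01) => _ ->.
    move: t01; rewrite in_itv/= => t01; have := Dt t t01.
    rewrite /G normrM => Dlt.
    rewrite -[leRHS]mul1r ler_pM//.
      by case/andP: t01 => t0 t1; rewrite ger0_norm ?exprn_ge0// exprn_ile1.
    rewrite -[X in `|X|](subrK ('D_v F (p + t *: (x - p)))).
    by rewrite (le_trans (ler_normD _ _))// addrC lerD2l ltW.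
by apply: DeriveDef; [apply/cvg_ex; eexists; exact: H|exact/cvg_lim].
Qed.

Lemma Ck_radial_mean k j (F : V -> R) : (forall k, Ck k O F) -> Ck k O (radial_mean j F).
Proof.
elim: k j F => [|k IH] j F CF.
  by split=> // x Ox; apply: continuous_radial_mean => //; exact: Ck0 (CF 0).
apply/CkP; split=> [x Ox|v]; first by apply: continuous_radial_mean => //; exact: Ck0 (CF 0).
have H x (Ox : O x) := is_derive_radial_mean j v (CF 1) Ox.
split=> [x /H[]//|].
apply: (@Ck_eq _ _ _ _ _ (radial_mean j.+1 ('D_v F))) => // [x /H[]//|].
by apply: IH => k'; have /CkP[_ /(_ v)[]] := CF k'.+1.
Qed.

Lemma radial_mean_FTC (F : V -> R) (x : V) : Ck 1 O F -> O x ->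
  radial_mean 0 ('D_(x - p) F) x = F x - F p.
Proof.
move=> CF Ox; have [cF dF] := (Ck0 CF, CF.2); have [dFv [cDF _]] := dF (x - p).
pose g (t : R) := F (p + t *: (x - p)).
have dg (t : R) : 0 <= t <= 1 -> is_derive t 1 g ('D_(x - p) F (p + t *: (x - p))).
  by move=> t01; apply: is_derive_line; apply: dFv; exact: starO.
have cg (t : R) : 0 <= t <= 1 -> {for t, continuous g}.
  by move=> /dg[+ _]; move/derivable1_diffP/differentiable_continuous.
have := @continuous_FTC2 R (fun t => t ^+ 0 * 'D_(x - p) F (p + t *: (x - p)))
  g 0 1 ltr01 _ _ _.
rewrite /radial_mean /Rintegral => -> /=.
- by rewrite /g scale1r scale0r addr0 [p + _]addrC subrK.
- exact: (@continuous_segment 0 _ _ cDF Ox).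
- split.
  + by move=> t; rewrite in_itv/= => /andP[t0 t1]; have [|//] := dg t; rewrite !ltW.
  + by apply: cvg_at_right_filter; apply: cg; rewrite lexx ler01.
  + by apply: cvg_at_left_filter; apply: cg; rewrite lexx ler01.
- move=> t; rewrite in_itv/= => /andP[t0 t1]; rewrite derive1E expr0 mul1r.
  by have [|_ ->] := dg t; rewrite ?ltW.
Qed.

End Hadamard.

Lemma Rintegral_sum_unit {R : realType} (I : Type) (r : seq I) (c : I -> R) (h : I -> R -> R) :
  (forall i, (@lebesgue_measure R).-integrable `[0, 1] (EFin \o h i)) ->
  (@lebesgue_measure R).-integrable `[0, 1]
    (EFin \o (fun t => \sum_(i <- r) c i * h i t)) /\
  \int[@lebesgue_measure R]_(t in `[0, 1]) (\sum_(i <- r) c i * h i t) =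
  \sum_(i <- r) c i * \int[@lebesgue_measure R]_(t in `[0, 1]) h i t.
Proof.
move=> ih; elim: r => [|i r [IHi IH]].
  split; last first.
    rewrite big_nil; under eq_Rintegral do rewrite big_nil.
    by rewrite Rintegral_cst// mul0r.
  rewrite (_ : _ \o _ = cst 0%E); first exact: integrable0.
  by apply/funext => t /=; rewrite big_nil.
have ci : (@lebesgue_measure R).-integrable `[0, 1] (EFin \o (fun t => c i * h i t)).
  rewrite (_ : _ \o _ = fun t => ((c i)%:E * (EFin \o h i) t)%E)//.
  exact: integrableZl.
have e : (fun t => \sum_(j <- i :: r) c j * h j t) =
    fun t => c i * h i t + \sum_(j <- r) c j * h j t.
  by apply/funext => t; rewrite big_cons.
rewrite e; split.
  pose a t := c i * h i t; pose b t := \sum_(j <- r) c j * h j t.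
  rewrite (_ : _ \o _ = fun t => ((a t)%:E + (b t)%:E)%E)//.
  exact: integrableD.
by rewrite RintegralD// RintegralZl// IH big_cons.
Qed.

(** The factors [g i] are the means of the partial derivatives of [F] over the segment from [p] to
    [x]: integrating the derivative of [F] along that segment gives F x - F p, and this derivative
    is the combination of the partial derivatives with coefficients x_i - p_i. *)
Lemma hadamard {R : realType} {n : nat} (O : set 'rV[R]_n) (p : 'rV[R]_n)
    (F : 'rV[R]_n -> R) :
  open O -> (forall x (t : R), O x -> 0 <= t <= 1 -> O (p + t *: (x - p))) ->
  (forall k, Ck k O F) ->
  exists g : 'I_n -> 'rV[R]_n -> R, (forall i k, Ck k O (g i)) /\
    forall x, O x -> F x = F p + \sum_i (x 0 i - p 0 i) * g i x.
Proof.
move=> oO starO CF.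
exists (fun i => radial_mean p 0 ('D_(delta_mx 0 i) F)); split=> [i k|x Ox].
  by apply: Ck_radial_mean => // k'; have /CkP[_ /(_ (delta_mx 0 i))[]] := CF k'.+1.
rewrite -[F x](subrK (F p)) addrC -(radial_mean_FTC starO (CF 1) Ox); congr (_ + _).
have int i := @integrable_segment R _ O p starO 0 ('D_(delta_mx 0 i) F) x
  ((CF 1).2 (delta_mx 0 i)).2.1 Ox.
have [_ <-] := Rintegral_sum_unit (index_enum _) (fun i => x 0 i - p 0 i) int.
apply: eq_Rintegral => t; rewrite inE/= in_itv/= => t01.
rewrite (derive_sum_coord _ oO (CF 1) (starO _ _ Ox t01)) big_ord1 mulr_sumr.
apply: eq_bigr => i _.
by rewrite !mxE mulrCA.
Qed.

(** * Smooth functions and frames on M *)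

Lemma Ck_local {R : realType} {V W : normedModType R} k (O : set V) (f : V -> W) :
  (forall x, O x -> exists N, [/\ open N, N x & Ck k N f]) -> Ck k O f.
Proof.
elim: k f => [|k IH] f Nf.
  by split=> // x /Nf[N [_ Nx]] /Ck0; exact.
apply/CkP; split=> [x /Nf[N [_ Nx]] /Ck0|v]; first exact.
split=> [x /Nf[N [_ Nx /CkP[_ /(_ v)[+ _]]]]|]; first exact.
by apply: IH => x /Nf[N [oN Nx /CkP[_ /(_ v)[_ CN]]]]; exists N.
Qed.

Lemma open_preimage {T U : topologicalType} (D : set T) (f : T -> U) (O : set U) :
  open D -> open O -> (forall x, D x -> {for x, continuous f}) ->
  open (D `&` f @^-1` O).
Proof.
move=> oD oO cf; rewrite openE => x [Dx Ofx].
apply: filterI; first exact: open_nbhs_nbhs.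
by apply: (cf x Dx); exact: open_nbhs_nbhs.
Qed.

Section ManifoldCharts.
Context {R : realType} {n : nat} {M : manifold R n}.
Implicit Types (c d : chart M 'rV[R]_n) (p x y : M).

Definition smooth_near c (f : M -> R) p : Prop :=
  exists O (G : 'rV[R]_n -> R), [/\ open O, O (c.2 p), forall k, Ck k O G &
    forall x, c.1 x -> O (c.2 x) -> f x = G (c.2 x)].

Lemma open_chart_image c (D : set M) : atlas M c -> open D -> D `<=` c.1 ->
  open (c.2 @` D).
Proof. by move=> ac oD Dc; exact: atlas_open_map ac _ oD Dc. Qed.

(** The local representative is composed with the transition map, on the part of the overlap that
    this map sends into [O]. *)
Lemma smooth_near_change c d (f : M -> R) p : atlas M c -> atlas M d ->
  c.1 p -> d.1 p -> smooth_near c f p -> smooth_near d f p.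
Proof.
move=> ac ad cp dp [ O [G [oO Op CG fG]]].
have [T [Q [oQ sQ CT]] cT] := atlas_smooth ad ac.
pose D := d.1 `&` c.1.
have oD : open (d.2 @` D).
  by apply: open_chart_image => [//||x []//]; apply: openI; exact: atlas_open.
have CT' k : Ck k (d.2 @` D) T by exact: Ck_sub (CT k).
pose N := (d.2 @` D) `&` T @^-1` O.
have oN : open N by apply: open_preimage => // v Dv; exact: Ck0 (CT' 0) _ Dv.
exists N, (G \o T); split=> //.
- by split; [exists p|rewrite /= -cT].
- move=> k; apply: (Ck_comp oN oO) => [v []//|i j|//].
  by apply: Ck_entry => //; apply: Ck_sub (CT' k) => v [].
- move=> x Dx [[y [dy cy] yx] OT].
  have e : y = x by exact: (atlas_inj ad).
  rewrite e in cy; have cx : c.1 x by [].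
  by rewrite /= -cT// fG// cT.
Qed.

Definition smooth_at (f : M -> R) p : Prop :=
  exists c, [/\ atlas M c, c.1 p & smooth_near c f p].

Lemma smooth_at_near c (f : M -> R) p :
  atlas M c -> c.1 p -> smooth_at f p -> smooth_near c f p.
Proof. by move=> ac cp [d [ad dp]]; exact: smooth_near_change. Qed.

(** The point [p] is the default value off the image of the chart. *)
Definition chart_inv c (p : M) (v : 'rV[R]_n) : M :=
  xget p [set x | c.1 x /\ c.2 x = v].

Lemma chart_invK c p x : atlas M c -> c.1 x -> chart_inv c p (c.2 x) = x.
Proof.
move=> ac cx; rewrite /chart_inv; case: xgetP => [y _ [cy e]|/(_ x) []//].
exact: (atlas_inj ac).
Qed.

Lemma chart_invP c p v : (c.2 @` c.1) v ->
  c.1 (chart_inv c p v) /\ c.2 (chart_inv c p v) = v.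
Proof.
move=> [x cx xv]; rewrite /chart_inv; case: xgetP => [y _ //|/(_ x) []//].
Qed.

Lemma chart_inv_continuous c p v : atlas M c -> (c.2 @` c.1) v ->
  {for v, continuous (chart_inv c p)}.
Proof.
move=> ac cv N /=; have [cx xv] := chart_invP p cv.
set x := chart_inv c p v in cx xv *; move=> Nx.
have [N' [oN' N'x] sN] : exists2 N', open_nbhs x N' & N' `<=` N by move: Nx; rewrite nbhsE.
pose D := N' `&` c.1.
have oD : open (c.2 @` D).
  by apply: open_chart_image => [//||? []//]; apply: openI => //; exact: atlas_open.
apply: (@filterS _ _ _ (c.2 @` D)); last by apply: open_nbhs_nbhs; split=> //; exists x.
by move=> w [y [N'y cy] <-]; rewrite /= chart_invK//; exact: sN.
Qed.

Lemma Ck_chart_inv c p (f : M -> R) k : atlas M c ->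
  (forall x, c.1 x -> smooth_near c f x) -> Ck k (c.2 @` c.1) (f \o chart_inv c p).
Proof.
move=> ac sf; apply: Ck_local => v [x cx <-].
have [ O [G [oO Ox CG fG]]] := sf x cx.
have oc : open (c.2 @` c.1) by apply: open_chart_image => //; exact: atlas_open.
exists (O `&` (c.2 @` c.1)); split; first exact: openI.
  by split=> //; exists x.
apply: (@Ck_eq _ _ _ _ _ G); first exact: openI.
  by move=> w [Ow [y cy e]]; rewrite -e /= chart_invK// fG// e.
by apply: Ck_sub (CG k) => w [].
Qed.

Lemma smooth_atP (f : M -> R) : smooth_wrt (atlas M) f <-> forall p, smooth_at f p.
Proof.
split=> [sf p|sf c ac].
  have [c ac cp] := atlas_cover p; exists c; split=> //.
  have [G [ O [oO sO CG]] fG] := sf c ac.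
  exists O, G; split=> // [|x cx _]; last exact: fG.
  by apply: sO; exists p.
have [[p cp]|nc] := pselect (exists p, c.1 p); last first.
  exists (cst 0); last by move=> x cx; case: nc; exists x.
  by exists setT; split; [exact: openT| |move=> k; exact: Ck_cst].
exists (f \o chart_inv c p); last by move=> x cx; rewrite /= chart_invK.
exists (c.2 @` c.1); split=> [|//|k].
  by apply: open_chart_image => //; exact: atlas_open.
by apply: Ck_chart_inv => // x cx; exact: smooth_at_near.
Qed.

Lemma smooth_smooth_at (f : smooth M) p : smooth_at f p.
Proof. by have /asboolP/smooth_atP := smoothP f. Qed.

Lemma smooth_of_at (f : M -> R) : (forall p, smooth_at f p) ->
  exists g : smooth M, g = f :> (M -> R).
Proof.
move=> sf; have sf' : f \in smooth_pred (M := M) by apply/asboolP/smooth_atP.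
by exists (Smooth sf').
Qed.

(** This is extension by zero: off [K] the function vanishes on an open set, so smoothness has to be
    checked on [K] only. *)
Lemma smooth_at_support (f : M -> R) (K : set M) : closed K ->
  (forall x, ~ K x -> f x = 0) -> (forall x, K x -> smooth_at f x) ->
  forall x, smooth_at f x.
Proof.
move=> cK f0 fK x; have [Kx|nKx] := pselect (K x); first exact: fK.
have [d ad dx] := atlas_cover x; exists d; split=> //.
exists (d.2 @` (d.1 `&` ~` K)), (cst 0); split.
- by apply: open_chart_image => [//||? []//]; apply: openI;
    [exact: atlas_open|exact: closed_openC].
- by exists x.
- by move=> k; exact: Ck_cst.
- move=> y dy [z [dz nKz] zy]; apply: f0.
  by have <- : z = y by exact: (atlas_inj ad).
Qed.

Lemma smooth_at_M (f g : M -> R) p : smooth_at f p -> smooth_at g p ->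
  smooth_at (fun x => f x * g x) p.
Proof.
move=> [c [ac cp sf]] /(smooth_at_near ac cp) sg; exists c; split=> //.
have [ O [F [oO Op CF fF]]] := sf; have [Q [G [oQ Qp CG gG]]] := sg.
have oI := openI oO oQ.
exists (O `&` Q), (F * G); split=> // [k|x cx [Ox Qx]]; last by rewrite fF// gG.
by apply: CkM => //; [apply: Ck_sub (CF k)|apply: Ck_sub (CG k)] => ? [].
Qed.

(** A Euclidean bump in a chart is extended by zero. The closed set [K] comes with it because points
    off [K] then have a neighbourhood on which [s] vanishes. *)
Lemma bump p (W : set M) : nbhs p W -> exists (s : smooth M) (K : set M),
  [/\ \forall x \near p, s x = 1, closed K, K `<=` W & forall x, ~ K x -> s x = 0].
Proof.
move=> pW; have [c ac cp] := atlas_cover p.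
have [W' [oW' W'p] sW] : exists2 W', open_nbhs p W' & W' `<=` W by move: pW; rewrite nbhsE.
pose D := W' `&` c.1.
have oD : open (c.2 @` D).
  by apply: open_chart_image => [//||? []//]; apply: openI => //; exact: atlas_open.
have /nbhs_ballP[r /= r0 rD] : nbhs (c.2 p) (c.2 @` D).
  by apply: open_nbhs_nbhs; split=> //; exists p.
have r20 : 0 < r / 2 by rewrite divr_gt0.
have [b [Cb b1 b0]] := bump_mx (c.2 p) r20.
pose B := [set v : 'rV[R]_n | `|c.2 p - v| <= r / 2].
have sB : B `<=` c.2 @` D.
  move=> v Bv; apply: rD; rewrite -ball_normE /=; apply: le_lt_trans Bv _.
  by rewrite ltr_pdivrMr// ltr_pMr// ltr1n.
have cB : compact B.
  apply: bounded_closed_compact.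
    exists (`|c.2 p| + r / 2); split; first exact: num_real.
    move=> x xlt v Bv; apply: le_trans (ltW xlt).
    rewrite -[v](subKr (c.2 p)); apply: le_trans (ler_normB _ _) _.
    by rewrite lerD2l.
  exact: closed_closed_ball_.
(* [K] is the continuous image of a compact ball, hence compact, and closed because [M] is
   Hausdorff. Halving the radius keeps the closed ball inside the image of the chart. *)
pose K := chart_inv c p @` B.
have cK : closed K.
  apply: compact_closed; first exact: manifold_hausdorff.
  apply: continuous_compact => //; apply: continuous_in_subspaceT => v /set_mem Bv.
  by apply: chart_inv_continuous => //; have [x [_ cx] e] := sB _ Bv; exists x.
have KD : K `<=` D.
  by move=> x [v /sB[y [W'y cy] <-] <-]; rewrite chart_invK.
pose s x := if `[< c.1 x >] then b (c.2 x) else 0.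
have sK x : ~ K x -> s x = 0.
  move=> nK; rewrite /s; case: asboolP => // cx; apply: b0.
  rewrite leNgt; apply/negP => h; apply: nK; exists (c.2 x); last by rewrite chart_invK.
  by rewrite /B /= distrC ltW.
have ss x : smooth_at s x.
  move: x; apply: (smooth_at_support cK sK) => x /KD[_ cx].
  exists c; split=> //; exists setT, b; split=> //; first exact: openT.
    by move=> k; apply: Cb; exact: openT.
  by move=> y cy _; rewrite /s; case: asboolP.
have [g gs] := smooth_of_at ss.
exists g, K; rewrite gs; split=> //; last by move=> x /KD[/sW].
have oc : open c.1 by exact: atlas_open.
have := atlas_cont ac cp b1; rewrite /= => b1'.
near=> x.
have cx : c.1 x by near: x; exact: open_nbhs_nbhs.
by rewrite /s; case: asboolP => // _; near: x.
Unshelve. all: by end_near. Qed.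

End ManifoldCharts.

Section Frames.
Context {R : realType} {n : nat} {M : manifold R n}.
Implicit Types (c d : chart M 'rV[R]_n) (p q x y : M).

Lemma smooth_addE (f g : smooth M) x : (f + g) x = f x + g x. Proof. by []. Qed.
Lemma smooth_mulE (f g : smooth M) x : (f * g) x = f x * g x. Proof. by []. Qed.
Lemma smooth_oppE (f : smooth M) x : (- f) x = - f x. Proof. by []. Qed.
Lemma smooth_subE (f g : smooth M) x : (f - g) x = f x - g x. Proof. by []. Qed.
Lemma smooth_scaleE (a : R) (f : smooth M) x : (a *: f) x = a * f x. Proof. by []. Qed.
Lemma smooth_0E x : (0 : smooth M) x = 0. Proof. by []. Qed.
Lemma smooth_1E x : (1 : smooth M) x = 1. Proof. by []. Qed.
Lemma smooth_sumE I (r : seq I) (f : I -> smooth M) x :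
  (\sum_(i <- r) f i) x = \sum_(i <- r) f i x.
Proof. by elim: r => [|i r IH]; rewrite ?big_nil// !big_cons smooth_addE IH. Qed.
Definition smoothE := (smooth_addE, smooth_mulE, smooth_oppE, smooth_subE,
  smooth_scaleE, smooth_0E, smooth_1E, smooth_sumE).

Lemma smooth_eq (f g : smooth M) : (forall x, f x = g x) -> f = g.
Proof. by move=> fg; apply/val_inj/funext. Qed.

Definition in_chart c (H : 'rV[R]_n -> R) x : R :=
  if `[< c.1 x >] then H (c.2 x) else 0.

Lemma in_chartE c H x : c.1 x -> in_chart c H x = H (c.2 x).
Proof. by rewrite /in_chart; case: asboolP. Qed.

Lemma smooth_at_in_chart c (s : smooth M) (K : set M) (O : set 'rV[R]_n)
    (H : 'rV[R]_n -> R) :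
  atlas M c -> closed K -> (forall x, ~ K x -> s x = 0) -> open O ->
  K `<=` c.1 `&` c.2 @^-1` O -> (forall k, Ck k O H) ->
  (fun x => s x * in_chart c H x) \in smooth_pred (M := M).
Proof.
move=> ac cK s0 oO KO CH; apply/asboolP/smooth_atP.
apply: (smooth_at_support cK) => [x /s0 ->|x /KO[cx Ox]]; first by rewrite mul0r.
apply: smooth_at_M; first exact: smooth_smooth_at.
exists c; split=> //; exists O, H; split=> // y cy _; exact: in_chartE.
Qed.

Lemma nbhs_chart c q (N : set 'rV[R]_n) : atlas M c -> c.1 q -> open N ->
  N (c.2 q) -> nbhs q (c.1 `&` c.2 @^-1` N).
Proof.
move=> ac cq oN Nq; apply: open_nbhs_nbhs; split=> //.
by apply: open_preimage => // [|x]; [exact: atlas_open|exact: atlas_cont].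
Qed.

(** Near points and fields accept global functions only; this provides one with the germ of a given
    function of the coordinates. *)
Lemma smooth_extend c q (N : set 'rV[R]_n) (H : 'rV[R]_n -> R) :
  atlas M c -> c.1 q -> open N -> N (c.2 q) -> (forall k, Ck k N H) ->
  exists h : smooth M, \forall x \near q, h x = H (c.2 x).
Proof.
move=> ac cq oN Nq CH.
have [s [K [s1 cK KN s0]]] := bump (nbhs_chart ac cq oN Nq).
exists (Smooth (smooth_at_in_chart ac cK s0 oN KN CH)).
have cn : nbhs q c.1 by apply: open_nbhs_nbhs; split=> //; exact: atlas_open.
near=> x; rewrite /=.
have -> : s x = 1 by near: x.
by rewrite mul1r in_chartE//; near: x.
Unshelve. all: by end_near. Qed.

Lemma chart_coord_ex c q i : atlas M c -> c.1 q ->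
  exists g : smooth M, \forall x \near q, g x = c.2 x 0 i.
Proof.
move=> ac cq; pose H (w : 'rV[R]_n) := w 0 i.
exact: (@smooth_extend c q setT H ac cq openT I (fun k => Ck_coord k setT 0 i)).
Qed.

Lemma vfield_der (X : vfield M) : derivation X.
Proof. by have /asboolP := vfieldP X. Qed.

Lemma derivation0 (X : smooth M -> smooth M) : derivation X -> X 0 = 0.
Proof. by case=> _ sX _; have := sX 0 0; rewrite !scale0r. Qed.

Lemma derivationB (X : smooth M -> smooth M) f g : derivation X -> X (f - g) = X f - X g.
Proof. by case=> aX sX _; rewrite aX -scaleN1r sX scaleN1r. Qed.

Lemma derivation1 (X : smooth M -> smooth M) : derivation X -> X 1 = 0.
Proof.
case=> _ _ lX; have := lX 1 1; rewrite !mulr1 mul1r => e.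
by apply: (addrI (X 1)); rewrite addr0 -e.
Qed.

Lemma nbhs_bump q (P : set M) : nbhs q P -> exists s : smooth M,
  (\forall x \near q, s x = 1) /\ forall x, ~ P x -> s x = 0.
Proof.
move=> qP; have [s [K [s1 _ KP s0]]] := bump qP.
by exists s; split=> // x nPx; apply: s0 => /KP.
Qed.

(** A bump [s] equal to 1 near [q] and to 0 wherever [f] is not 0 gives s f = 0; the Leibniz rule at
    [q] then leaves only (X f)(q). *)
Lemma vfield_local (X : vfield M) (f : smooth M) q :
  (\forall x \near q, f x = 0) -> (X f : smooth M) q = 0.
Proof.
move=> f0; have [s [s1 sf]] := nbhs_bump f0; have [aX sX lX] := vfield_der X.
have sf0 : s * f = 0.
  apply: smooth_eq => x; rewrite !smoothE.
  by have [->|/sf ->] := pselect (f x = 0); rewrite ?mulr0 ?mul0r.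
have := lX s f; rewrite sf0 (derivation0 (vfield_der X)).
move=> /(congr1 (fun h : smooth M => h q)); rewrite !smoothE.
by rewrite (nbhs_singleton f0) (nbhs_singleton s1) mulr0 add0r mul1r.
Qed.

Lemma vfield_local_eq (X : vfield M) (f g : smooth M) q :
  (\forall x \near q, f x = g x) -> (X f : smooth M) q = (X g : smooth M) q.
Proof.
move=> fg; have [aX sX lX] := vfield_der X; apply/eqP; rewrite -subr_eq0; apply/eqP.
have H := @vfield_local X (f - g) q; have e := derivationB f g (vfield_der X).
rewrite -smooth_subE -e; apply: H.
by apply: filterS fg => x fgx; rewrite smoothE fgx subrr.
Qed.

Lemma coord_field_subproof c p (s : smooth M) (K : set M) (i : 'I_n) (f : smooth M) :
  atlas M c -> closed K -> K `<=` c.1 -> (forall x, ~ K x -> s x = 0) ->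
  (fun x => s x * in_chart c ('D_(delta_mx 0 i) (f \o chart_inv c p)) x)
    \in smooth_pred (M := M).
Proof.
move=> ac cK Kc s0.
have oc : open (c.2 @` c.1) by apply: open_chart_image => //; exact: atlas_open.
apply: (smooth_at_in_chart ac cK s0 oc) => [x /Kc cx|k]; first by split=> //; exists x.
have := @Ck_chart_inv _ _ M c p f k.+1 ac
  (fun x cx => smooth_at_near ac cx (smooth_smooth_at f x)).
by move=> /CkP[_ /(_ (delta_mx 0 i))[]].
Qed.

(** Multiplication by the cut-off [s] turns the coordinate derivation of the chart into a derivation
    of all of C^oo(M), unchanged where [s] is 1. *)
Lemma coord_field c p (s : smooth M) (K : set M) (i : 'I_n) :
  atlas M c -> c.1 p -> closed K -> K `<=` c.1 -> (forall x, ~ K x -> s x = 0) ->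
  exists X : vfield M, forall f x, (X f : smooth M) x =
    s x * in_chart c ('D_(delta_mx 0 i) (f \o chart_inv c p)) x.
Proof.
move=> ac cp cK Kc s0.
pose X f : smooth M := Smooth (coord_field_subproof p i f ac cK Kc s0).
have oc : open (c.2 @` c.1) by apply: open_chart_image => //; exact: atlas_open.
have df (f : smooth M) x : c.1 x -> derivable (f \o chart_inv c p) (c.2 x) (delta_mx 0 i).
  move=> cx; have := @Ck_chart_inv _ _ M c p f 1 ac
    (fun x cx => smooth_at_near ac cx (smooth_smooth_at f x)).
  by move=> /CkP[_ /(_ (delta_mx 0 i))[+ _]]; apply; exists x.
have XP : (X : smooth M -> (smooth M)^o) \in vfield_pred (M := M).
  apply/asboolP; split=> [f g|r f|f g]; apply: smooth_eq => x;
    rewrite !smoothE /= /in_chart; case: asboolP => cx; rewrite ?mulr0 ?addr0 ?mul0r//.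
  - by rewrite -mulrDr -deriveD//; exact: df.
  - rewrite mulrCA -[r * _]/(r *: _) -deriveZ//; exact: df.
  - rewrite (_ : (f * g : smooth M) \o chart_inv c p =
      (f \o chart_inv c p) * (g \o chart_inv c p))//.
    rewrite deriveM; [|exact: df..].
    by rewrite /= !chart_invK// /GRing.scale/=; ring.
by exists (VField XP).
Qed.

(** What later arguments retain of a chart: global functions [g] playing the coordinates, global
    fields [th] dual to them on [W], and a Hadamard expansion of every function at every point of
    [W]. *)
Definition is_frame (W : set M) (g : 'I_n -> smooth M) (th : 'I_n -> vfield M) :=
  [/\ open W, forall q i k, W q -> (th i (g k) : smooth M) q = (i == k)%:R &
    forall q (f : smooth M), W q -> exists h : 'I_n -> smooth M,
      \forall x \near q, f x = f q + \sum_i (g i x - g i q) * h i x].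

Lemma frame_exists c p : atlas M c -> c.1 p -> exists W g th,
  [/\ is_frame W g th, W p, W `<=` c.1 & forall i x, W x -> g i x = c.2 x 0 i].
Proof.
move=> ac cp.
have oc1 : open c.1 by exact: atlas_open.
have oc : open (c.2 @` c.1) by exact: open_chart_image.
have [s [K [s1 cK Kc s0]]] := bump (open_nbhs_nbhs (conj oc1 cp)).
have /choice[th thE] i := coord_field i ac cp cK Kc s0.
have /choice[g gE] i := chart_coord_ex i ac cp.
(* The set where the cut-off is 1 and the global functions are the coordinates; its interior is the
   domain of the frame. *)
pose W0 := [set x | [/\ c.1 x, s x = 1 & forall i, g i x = c.2 x 0 i]].
pose W := W0°.
have W0p : nbhs p W0.
  near=> x; split; [|by near: x|move=> i].
  - by near: x; exact: open_nbhs_nbhs.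
  - by move: i; near: x; apply: filter_forall.
have oW : open W by exact: open_interior.
have sW : W `<=` W0 by exact: interior_subset.
exists W, g, th; split=> //; [split=> // [q i k Wq|q f Wq]|by move=> x /sW[]|by move=> i x /sW[]].
  have [cq sq _] := sW q Wq; rewrite thE sq mul1r in_chartE//.
  have -> : 'D_(delta_mx 0 i) (g k \o chart_inv c p) (c.2 q) =
      'D_(delta_mx 0 i) (fun v : 'rV[R]_n => v 0 k) (c.2 q).
    apply: near_eq_derive.
    have N : nbhs (c.2 q) (c.2 @` W).
      apply: open_nbhs_nbhs; split; last by exists q.
      by apply: open_chart_image => // x /sW[].
    near=> v; have [x /sW[cx _ gx] <-] : (c.2 @` W) v by near: v; exact: N.
    by rewrite /= chart_invK.
  by rewrite derive_coord mxE /= eq_sym.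
have [cq _ _] := sW q Wq.
have /nbhs_ballP[r /= r0 rc] : nbhs (c.2 q) (c.2 @` c.1).
  by apply: open_nbhs_nbhs; split=> //; exists q.
(* Hadamard's lemma asks for a domain that is star-shaped about the point of expansion. *)
pose B := ball (c.2 q) r.
have oB : open B by exact: ball_open.
have Bq : B (c.2 q) by exact: ballxx.
have starB (x : 'rV[R]_n) (t : R) : B x -> 0 <= t <= 1 -> B (c.2 q + t *: (x - c.2 q)).
  rewrite /B -ball_normE /= => xr /andP[t0 t1].
  rewrite opprD addNKr normrN normrZ ger0_norm// -normrN opprB.
  by apply: le_lt_trans xr; rewrite ler_piMl.
have CB k : Ck k B (f \o chart_inv c p).
  apply: Ck_sub rc _; apply: Ck_chart_inv => // x cx.
  exact: smooth_at_near ac cx (smooth_smooth_at f x).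
have [H [CH fH]] := hadamard oB starB CB.
have /choice[h hE] i := smooth_extend ac cq oB Bq (CH i).
exists h.
have WB := nbhs_chart ac cq oB Bq.
have Wn : nbhs q W by exact: open_nbhs_nbhs.
near=> x.
have [cx Bx] : (c.1 `&` c.2 @^-1` B) x by near: x.
have [_ _ gx] : W0 x by apply: sW; near: x.
have := fH _ Bx; rewrite /= !chart_invK// => ->; congr (_ + _).
apply: eq_bigr => i _; have [_ _ gq] := sW q Wq; rewrite gx gq; congr (_ * _).
by apply/esym; move: i; near: x; apply: filter_forall.
Unshelve. all: by end_near. Qed.

(** The expansion is restated as the germ of one global function, to which derivations and near
    points can be applied. *)
Lemma frame_expand W g th q (f : smooth M) : is_frame W g th -> W q ->
  exists h : 'I_n -> smooth M, \forall x \near q,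
    f x = (f q *: (1 : smooth M) + \sum_i (g i - g i q *: (1 : smooth M)) * h i) x.
Proof.
move=> [_ _ had] Wq; have [h fh] := had q f Wq; exists h.
apply: filterS fh => x ->; rewrite !smoothE mulr1; congr (_ + _).
by apply: eq_bigr => i _; rewrite !smoothE mulr1.
Qed.

Lemma frame_vfield W g th (X : vfield M) (f : smooth M) q : is_frame W g th -> W q ->
  (X f : smooth M) q = \sum_i (X (g i) : smooth M) q * (th i f : smooth M) q.
Proof.
move=> fr Wq; have [h fh] := frame_expand f fr Wq; have [oW thg _] := fr.
(* Applying [Y] to the expansion leaves the unknown values [h i q]; the choice [Y = th i] identifies
   them as the derivatives of [f] along [th i]. *)
have E (Y : vfield M) : (Y f : smooth M) q = \sum_i (Y (g i) : smooth M) q * h i q.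
  have [aY sY lY] := vfield_der Y.
  have Yc (a : R) : Y (a *: (1 : smooth M)) = 0 by rewrite sY (derivation1 (vfield_der Y)) scaler0.
  rewrite (vfield_local_eq Y fh).
  rewrite aY Yc add0r.
  have -> (I : Type) (r : seq I) (u : I -> smooth M) :
      Y (\sum_(i <- r) u i) = \sum_(i <- r) (Y (u i) : smooth M).
    elim: r => [|i r IH]; first by rewrite !big_nil (derivation0 (vfield_der Y)).
    by rewrite !big_cons aY IH.
  rewrite smoothE; apply: eq_bigr => i _; rewrite lY !smoothE mulr1 subrr mul0r addr0.
  by rewrite (derivationB _ _ (vfield_der Y)) Yc subr0.
rewrite E; apply: eq_bigr => i _; congr (_ * _); rewrite E (bigD1 i)//=.
by rewrite thg// eqxx mul1r big1 ?addr0// => j ji; rewrite thg// eq_sym (negbTE ji) mul0r.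
Qed.

End Frames.

(** * Weil algebras *)

Section WeilAlgebras.
Context {R : realType} {A : weilAlgebra R}.
Implicit Types a b : A.

Local Notation m := (weil_max A).

Lemma weil_idealM a x : x \in m -> a * x \in m.
Proof. by have [H _ _] := weil_maximal A; exact: H. Qed.

Lemma weil_max1 : 1 \notin m.
Proof.
apply/negP => m1; have [_ H _] := weil_maximal A; apply: H; apply/vspaceP => x.
by rewrite memvf -[x]mulr1 weil_idealM.
Qed.

(** Induction on the codimension: a proper ideal that is not maximal lies in a strictly larger
    proper one, and a maximal one is [m] by uniqueness. *)
Lemma weil_ideal_sub (I : {vspace A}) : ideal_of I -> I <> fullv -> (I <= m)%VS.
Proof.
move: {2}(\dim {:A} - \dim I)%N (leqnn (\dim {:A} - \dim I)%N) => k.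
elim: k I => [|k IH] I dI iI If.
  case: If; apply/eqP; rewrite eqEdim subvf /=.
  by move: dI; rewrite leqn0 subn_eq0.
have [mI|nmI] := pselect (maximal_ideal_of I).
  by rewrite (weil_unique mI).
have [J [iJ IJ JI Jf]] : exists J : {vspace A},
    [/\ ideal_of J, (I <= J)%VS, J <> I & J <> fullv].
  apply: contrapT => nJ; apply: nmI; split=> // J iJ IJ.
  have [->|JI] := pselect (J = I); first by left.
  have [->|Jf] := pselect (J = fullv); first by right.
  by case: nJ; exists J.
apply: (subv_trans IJ); apply: (IH J) => //.
have ltd : (\dim I < \dim J)%N.
  rewrite ltn_neqAle (dimvS IJ) andbT; apply/eqP => e; apply: JI.
  by apply/esym/eqP; rewrite eqEdim IJ e /=.
have dJ : (\dim J <= \dim {:A})%N by rewrite dimvS// subvf.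
by move: dI; lia.
Qed.

Definition principal a : {vspace A} := limg (linfun (a \*o idfun)).

Lemma principalP a x : reflect (exists b, x = a * b) (x \in principal a).
Proof.
apply: (iffP memv_imgP) => [[b _ ->]|[b ->]].
  by exists b; rewrite lfunE.
by exists b; rewrite ?memvf// lfunE.
Qed.

Lemma principal_ideal a : ideal_of (principal a).
Proof.
by move=> b x /principalP[c ->]; apply/principalP; exists (b * c); rewrite mulrCA.
Qed.

Lemma weil_unit a : a \notin m -> exists b, a * b = 1.
Proof.
move=> am; have [e|nf] := pselect (principal a = fullv).
  have : 1 \in principal a by rewrite e memvf.
  by move=> /principalP[b ->]; exists b.
have /subvP/(_ a) := weil_ideal_sub (@principal_ideal a) nf.
move=> H; case/negP: am; apply: H; apply/principalP; exists 1; by rewrite mulr1.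
Qed.

Lemma weil_unitB a : a \in m -> exists b, (1 - a) * b = 1.
Proof.
move=> am; apply: weil_unit; apply: contra weil_max1 => h.
by rewrite -[1](subrK a) memvD.
Qed.

(** Each factor [a] in [m] strictly lowers the dimension of the principal ideal of a nonzero product
    b: equality would give b (1 - c a) = 0 with 1 - c a invertible. The dimension is exhausted after
    [\dim {:A}] factors. *)
Lemma prod_nilpotent (s : seq A) : all (fun a => a \in m) s ->
  (\dim {:A} <= size s)%N -> \prod_(a <- s) a = 0.
Proof.
move=> ms ds; apply/eqP/negP => /negP p0.
suff : (\dim (principal (\prod_(a <- s) a)%R) + size s <= \dim {:A})%N.
  suff : (0 < \dim (principal (\prod_(a <- s) a)%R))%N by lia.
  rewrite lt0n dimv_eq0; apply: contra p0 => /eqP e; rewrite -memv0 -e.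
  by apply/principalP; exists 1; rewrite mulr1.
elim: s ms p0 {ds} => [|a s IH] /=; first by rewrite addn0 dimvS// subvf.
move=> /andP[am ms]; rewrite big_cons => p0.
have s0 : \prod_(a <- s) a != 0 by apply: contra p0 => /eqP ->; rewrite mulr0.
apply: leq_trans (IH ms s0); rewrite addnS -addSn leq_add2r.
set b := \prod_(a <- s) a in s0 p0 *.
have sub : (principal (a * b) <= principal b)%VS.
  apply/subvP => x /principalP[c ->]; apply/principalP; exists (a * c).
  by rewrite mulrCA mulrA.
rewrite ltn_neqAle (dimvS sub) andbT; apply/eqP => e.
have : b \in principal (a * b).
  have -> : principal (a * b) = principal b by apply/eqP; rewrite eqEdim sub e /=.
  by apply/principalP; exists 1; rewrite mulr1.
move=> /principalP[c bc]; have [u u1] := weil_unitB (weil_idealM c am).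
move/negP: s0; apply; apply/eqP.
rewrite -[b]mulr1 -u1 mulrA mulrBr mulr1 [b * _](_ : _ = b) ?subrr ?mul0r//.
by rewrite [RHS]bc; ring.
Qed.

Lemma weil_real_max (r : R) : (r%:A : A) \in m -> r = 0.
Proof.
have [//|r0] := eqVneq r 0; move=> rm; case/negP: weil_max1.
by rewrite -[1]scale1r -(mulVf r0) -scalerA memvZ.
Qed.

Lemma body_ex a : exists r : R, a - r%:A \in m.
Proof.
have d1 : \dim <[1 : A]> = 1%N by rewrite dim_vline oner_neq0.
have cap0 : (m :&: <[1]>)%VS = 0%VS.
  apply/eqP; rewrite -subv0; apply/subvP => x; rewrite memv_cap => /andP[xm /vlineP[k xk]].
  by rewrite xk in xm *; rewrite (weil_real_max xm) scale0r mem0v.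
have full : (m + <[1]>)%VS = fullv.
  by apply/eqP; rewrite eqEdim subvf /= -(weil_codim A) dimv_disjoint_sum// d1.
have : a \in (m + <[1]>)%VS by rewrite full memvf.
by move=> /memv_addP[u um [v /vlineP[k ->] ->]]; exists k; rewrite addrK.
Qed.

(** The projection of A = R + m onto R. *)
Definition body a : R := sval (cid (body_ex a)).

Lemma bodyP a : a - (body a)%:A \in m.
Proof. by rewrite /body; case: cid. Qed.

Lemma body_unique a (r : R) : a - r%:A \in m -> body a = r.
Proof.
move=> h; apply/eqP; rewrite -subr_eq0; apply/eqP/weil_real_max.
have -> : (body a - r)%:A = (a - r%:A) - (a - (body a)%:A).
  by rewrite scalerBl opprB [RHS]addrC addrA subrK.
by rewrite memvB ?bodyP.
Qed.

Lemma bodyD a b : body (a + b) = body a + body b.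
Proof.
apply: body_unique; rewrite scalerDl opprD addrACA; apply: memvD; exact: bodyP.
Qed.

Lemma bodyZ (r : R) a : body (r *: a) = r * body a.
Proof. by apply: body_unique; rewrite -scalerA -scalerBr memvZ ?bodyP. Qed.

Lemma body_real (r : R) : body r%:A = r.
Proof. by apply: body_unique; rewrite subrr mem0v. Qed.

Lemma body_sum I (s : seq I) (f : I -> A) :
  body (\sum_(i <- s) f i) = \sum_(i <- s) body (f i).
Proof.
have b0 : body 0 = 0 by rewrite -(scale0r (0 : A)) bodyZ mul0r.
by elim: s => [|i s IH]; rewrite ?big_nil// !big_cons bodyD IH.
Qed.

Lemma body_max a : a \in m -> body a = 0.
Proof. by move=> am; apply: body_unique; rewrite scale0r subr0. Qed.

Lemma body_neq0_unit a : body a != 0 -> exists b, a * b = 1.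
Proof. by move=> a0; apply: weil_unit; apply: contra a0 => /body_max ->. Qed.

End WeilAlgebras.

(** * Near points *)

Section NearPoints.
Context {R : realType} {n : nat} {M : manifold R n} {A : weilAlgebra R}.
Implicit Types (xi : near_point M A) (p q x y : M) (f g h : smooth M).

Lemma near_Z xi (r : R) f : xi (r *: f) = r *: xi f.
Proof. by rewrite (near_scalable xi). Qed.

Lemma near_cst xi (r : R) : xi (r *: (1 : smooth M)) = r%:A.
Proof. by rewrite near_Z rmorph1. Qed.

Lemma near_body xi p f : near_at xi p -> body (xi f) = f p.
Proof. by move=> xp; apply: body_unique; exact: xp. Qed.

(** With a bump [s] as for vector fields, s f = 0, and xi(s) is a unit because its real part is s(p)
    = 1. *)
Lemma near_local xi p f : near_at xi p -> (\forall x \near p, f x = 0) -> xi f = 0.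
Proof.
move=> xp f0; have [s [s1 sf]] := nbhs_bump f0.
have sf0 : s * f = 0.
  apply: smooth_eq => x; rewrite !smoothE.
  by have [->|/sf ->] := pselect (f x = 0); rewrite ?mulr0 ?mul0r.
have [|b sb] := @body_neq0_unit _ _ (xi s).
  by rewrite (near_body s xp) (nbhs_singleton s1) oner_neq0.
by rewrite -[xi f]mul1r -sb mulrAC -rmorphM sf0 rmorph0 mul0r.
Qed.

Lemma near_local_eq xi p f g : near_at xi p -> (\forall x \near p, f x = g x) ->
  xi f = xi g.
Proof.
move=> xp fg; apply/eqP; rewrite -subr_eq0 -rmorphB; apply/eqP/(near_local xp).
by apply: filterS fg => x e; rewrite smoothE e subrr.
Qed.

Lemma near_at_unique xi p q : near_at xi p -> near_at xi q -> p = q.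
Proof.
move=> xp xq; apply: contrapT => pq.
have [s [s1 s0]] : exists s : smooth M,
    (\forall x \near p, s x = 1) /\ forall x, ~ (~` [set q]) x -> s x = 0.
  apply: nbhs_bump; apply: open_nbhs_nbhs; split=> //.
  apply: closed_openC; apply: accessible_closed_set1.
  exact: hausdorff_accessible (@manifold_hausdorff _ _ M).
have := near_body s xp; rewrite (near_body s xq) (nbhs_singleton s1) s0.
  by move/eqP; rewrite eq_sym oner_eq0.
by move=> /(_ erefl).
Qed.

Lemma near_germE xi p g (u : M -> R) : near_at xi p ->
  (\forall x \near p, g x = u x) -> near_germ xi u = xi g.
Proof.
move=> xp gu; rewrite /near_germ; case: xgetP => [a _ [q [h [xq hu ->]]]|/(_ (xi g)) []].
  rewrite -(near_at_unique xp xq) in hu; apply: near_local_eq xp _.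
  by apply: filterS2 hu gu => y -> ->.
by exists p, g.
Qed.

(* Each use of the hypothesis gains a factor in the nilpotent maximal ideal. *)
Lemma determinacy (I : Type) (r : seq I) (Z : smooth M -> A) (nu : I -> A) :
  (forall i, nu i \in weil_max A) ->
  (forall f, exists h : I -> smooth M, Z f = \sum_(i <- r) nu i * Z (h i)) ->
  forall f, Z f = 0.
Proof.
move=> num ZE f.
suff H k (u : seq A) g : all (fun a => a \in weil_max A) u ->
    (\dim {:A} <= size u + k)%N -> (\prod_(a <- u) a) * Z g = 0.
  by have := H (\dim {:A}) [::] f isT (leqnn _); rewrite big_nil mul1r.
elim: k u g => [|k IH] u g um; first by rewrite addn0 => /(prod_nilpotent um) ->; rewrite mul0r.
rewrite addnS -addSn => du; have [h ->] := ZE g.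
rewrite mulr_sumr big1// => i _.
have := IH (nu i :: u) (h i); rewrite /= num um => /(_ isT du).
by rewrite big_cons [nu i * _]mulrC -mulrA.
Qed.

Definition point_derivation xi (D : smooth M -> A) :=
  [/\ forall f g, D (f + g) = D f + D g, forall (r : R) f, D (r *: f) = r *: D f &
      forall f g, D (f * g) = D f * xi g + xi f * D g].

Lemma pder1 xi D : point_derivation xi D -> D 1 = 0.
Proof.
case=> _ _ lD; have := lD 1 1; rewrite !mulr1 rmorph1 mulr1 mul1r => e.
by apply: (addrI (D 1)); rewrite addr0 -e.
Qed.

Lemma pder0 xi D : point_derivation xi D -> D 0 = 0.
Proof. by case=> _ sD _; have := sD 0 0; rewrite !scale0r. Qed.

Lemma pderB xi D f g : point_derivation xi D -> D (f - g) = D f - D g.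
Proof. by case=> aD sD _; rewrite aD -scaleN1r sD scaleN1r. Qed.

Lemma pder_sum xi D I (r : seq I) (u : I -> smooth M) : point_derivation xi D ->
  D (\sum_(i <- r) u i) = \sum_(i <- r) D (u i).
Proof.
move=> dD; elim: r => [|i r IH]; first by rewrite !big_nil (pder0 dD).
by case: (dD) => aD _ _; rewrite !big_cons aD IH.
Qed.

Lemma pder_local xi D p f : point_derivation xi D -> near_at xi p ->
  (\forall x \near p, f x = 0) -> D f = 0.
Proof.
move=> dD xp f0; have [s [s1 sf]] := nbhs_bump f0.
have sf0 : s * f = 0.
  apply: smooth_eq => x; rewrite !smoothE.
  by have [->|/sf ->] := pselect (f x = 0); rewrite ?mulr0 ?mul0r.
have [|b sb] := @body_neq0_unit _ _ (xi s).
  by rewrite (near_body s xp) (nbhs_singleton s1) oner_neq0.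
have [_ _ lD] := dD; have := lD s f.
rewrite sf0 (pder0 dD) (near_local xp f0) mulr0 add0r => e.
by rewrite -[D f]mul1r -sb mulrAC -e mul0r.
Qed.

Lemma pder_local_eq xi D p f g : point_derivation xi D -> near_at xi p ->
  (\forall x \near p, f x = g x) -> D f = D g.
Proof.
move=> dD xp fg; apply/eqP; rewrite -subr_eq0 -(pderB _ _ dD); apply/eqP.
apply: (pder_local dD xp).
by apply: filterS fg => x e; rewrite smoothE e subrr.
Qed.

(** Applied to the Hadamard expansion of f, [D] kills the constants and the coordinates, and leaves
    the sum of (xi(g_i) - g_i(p)) D(h_i). The coefficients lie in the maximal ideal, which is the
    hypothesis of [determinacy]. *)
Lemma pder_eq0 W (g : 'I_n -> smooth M) th xi D p : is_frame W g th -> W p -> near_at xi p ->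
  point_derivation xi D -> (forall i, D (g i) = 0) -> forall f, D f = 0.
Proof.
move=> fr Wp xp dD Dg0.
apply: (@determinacy 'I_n (index_enum _) D (fun i => xi (g i) - (g i p)%:A)).
  by move=> i; exact: xp.
move=> f; have [h fh] := frame_expand f fr Wp; exists h.
rewrite (pder_local_eq dD xp fh).
have [aD sD lD] := dD.
rewrite aD sD (pder1 dD) scaler0 add0r (pder_sum _ _ dD); apply: eq_bigr => i _.
rewrite lD (pderB _ _ dD) Dg0 sD (pder1 dD) scaler0 subrr mul0r add0r.
by rewrite rmorphB /= near_cst.
Qed.

Lemma near_vfield_der xi (X : vfield M) : point_derivation xi (fun f => xi (X f)).
Proof.
have [aX sX lX] := vfield_der X; split=> [f g|r f|f g].
- by rewrite aX rmorphD.
- by rewrite sX near_Z.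
- by rewrite lX rmorphD !rmorphM.
Qed.

Lemma pder_lin xi (D E : smooth M -> A) (a b : A) : point_derivation xi D ->
  point_derivation xi E -> point_derivation xi (fun f => a * D f + b * E f).
Proof.
move=> [aD sD lD] [aE sE lE]; split=> [f g|r f|f g].
- by rewrite aD aE; ring.
- by rewrite sD sE scalerDr !scalerAr.
- by rewrite lD lE; ring.
Qed.

Lemma pder_comb xi I (r : seq I) (D : I -> smooth M -> A) (a : I -> A) :
  (forall i, point_derivation xi (D i)) ->
  point_derivation xi (fun f => \sum_(i <- r) a i * D i f).
Proof.
move=> dD; elim: r => [|i r IH].
  split=> [f g|r f|f g]; rewrite !big_nil ?addr0 ?scaler0//.
  by rewrite mul0r mulr0 addr0.
have := pder_lin (a i) 1 (dD i) IH.
move=> [aD sD lD]; split=> [f g|s f|f g]; rewrite !big_cons.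
- by have := aD f g; rewrite !mul1r.
- by have := sD s f; rewrite !mul1r.
- by have := lD f g; rewrite !mul1r.
Qed.

Lemma near_frame_delta W (g : 'I_n -> smooth M) th xi p i k :
  is_frame W g th -> W p -> near_at xi p -> xi (th i (g k)) = (i == k)%:R.
Proof.
move=> [oW thg _] Wp xp.
rewrite (@near_local_eq xi p _ ((i == k)%:R *: (1 : smooth M)) xp).
  by rewrite near_cst scaler_nat.
by apply: filterS (open_nbhs_nbhs (conj oW Wp)) => q Wq; rewrite thg// smoothE mulr1.
Qed.

(** The difference of the two sides is again a derivation along [xi], and it vanishes on the
    coordinates because the frame is dual to them. *)
Lemma pder_frame W (g : 'I_n -> smooth M) th xi D p f : is_frame W g th -> W p -> near_at xi p ->
  point_derivation xi D -> D f = \sum_i D (g i) * xi (th i f).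
Proof.
move=> fr Wp xp dD; apply/eqP; rewrite -subr_eq0; apply/eqP.
have dS := pder_comb (index_enum 'I_n) (fun i => D (g i)) (fun i => near_vfield_der xi (th i)).
have := pder_lin 1 (-1) dD dS => dZ.
have := pder_eq0 fr Wp xp dZ => /(_ _ f); rewrite mul1r mulN1r; apply => k.
have E i := near_frame_delta i k fr Wp xp.
rewrite mul1r mulN1r (bigD1 k)//= E eqxx mulr1 big1 ?addr0 ?subrr// => i ik.
by rewrite E (negbTE ik) mulr0.
Qed.

(** [determinacy] again, for the difference of the two near points: the common base point and the
    equal values on coordinates let the factor xi(g_i) - g_i(p) be taken out. *)
Lemma near_eq W (g : 'I_n -> smooth M) th xi xi' p : is_frame W g th -> W p -> near_at xi p ->
  near_at xi' p -> (forall i, xi (g i) = xi' (g i)) -> forall f, xi f = xi' f.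
Proof.
move=> fr Wp xp xp' e f; apply/eqP; rewrite -subr_eq0; apply/eqP; move: f.
apply: (@determinacy 'I_n (index_enum _) (fun f => xi f - xi' f)
  (fun i => xi (g i) - (g i p)%:A)); first by move=> i; exact: xp.
move=> f; have [h fh] := frame_expand f fr Wp; exists h.
set F := (_ + _) in fh.
have E (y : near_point M A) : y F = (f p)%:A + \sum_i (y (g i) - (g i p)%:A) * y (h i).
  rewrite /F rmorphD /= near_cst rmorph_sum; congr (_ + _); apply: eq_bigr => i _.
  by rewrite rmorphM rmorphB /= near_cst.
rewrite (near_local_eq xp fh) (near_local_eq xp' fh) !E.
rewrite opprD addrACA subrr add0r -sumrB; apply: eq_bigr => i _.
by rewrite -e -mulrBr.
Qed.

Lemma near_point_ext xi xi' : (forall f, xi f = xi' f) -> xi = xi'.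
Proof.
move: xi xi' => [xi sxi bxi] [xi' sxi' bxi'] /= e.
have {}e : xi = xi'.
  case: xi xi' {sxi bxi sxi' bxi'} e => f [[f1] [f2]] [g [[g1] [g2]]] /= e.
  have {e}fg : f = g by apply/funext.
  by rewrite fg in f1 f2 *; rewrite (Prop_irrelevance f1 g1) (Prop_irrelevance f2 g2).
rewrite -e in sxi' bxi' *.
by rewrite (Prop_irrelevance sxi sxi') (Prop_irrelevance bxi bxi').
Qed.

End NearPoints.

(** * Taylor expansion with nilpotent increments *)

Section Taylor.
Context {R : realType} {n : nat} {A : weilAlgebra R}.
Implicit Types (O : set 'rV[R]_n) (F G : 'rV[R]_n -> R) (x : 'rV[R]_n) (nu : 'I_n -> A).

(* The term of degree [k] of the Taylor expansion of [F] at [x], with increment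
   [nu], as the [k]-th power of [sum_i nu_i d_i] divided by [k!]. *)
Fixpoint taylor_term k F x nu : A :=
  if k is k'.+1 then
    k%:R^-1 *: \sum_i nu i * taylor_term k' ('D_(delta_mx 0 i) F) x nu
  else (F x)%:A.

Lemma taylor_eq k O F G x nu : open O -> O x -> (forall y, O y -> F y = G y) ->
  taylor_term k F x nu = taylor_term k G x nu.
Proof.
move=> oO Ox; elim: k F G => [|k IH] F G FG /=; first by rewrite FG.
congr (_ *: _); apply: eq_bigr => i _; congr (_ * _); apply: IH => y Oy.
by apply: near_eq_derive; apply: filterS (open_nbhs_nbhs (conj oO Oy)) => z; exact: FG.
Qed.

Definition Cinf {V W : normedModType R} (O : set V) (F : V -> W) := forall k, Ck k O F.

Lemma Cinf_derive {V W : normedModType R} (O : set V) (F : V -> W) (v : V) :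
  Cinf O F -> Cinf O ('D_v F).
Proof. by move=> CF k; have /CkP[_ /(_ v)[]] := CF k.+1. Qed.

Lemma Cinf_derivable {V W : normedModType R} (O : set V) (F : V -> W) (v x : V) :
  Cinf O F -> O x -> derivable F x v.
Proof. by move=> CF; have /CkP[_ /(_ v)[+ _]] := CF 1; exact. Qed.

Lemma taylorD k O F G x nu : open O -> O x -> Cinf O F -> Cinf O G ->
  taylor_term k (F + G) x nu = taylor_term k F x nu + taylor_term k G x nu.
Proof.
move=> oO Ox; elim: k F G => [|k IH] F G CF CG /=; first by rewrite scalerDl.
rewrite -scalerDr -big_split /=; congr (_ *: _); apply: eq_bigr => i _.
rewrite -mulrDr -IH; [|exact: Cinf_derive..]; congr (_ * _).
by apply: taylor_eq oO Ox _ => y Oy; rewrite deriveD//; exact: Cinf_derivable Oy.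
Qed.

Lemma taylorZ k O (r : R) F x nu : open O -> O x -> Cinf O F ->
  taylor_term k (r \*: F) x nu = r *: taylor_term k F x nu.
Proof.
move=> oO Ox; elim: k F => [|k IH] F CF /=; first by rewrite scalerA.
rewrite [RHS]scalerA mulrC -scalerA; congr (_ *: _); rewrite scaler_sumr; apply: eq_bigr => i _.
rewrite scalerAr -IH; [|exact: Cinf_derive]; congr (_ * _).
by apply: taylor_eq oO Ox _ => y Oy; rewrite deriveZ//; exact: Cinf_derivable Oy.
Qed.

Lemma taylor_termS k F x nu : taylor_term k.+1 F x nu =
  k.+1%:R^-1 *: \sum_i nu i * taylor_term k ('D_(delta_mx 0 i) F) x nu.
Proof. by []. Qed.

Lemma taylor_term_cst k (r : R) x nu : taylor_term k.+1 (cst r) x nu = 0.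
Proof.
have dc (s : R) (i : 'I_n) : 'D_(delta_mx 0 i) (cst s : 'rV[R]_n -> R) = cst 0.
  by apply/funext => y; rewrite derive_cst.
have T0 j : taylor_term j (cst 0) x nu = 0.
  elim: j => [|j IH]; first by rewrite /= scale0r.
  rewrite taylor_termS big1 ?scaler0// => i _.
  by rewrite dc IH mulr0.
rewrite taylor_termS big1 ?scaler0// => i _.
by rewrite dc T0 mulr0.
Qed.

Lemma taylorS k F x nu : k.+1%:R *: taylor_term k.+1 F x nu =
  \sum_i nu i * taylor_term k ('D_(delta_mx 0 i) F) x nu.
Proof. by rewrite taylor_termS scalerA divff ?scale1r// pnatr_eq0. Qed.

(** The Leibniz rule for powers of the derivation sum_i nu_i d_i, divided by k!. After
    multiplication by k + 1, the two halves of the product rule give the weights l and k + 1 - l,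
    which add up to k + 1. *)
Lemma taylorM k O F G x nu : open O -> O x -> Cinf O F -> Cinf O G ->
  taylor_term k (F * G) x nu =
  \sum_(l < k.+1) taylor_term l F x nu * taylor_term (k - l) G x nu.
Proof.
move=> oO Ox; elim: k F G => [|k IH] F G CF CG.
  by rewrite big_ord1 /= -scalerAl mul1r scalerA.
apply: (@scalerI _ _ k.+1%:R); first by rewrite pnatr_eq0.
rewrite taylorS.
have C1 i : Cinf O ('D_(delta_mx 0 i) F * G).
  by move=> k'; apply: CkM => //; exact: Cinf_derive.
have C2 i : Cinf O (F * 'D_(delta_mx 0 i) G).
  by move=> k'; apply: CkM => //; exact: Cinf_derive.
transitivity (\sum_i \sum_(l < k.+1) ((nu i * taylor_term l ('D_(delta_mx 0 i) F) x nu) *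
     taylor_term (k - l) G x nu + taylor_term l F x nu *
     (nu i * taylor_term (k - l) ('D_(delta_mx 0 i) G) x nu))).
  apply: eq_bigr => i _.
  rewrite (@taylor_eq k O _ ('D_(delta_mx 0 i) F * G + F * 'D_(delta_mx 0 i) G))//; last first.
    move=> y Oy; rewrite deriveM; [|exact: Cinf_derivable Oy..].
    by rewrite !fctE addrC [G y *: _]mulrC.
  rewrite (taylorD _ _ oO Ox)// IH//; last exact: Cinf_derive.
  rewrite IH//; last exact: Cinf_derive.
  rewrite -big_split mulr_sumr /=; apply: eq_bigr => l _; ring.
rewrite exchange_big /=.
transitivity (\sum_(l < k.+1) (l.+1%:R *: taylor_term l.+1 F x nu * taylor_term (k - l) G x nu)
  + \sum_(l < k.+1) (taylor_term l F x nu * ((k - l).+1%:R *: taylor_term (k - l).+1 G x nu))).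
  rewrite -big_split /=; apply: eq_bigr => l _; rewrite big_split /= !taylorS.
  by rewrite mulr_suml mulr_sumr.
(* Index shift; the term l = 0 that is added has weight 0. In [E2] it is the last term, l = k + 1,
   that has weight 0. *)
have E1 : \sum_(l < k.+1) (l.+1%:R *: taylor_term l.+1 F x nu * taylor_term (k - l) G x nu)
  = \sum_(l < k.+2) l%:R *: (taylor_term l F x nu * taylor_term (k.+1 - l) G x nu).
  rewrite [RHS]big_ord_recl scale0r add0r; apply: eq_bigr => l _.
  by rewrite -scalerAl subSS.
have E2 : \sum_(l < k.+1) (taylor_term l F x nu * ((k - l).+1%:R *: taylor_term (k - l).+1 G x nu))
  = \sum_(l < k.+2) (k.+1 - l)%:R *: (taylor_term l F x nu * taylor_term (k.+1 - l) G x nu).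
  rewrite [RHS]big_ord_recr /= subnn scale0r addr0; apply: eq_bigr => l _.
  by rewrite -scalerAr subSn// -ltnS.
rewrite E1 E2 -big_split scaler_sumr /=; apply: eq_bigr => l _.
by rewrite -scalerDl -natrD subnKC// -ltnS.
Qed.

(** A term of degree k carries k factors [nu i]; the list [u] collects those which the recursion has
    already taken out. *)
Lemma taylor_nil0 k F x nu (u : seq A) : (forall i, nu i \in weil_max A) ->
  all (fun a => a \in weil_max A) u -> (\dim {:A} <= size u + k)%N ->
  (\prod_(a <- u) a) * taylor_term k F x nu = 0.
Proof.
move=> num; elim: k F u => [|k IH] F u um.
  by rewrite addn0 => /(prod_nilpotent um) ->; rewrite mul0r.
rewrite addnS -addSn => du /=; rewrite -scalerAr mulr_sumr big1 ?scaler0// => i _.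
have := IH ('D_(delta_mx 0 i) F) (nu i :: u); rewrite /= num um => /(_ isT du).
by rewrite big_cons [nu i * _]mulrC -mulrA.
Qed.

Lemma taylor_nil k F x nu : (forall i, nu i \in weil_max A) -> (\dim {:A} <= k)%N ->
  taylor_term k F x nu = 0.
Proof.
move=> num dk; have := taylor_nil0 F x num (isT : all (fun a => a \in weil_max A) [::]).
by move=> /(_ k dk); rewrite big_nil mul1r.
Qed.

(** Writing the sum as the value at 1 of a polynomial turns the Cauchy product of two expansions
    into a product of polynomials. For [nu] in the maximal ideal the terms beyond the truncation
    vanish. *)
Definition taylor F x nu : A := (\poly_(k < \dim {:A}) taylor_term k F x nu).[1].

Lemma taylorE F x nu : taylor F x nu = \sum_(k < \dim {:A}) taylor_term k F x nu.
Proof.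
by rewrite /taylor horner_poly; apply: eq_bigr => k _; rewrite expr1n mulr1.
Qed.

Lemma taylor_congr O F G x nu : open O -> O x -> (forall y, O y -> F y = G y) ->
  taylor F x nu = taylor G x nu.
Proof.
by move=> oO Ox FG; rewrite !taylorE; apply: eq_bigr => k _; exact: taylor_eq oO Ox FG.
Qed.

Lemma taylor_add O F G x nu : open O -> O x -> Cinf O F -> Cinf O G ->
  taylor (F + G) x nu = taylor F x nu + taylor G x nu.
Proof.
move=> oO Ox CF CG; rewrite !taylorE -big_split; apply: eq_bigr => k _.
exact: taylorD oO Ox CF CG.
Qed.

Lemma taylor_scale O (r : R) F x nu : open O -> O x -> Cinf O F ->
  taylor (r \*: F) x nu = r *: taylor F x nu.
Proof.
move=> oO Ox CF; rewrite !taylorE scaler_sumr; apply: eq_bigr => k _.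
exact: taylorZ oO Ox CF.
Qed.

(* The nilpotency of [nu] makes the truncated expansions multiply exactly. *)
Lemma taylor_mul O F G x nu : (forall i, nu i \in weil_max A) ->
  open O -> O x -> Cinf O F -> Cinf O G ->
  taylor (F * G) x nu = taylor F x nu * taylor G x nu.
Proof.
move=> num oO Ox CF CG; rewrite /taylor -hornerM; congr (_.[1]); apply/polyP => k.
have E H l : (\poly_(k < \dim {:A}) taylor_term k H x nu)`_l = taylor_term l H x nu.
  by rewrite coef_poly; case: ltnP => // dl; rewrite taylor_nil.
rewrite coefM E (taylorM _ _ oO Ox CF CG); apply: eq_bigr => l _.
by rewrite !E.
Qed.

Lemma taylor_cst (r : R) x nu : taylor (cst r) x nu = r%:A.
Proof.
have d0 : (0 < \dim {:A})%N by rewrite -(weil_codim A) addn1.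
rewrite taylorE -(prednK d0) big_ord_recl big1 ?addr0// => k _.
by rewrite lift0 taylor_term_cst.
Qed.

Lemma taylor_body F x nu : (forall i, nu i \in weil_max A) ->
  taylor F x nu - (F x)%:A \in weil_max A.
Proof.
move=> num; have d0 : (0 < \dim {:A})%N by rewrite -(weil_codim A) addn1.
rewrite taylorE -(prednK d0) big_ord_recl /= addrC addKr.
apply: memv_suml => k _; apply: memvZ; apply: memv_suml => i _.
by rewrite mulrC weil_idealM.
Qed.

Lemma taylor_coord i x nu : (forall i, nu i \in weil_max A) ->
  taylor (fun v : 'rV[R]_n => v 0 i) x nu = (x 0 i)%:A + nu i.
Proof.
move=> num; have d0 : (0 < \dim {:A})%N by rewrite -(weil_codim A) addn1.
have dc j : 'D_(delta_mx 0 j) (fun v : 'rV[R]_n => v 0 i) = cst ((j == i)%:R : R).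
  by apply/funext => y; rewrite derive_coord mxE /= eq_sym.
rewrite taylorE -(prednK d0) big_ord_recl; congr (_ + _).
case e : (\dim {:A}).-1 => [|d].
  (* In dimension 1 the truncation has no term of degree one, but then [nu i] is 0. *)
  have d1 : (\dim {:A} <= 1)%N by lia.
  rewrite big_ord0; apply/esym.
  have := @prod_nilpotent R A [:: nu i]; rewrite /= num big_seq1; exact.
rewrite big_ord_recl big1 ?addr0 => [|k _].
  have dcx j y : 'D_(delta_mx 0 j) (fun v : 'rV[R]_n => v 0 i) y = (j == i)%:R.
    by have := congr1 (fun f : 'rV[R]_n -> R => f y) (dc j).
  rewrite /= invr1 scale1r (bigD1 i)//= dcx eqxx scale1r mulr1 big1 ?addr0// => j ji.
  by rewrite dcx (negbTE ji) scale0r mulr0.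
rewrite !lift0 taylor_termS big1 ?scaler0// => j _.
by rewrite dc taylor_term_cst mulr0.
Qed.

End Taylor.

(** * Charts of M^A *)

Section NearCharts.
Context {R : realType} {n : nat} {M : manifold R n} {A : weilAlgebra R}.
Local Notation e := (vbasis {:A}).
Local Notation V := 'M[R]_(n, \dim {:A}).
Implicit Types (c : chart M 'rV[R]_n) (p q : M) (xi : near_point M A) (v : V).

(** A matrix [v] is read as a point of A^n, which is split into its real part [abody] and its
    nilpotent part [anil], the point and the increment of a Taylor expansion. *)
Definition acoord v (i : 'I_n) : A := \sum_j v i j *: e`_j.
Definition abody v : 'rV[R]_n := \row_i body (acoord v i).
Definition anil v (i : 'I_n) : A := acoord v i - (abody v 0 i)%:A.

Lemma coord_acoord v i j : coord e j (acoord v i) = v i j.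
Proof. by rewrite /acoord coord_sum_free// (basis_free (vbasisP _)). Qed.

Lemma acoord_eq v i (a : A) : (forall j, v i j = coord e j a) -> acoord v i = a.
Proof.
move=> va; rewrite [RHS](coord_vbasis (memvf a)); apply: eq_bigr => j _.
by rewrite va.
Qed.

Lemma anil_max v i : anil v i \in weil_max A.
Proof. by rewrite /anil mxE bodyP. Qed.

Lemma abodyE v i : abody v 0 i = \sum_j v i j * body e`_j.
Proof. by rewrite mxE body_sum; apply: eq_bigr => j _; rewrite bodyZ. Qed.

Lemma Ck_abody k (O : set V) i : open O -> Ck k O (fun v => abody v 0 i).
Proof.
move=> oO; rewrite (_ : (fun _ => _) = fun v => \sum_j v i j * body e`_j).
  by apply: Ck_sum => // j; apply: CkM => //; [exact: Ck_coord|exact: Ck_cst].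
by apply/funext => v; exact: abodyE.
Qed.

Lemma abody_continuous v : {for v, continuous abody}.
Proof.
apply: (@cvg_mx _ _ (nbhs v) _) => i j; rewrite (ord1 i).
exact: Ck0 (Ck_abody 0 j openT) v I.
Qed.

Lemma open_abody (O : set 'rV[R]_n) : open O -> open (abody @^-1` O).
Proof.
move=> oO; rewrite -[X in open X]setTI; apply: open_preimage => //.
  exact: openT.
by move=> v _; exact: abody_continuous.
Qed.

(** This is the image of the chart of M^A induced by [c]: the inclusions are [near_dom_chart] and
    [near_invP]. *)
Definition near_dom c : set V := [set v | (c.2 @` c.1) (abody v)].

Lemma open_near_dom c : atlas M c -> open (near_dom c).
Proof.
by move=> ac; apply: open_abody; apply: open_chart_image => //; exact: atlas_open.
Qed.

Lemma Cinf_chart_inv c p (f : smooth M) : atlas M c ->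
  Cinf (c.2 @` c.1) (f \o chart_inv c p).
Proof.
move=> ac k; apply: Ck_chart_inv => // x cx.
exact: smooth_at_near ac cx (smooth_smooth_at f x).
Qed.

Definition taylor_chart c p v (f : smooth M) : A :=
  taylor (f \o chart_inv c p) (abody v) (anil v).

(** Taylor expansion at the real part with the nilpotent part as increment is an algebra morphism,
    since products are exact. This gives surjectivity of the charts of M^A onto [near_dom]. *)
Lemma near_construct c p v q : atlas M c -> c.1 q -> abody v = c.2 q ->
  exists xi : near_point M A, near_at xi q /\ forall f, xi f = taylor_chart c p v f.
Proof.
move=> ac cq vq; pose phi := taylor_chart c p v.
have oc : open (c.2 @` c.1) by apply: open_chart_image => //; exact: atlas_open.
have cv : (c.2 @` c.1) (abody v) by rewrite vq; exists q.
have Cf (f : smooth M) := Cinf_chart_inv p f ac.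
have pc (r : R) : phi (r *: (1 : smooth M)) = r%:A.
  rewrite -[RHS](taylor_cst r (abody v) (anil v)); congr (taylor _ _ _).
  by apply/funext => x; exact: mulr1.
have pa : nmod_morphism phi.
  split=> [|f g]; last exact: taylor_add oc cv (Cf f) (Cf g).
  by have := pc 0; rewrite !scale0r.
have pm : monoid_morphism phi.
  split=> [|f g]; first by have := pc 1; rewrite !scale1r.
  exact: taylor_mul (anil_max v) oc cv (Cf f) (Cf g).
pose phiA := GRing.isNmodMorphism.Build _ _ phi pa.
pose phiM := GRing.isMonoidMorphism.Build _ _ phi pm.
pose phiR : {rmorphism smooth M -> A} := HB.pack phi phiA phiM.
have sc : scalable phiR by move=> r f; exact: taylor_scale oc cv (Cf f).
have bq : near_at phiR q.
  move=> f; have := taylor_body (f \o chart_inv c p) (abody v) (anil_max v).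
  by rewrite {2}vq /= chart_invK.
by exists (NearPoint sc (ex_intro _ q bq)).
Qed.

Lemma acoord_near_chart c xi q (g : smooth M) i : near_at xi q ->
  (\forall x \near q, g x = c.2 x 0 i) -> acoord ((near_chart A c).2 xi) i = xi g.
Proof.
move=> xq gc; apply: acoord_eq => j; rewrite mxE.
by rewrite (near_germE xq gc).
Qed.

Lemma abody_near_chart c xi q : atlas M c -> c.1 q -> near_at xi q ->
  abody ((near_chart A c).2 xi) = c.2 q.
Proof.
move=> ac cq xq; apply/rowP => i; rewrite mxE.
have [g gc] := chart_coord_ex i ac cq.
by rewrite (acoord_near_chart xq gc) (near_body g xq) (nbhs_singleton gc).
Qed.

Lemma taylor_chart_coord c p v q i (g : smooth M) : atlas M c -> c.1 q ->
  abody v = c.2 q -> (\forall x \near q, g x = c.2 x 0 i) ->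
  taylor_chart c p v g = acoord v i.
Proof.
move=> ac cq vq gc.
have [W [oW Wq] gW] : exists2 W, open_nbhs q W & W `<=` [set x | g x = c.2 x 0 i].
  by move: gc; rewrite -[X in X -> _]/(nbhs q _) nbhsE.
pose D := W `&` c.1.
have oD : open (c.2 @` D).
  by apply: open_chart_image => [//||x []//]; apply: openI => //; exact: atlas_open.
have Dv : (c.2 @` D) (abody v) by rewrite vq; exists q.
rewrite /taylor_chart (@taylor_congr _ _ _ (c.2 @` D) _ (fun w : 'rV[R]_n => w 0 i))//.
  by rewrite taylor_coord; [rewrite /anil addrC subrK|exact: anil_max].
by move=> _ [x [Wx cx] <-]; rewrite /= chart_invK//; exact: gW.
Qed.

(** Both sides are near points of [q] with the same values on the coordinates, so [near_eq]
    applies. *)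
Lemma near_taylor c p xi q f : atlas M c -> c.1 q -> near_at xi q ->
  xi f = taylor_chart c p ((near_chart A c).2 xi) f.
Proof.
move=> ac cq xq; have vq := abody_near_chart ac cq xq.
have [xi' [xq' E]] := near_construct p ac cq vq.
have [W [g [th [fr Wq Wc gW]]]] := frame_exists ac cq.
rewrite -E; apply: (near_eq fr Wq xq xq') => i; rewrite E.
have gc : \forall x \near q, g i x = c.2 x 0 i.
  by have [oW _ _] := fr; apply: filterS (open_nbhs_nbhs (conj oW Wq)) => x; exact: gW.
by rewrite (taylor_chart_coord p ac cq vq gc) (acoord_near_chart xq gc).
Qed.

(** The default [xi0] is an argument because M^A may be empty. *)
Definition near_inv c (xi0 : near_point M A) v : near_point M A :=
  if pselect (exists xi, (near_chart A c).1 xi /\ (near_chart A c).2 xi = v) is left h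
  then sval (cid h) else xi0.

Lemma near_inv_ex c xi0 v :
  (exists xi, (near_chart A c).1 xi /\ (near_chart A c).2 xi = v) ->
  (near_chart A c).1 (near_inv c xi0 v) /\ (near_chart A c).2 (near_inv c xi0 v) = v.
Proof. by move=> h; rewrite /near_inv; case: pselect => // h'; case: cid. Qed.

Lemma near_chart_inj c xi xi' : atlas M c -> (near_chart A c).1 xi ->
  (near_chart A c).1 xi' -> (near_chart A c).2 xi = (near_chart A c).2 xi' -> xi = xi'.
Proof.
move=> ac [q cq xq] [q' cq' xq'] e; apply: near_point_ext => f.
by rewrite (near_taylor q f ac cq xq) e -(near_taylor q f ac cq' xq').
Qed.

Lemma near_invK c xi0 xi : atlas M c -> (near_chart A c).1 xi ->
  near_inv c xi0 ((near_chart A c).2 xi) = xi.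
Proof.
move=> ac cxi; have [|cy ey] := @near_inv_ex c xi0 ((near_chart A c).2 xi).
  by exists xi.
exact: near_chart_inj ac cy cxi ey.
Qed.

Lemma near_invP c xi0 v : atlas M c -> near_dom c v ->
  (near_chart A c).1 (near_inv c xi0 v) /\ (near_chart A c).2 (near_inv c xi0 v) = v.
Proof.
move=> ac [q cq qv]; have [xi [xq E]] := near_construct q ac cq (esym qv).
apply: near_inv_ex; exists xi; split; first by exists q.
apply/matrixP => i j; rewrite -coord_acoord -[RHS]coord_acoord; congr (coord e j _).
have [g gc] := chart_coord_ex i ac cq.
by rewrite (acoord_near_chart xq gc) E (taylor_chart_coord q ac cq (esym qv) gc).
Qed.

Lemma near_inv_at c xi0 v q : atlas M c -> c.1 q -> abody v = c.2 q ->
  near_at (near_inv c xi0 v) q.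
Proof.
move=> ac cq vq; have dv : near_dom c v by exists q.
have [[q' cq' xq'] E] := near_invP xi0 ac dv.
have := abody_near_chart ac cq' xq'; rewrite E vq => h.
by rewrite (atlas_inj ac cq cq' h).
Qed.

Lemma near_dom_chart c xi : atlas M c -> (near_chart A c).1 xi ->
  near_dom c ((near_chart A c).2 xi).
Proof.
by move=> ac [q cq xq]; rewrite /near_dom /= (abody_near_chart ac cq xq); exists q.
Qed.

End NearCharts.

(** * C^k maps with values in a finite-dimensional algebra *)

Section AlgebraValued.
Context {R : realType} {V : normedModType R} {A : comVectAlgType R}.
Local Notation e := (vbasis {:A}).
Implicit Types (O : set V) (F G : V -> A).

Definition CkA k O F := forall j, Ck k O (fun v => coord e j (F v)).

Lemma CkA_eq k O F G : open O -> (forall v, O v -> F v = G v) -> CkA k O F -> CkA k O G.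
Proof. by move=> oO FG CF j; apply: Ck_eq (CF j) => // v Ov; rewrite FG. Qed.

Lemma CkA_cst k O (a : A) : CkA k O (fun=> a).
Proof. by move=> j; exact: Ck_cst. Qed.

Lemma CkAD k O F G : open O -> CkA k O F -> CkA k O G -> CkA k O (fun v => F v + G v).
Proof.
move=> oO CF CG j; under eq_fun do rewrite linearD.
by apply: CkD => //; [exact: CF|exact: CG].
Qed.

Lemma CkA_sum k O I (r : seq I) (F : I -> V -> A) : open O ->
  (forall i, CkA k O (F i)) -> CkA k O (fun v => \sum_(i <- r) F i v).
Proof.
move=> oO CF j; under eq_fun do rewrite linear_sum.
by apply: Ck_sum => // i; exact: CF.
Qed.

Lemma CkA_scale k O (a : V -> R) (b : A) : open O -> Ck k O a ->
  CkA k O (fun v => a v *: b).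
Proof.
move=> oO Ca j; under eq_fun do rewrite linearZ.
by apply: CkM => //; exact: Ck_cst.
Qed.

Lemma coord_mul (a b : A) j : coord e j (a * b) = \sum_(i < \dim {:A})
  \sum_(l < \dim {:A}) (coord e i a * coord e l b) * coord e j (e`_i * e`_l).
Proof.
rewrite {1}(coord_vbasis (memvf a)) {1}(coord_vbasis (memvf b)).
rewrite mulr_suml linear_sum; apply: eq_bigr => i _.
rewrite mulr_sumr linear_sum; apply: eq_bigr => l _.
by rewrite -scalerAl -scalerAr scalerA linearZ.
Qed.

Lemma CkAM k O F G : open O -> CkA k O F -> CkA k O G -> CkA k O (fun v => F v * G v).
Proof.
move=> oO CF CG j; under eq_fun do rewrite coord_mul.
apply: Ck_sum => // i; apply: Ck_sum => // l; apply: CkM => //; last exact: Ck_cst.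
exact: CkM.
Qed.

Lemma CkA_local k O F : (forall x, O x -> exists N, [/\ open N, N x & CkA k N F]) ->
  CkA k O F.
Proof.
move=> H j; apply: Ck_local => x /H[N [oN Nx CN]]; exists N; split=> //; exact: CN.
Qed.

Lemma CkA_sub k O O' F : O' `<=` O -> CkA k O F -> CkA k O' F.
Proof. by move=> sO CF j; exact: Ck_sub (CF j). Qed.

End AlgebraValued.

(** * Smooth A-valued functions on M^A *)

Section SmoothA.
Context {R : realType} {n : nat} {M : manifold R n} {A : weilAlgebra R}.
Local Notation e := (vbasis {:A}).
Local Notation V := 'M[R]_(n, \dim {:A}).
Implicit Types (c : chart M 'rV[R]_n) (p q : M) (xi : near_point M A) (v : V).

Lemma CkA_acoord k (O : set V) i : CkA k O (fun v => acoord v i : A).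
Proof. by move=> j; under eq_fun do rewrite coord_acoord; exact: Ck_coord. Qed.

Lemma CkA_anil k (O : set V) i : open O -> CkA k O (fun v => anil v i : A).
Proof.
move=> oO.
apply: (@CkAD _ _ _ k O (fun v => acoord v i) (fun v => - (abody v 0 i)%:A)) => //.
  exact: CkA_acoord.
rewrite (_ : (fun v => _) = fun v : V => abody v 0 i *: (-1 : A)).
  by apply: CkA_scale => //; exact: Ck_abody.
by apply/funext => v; rewrite scalerN.
Qed.

(** Real and nilpotent parts depend linearly on the matrix, and a Taylor term is polynomial in the
    increment with smooth functions of the real part as coefficients. *)
Lemma CkA_taylor_term k l (O : set V) (Q : set 'rV[R]_n) (F : 'rV[R]_n -> R) :
  open O -> open Q -> (forall v, O v -> Q (abody v)) -> Cinf Q F ->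
  CkA k O (fun v => taylor_term l F (abody v) (anil v)).
Proof.
move=> oO oQ OQ; elim: l F => [|l IH] F CF.
  apply: CkA_scale => //.
  apply: (Ck_comp oO oQ OQ) => // i j.
  by rewrite (ord1 i); exact: Ck_abody.
under eq_fun do rewrite taylor_termS scaler_sumr.
apply: CkA_sum => // i; under eq_fun do rewrite scalerAr.
apply: CkAM => //; first exact: CkA_anil.
under eq_fun do rewrite -mulr_algl.
by apply: CkAM => //; [exact: CkA_cst|apply: IH; exact: Cinf_derive].
Qed.

Lemma CkA_taylor_chart k c p (f : smooth M) : atlas M c ->
  CkA k (near_dom (A := A) c) (fun v => taylor_chart c p v f).
Proof.
move=> ac; have oc : open (c.2 @` c.1) by apply: open_chart_image => //; exact: atlas_open.
have od := @open_near_dom _ _ M A c ac.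
under eq_fun do rewrite /taylor_chart taylorE.
apply: CkA_sum => // l; apply: (CkA_taylor_term k l od oc) => //.
exact: Cinf_chart_inv.
Qed.

Lemma near_atlasP (F : near_point M A -> A) :
  smooth_vect (@near_atlas R n M A) F <-> forall c xi0 k, atlas M c ->
    CkA k (near_dom (A := A) c) (F \o near_inv c xi0).
Proof.
split=> [sF c xi0 k ac j|CF j _ [c ac <-]].
  have [|G [ O [oO sO CG]] FG] := sF j (near_chart A c); first by exists c.
  have od := @open_near_dom _ _ M A c ac.
  apply: (@Ck_eq _ _ _ _ _ G) => // [v dv|].
    have [cv ev] := near_invP xi0 ac dv.
    by rewrite /= FG// ev.
  apply: Ck_sub (CG k) => v dv; apply: sO.
  have [cv ev] := near_invP xi0 ac dv.
  by exists (near_inv c xi0 v).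
(* The inverse chart needs a near point as default; if there is none, any representative will do. *)
have [[xi0 _]|no] := pselect (exists xi : near_point M A, True); last first.
  exists (cst 0); last by move=> xi; case: no; exists xi.
  by exists setT; split; [exact: openT| |move=> k; exact: Ck_cst].
exists (fun v => coord e j (F (near_inv c xi0 v))); last first.
  by move=> xi cxi; rewrite near_invK.
exists (near_dom c); split; first exact: open_near_dom.
  by move=> _ [xi cxi <-]; exact: near_dom_chart.
by move=> k; exact: CF.
Qed.

Lemma CkA_smoothA (F : smoothA M A) c xi0 k : atlas M c ->
  CkA k (near_dom (A := A) c) (F \o near_inv c xi0).
Proof. by move=> ac; have /asboolP/near_atlasP := smoothAP F; exact. Qed.

Lemma near_baseP xi : exists p, near_at xi p.
Proof. exact: near_base. Qed.

(** Smoothness on M^A is local over [M]: it suffices to test it above small open sets of base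
    points. *)
Lemma smoothA_local (F : near_point M A -> A) :
  (forall xi p, near_at xi p -> exists (G : smoothA M A) W, nbhs p W /\
     forall xi' q, near_at xi' q -> W q -> F xi' = G xi') ->
  (F : near_point M A -> A^o) \in smoothA_pred (M := M) (A := A).
Proof.
move=> FG; apply/asboolP/near_atlasP => c xi0 k ac; apply: CkA_local => v dv.
have od := @open_near_dom _ _ M A c ac.
have [q cq qv] := dv; have xq := near_inv_at xi0 ac cq (esym qv).
have [G [W [Wq GW]]] := FG _ _ xq.
have [W' [oW' Wq'] sW] : exists2 W', open_nbhs q W' & W' `<=` W by move: Wq; rewrite nbhsE.
pose D := W' `&` c.1.
have oD : open (c.2 @` D).
  by apply: open_chart_image => [//||x []//]; apply: openI => //; exact: atlas_open.
exists (abody @^-1` (c.2 @` D)); split.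
- exact: open_abody.
- by rewrite /= -qv; exists q.
- apply: (@CkA_eq _ _ _ _ _ (G \o near_inv c xi0)); first exact: open_abody.
    move=> w [x [Wx cx] xw]; apply/esym/(GW _ x); last exact: sW.
    exact: near_inv_at ac cx (esym xw).
  apply: CkA_sub (CkA_smoothA G xi0 k ac) => w [x [_ cx] xw]; by exists x.
Qed.

(** In a chart the function is the Taylor expansion of [f], smooth in the point and the increment
    together. The default in [prolong_fun] is therefore never taken. *)
Lemma prolong_smooth (f : smooth M) :
  (fun xi : near_point M A => xi f : A^o) \in smoothA_pred (M := M) (A := A).
Proof.
apply/asboolP/near_atlasP => c xi0 k ac.
have od := @open_near_dom _ _ M A c ac.
have [[p cp]|nc] := pselect (exists p, c.1 p); last first.
  by apply: CkA_local => v [q cq _]; case: nc; exists q.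
apply: CkA_eq (CkA_taylor_chart k p f ac) => // v dv.
have [[q cq xq] ev] := near_invP xi0 ac dv.
by rewrite /= (near_taylor p f ac cq xq) ev.
Qed.

Lemma prolong_funE (f : smooth M) xi : prolong_fun A f xi = xi f.
Proof.
rewrite /prolong_fun.
have := insubdK (0 : smoothA M A) (prolong_smooth f).
by move=> /(congr1 (fun F : near_point M A -> A^o => F xi)).
Qed.

End SmoothA.

(** * Extension of vector fields *)

Section RealDerivative.
Context {R : realType} {V : normedModType R}.
Implicit Types (f g : V -> R) (v w : V).

Lemma is_derive_mulr f v w (df c : R) :
  is_derive v w f df -> is_derive v w (fun u => f u * c) (df * c).
Proof.
move=> [cf <-]; rewrite mulrC (_ : (fun u => _) = c \*: f).
  by apply: DeriveDef; [exact: derivableZ|rewrite deriveZ].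
by apply/funext => u; rewrite mulrC.
Qed.

Lemma is_derive_mul f g v w (df dg : R) :
  is_derive v w f df -> is_derive v w g dg ->
  is_derive v w (fun u => f u * g u) (df * g v + f v * dg).
Proof.
move=> [cf <-] [cg <-]; apply: DeriveDef; first exact: (derivableM cf cg).
by rewrite [LHS](deriveM cf cg) /GRing.scale/=; ring.
Qed.

Lemma is_derive_add f g v w (df dg : R) :
  is_derive v w f df -> is_derive v w g dg ->
  is_derive v w (fun u => f u + g u) (df + dg).
Proof.
move=> [cf <-] [cg <-]; apply: DeriveDef; first exact: derivableD.
exact: (deriveD cf cg).
Qed.

End RealDerivative.

Section AlgebraDerivative.
Context {R : realType} {V : normedModType R} {A : comVectAlgType R}.
Local Notation e := (vbasis {:A}).
Implicit Types (O : set V) (F G : V -> A) (v w : V).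

Definition deriveA w F v : A := \sum_j 'D_w (fun u => coord e j (F u)) v *: e`_j.

Lemma coord_deriveA w F v j : coord e j (deriveA w F v) = 'D_w (fun u => coord e j (F u)) v.
Proof. by rewrite /deriveA coord_sum_free// (basis_free (vbasisP _)). Qed.

Lemma coord_inj (a b : A) : (forall j, coord e j a = coord e j b) -> a = b.
Proof.
move=> ab; rewrite (coord_vbasis (memvf a)) (coord_vbasis (memvf b)).
by apply: eq_bigr => j _; rewrite ab.
Qed.

Lemma eq_deriveA w F G v : (forall u, F u = G u) -> deriveA w F v = deriveA w G v.
Proof. by move=> FG; have -> : F = G by exact/funext. Qed.

Lemma deriveA_near_eq w F G v : (\forall u \near v, F u = G u) ->
  deriveA w F v = deriveA w G v.
Proof.
move=> FG; apply: eq_bigr => j _; congr (_ *: _); apply: near_eq_derive.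
by apply: filterS FG => u ->.
Qed.

Lemma CkA1_is_derive O F v w j : CkA 1 O F -> O v ->
  is_derive v w (fun u => coord e j (F u)) (coord e j (deriveA w F v)).
Proof.
move=> CF Ov; rewrite coord_deriveA; apply: DeriveDef => //.
by have /CkP[_ /(_ w)[+ _]] := CF j; exact.
Qed.

(** The hypothesis on [L] is real linearity expressed in the basis. It is meant for scalar
    multiplications, for multiplication by an element of A, and for the projection onto the real
    scalars. *)
Lemma deriveA_lin O F v w (L : A -> A) :
  (forall a, L a = \sum_i coord e i a *: L e`_i) -> CkA 1 O F -> O v ->
  deriveA w (L \o F) v = L (deriveA w F v).
Proof.
move=> LE CF Ov; apply: coord_inj => j; rewrite coord_deriveA [in RHS]LE linear_sum.
rewrite (_ : (fun u => _) = \sum_(i < \dim {:A})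
    (fun u => coord e i (F u) * coord e j (L e`_i))); last first.
  apply/funext => u; rewrite /= LE linear_sum fct_sumE; apply: eq_bigr => i _.
  by rewrite linearZ.
have H (i : 'I_(\dim {:A})) := is_derive_mulr (coord e j (L e`_i)) (CkA1_is_derive w i CF Ov).
rewrite derive_sum; last by move=> i; case: (H i).
by apply: eq_bigr => i _; case: (H i) => _ ->; rewrite linearZ.
Qed.

Lemma deriveAD O F G v w : CkA 1 O F -> CkA 1 O G -> O v ->
  deriveA w (fun u => F u + G u) v = deriveA w F v + deriveA w G v.
Proof.
move=> CF CG Ov; apply: coord_inj => j; rewrite linearD /= [LHS]coord_deriveA.
under eq_fun do rewrite linearD.
by case: (is_derive_add (CkA1_is_derive w j CF Ov) (CkA1_is_derive w j CG Ov)).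
Qed.

Lemma deriveAM O F G v w : CkA 1 O F -> CkA 1 O G -> O v ->
  deriveA w (fun u => F u * G u) v = deriveA w F v * G v + F v * deriveA w G v.
Proof.
move=> CF CG Ov; apply: coord_inj => j; rewrite coord_deriveA linearD /= !coord_mul.
pose t i l u := (coord e i (F u) * coord e l (G u)) * coord e j (e`_i * e`_l).
have H (i l : 'I_(\dim {:A})) : is_derive v w (t i l) _ := is_derive_mulr (coord e j (e`_i * e`_l))
  (is_derive_mul (CkA1_is_derive w i CF Ov) (CkA1_is_derive w l CG Ov)).
rewrite (_ : (fun u => _) = \sum_(i < \dim {:A}) \sum_(l < \dim {:A}) t i l); last first.
  apply/funext => u; rewrite coord_mul fct_sumE; apply: eq_bigr => i _.
  by rewrite fct_sumE.
rewrite derive_sum; last first.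
  by move=> i; apply: derivable_sum => l; case: (H i l).
rewrite -big_split; apply: eq_bigr => i _.
rewrite derive_sum; last by move=> l; case: (H i l).
rewrite -big_split; apply: eq_bigr => l _ /=; case: (H i l) => _ ->.
by rewrite mulrDl.
Qed.

End AlgebraDerivative.

Section Extension.
Context {R : realType} {n : nat} {M : manifold R n} {A : weilAlgebra R}.
Local Notation e := (vbasis {:A}).
Local Notation V := 'M[R]_(n, \dim {:A}).
Implicit Types (c d : chart M 'rV[R]_n) (p q : M) (xi : near_point M A) (v : V).
Implicit Types (F G : smoothA M A) (X Y : vfieldA M A) (f g : smooth M).

Lemma smoothA_addE F G xi : (F + G) xi = F xi + G xi. Proof. by []. Qed.
Lemma smoothA_mulE F G xi : (F * G) xi = F xi * G xi. Proof. by []. Qed.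
Lemma smoothA_oppE F xi : (- F) xi = - F xi. Proof. by []. Qed.
Lemma smoothA_subE F G xi : (F - G) xi = F xi - G xi. Proof. by []. Qed.
Lemma smoothA_scaleE (a : A) F xi : (a *: F) xi = a * F xi. Proof. by []. Qed.
Lemma smoothA_0E xi : (0 : smoothA M A) xi = 0. Proof. by []. Qed.
Lemma smoothA_1E xi : (1 : smoothA M A) xi = 1. Proof. by []. Qed.
Lemma smoothA_sumE I (r : seq I) (F : I -> smoothA M A) xi :
  (\sum_(i <- r) F i) xi = \sum_(i <- r) F i xi.
Proof. by elim: r => [|i r IH]; rewrite ?big_nil// !big_cons smoothA_addE IH. Qed.
Definition smoothAE := (smoothA_addE, smoothA_mulE, smoothA_oppE, smoothA_subE,
  smoothA_scaleE, smoothA_0E, smoothA_1E, smoothA_sumE).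

Lemma smoothA_eq F G : (forall xi, F xi = G xi) -> F = G.
Proof. by move=> FG; apply/val_inj/funext. Qed.

Lemma vfieldA_der X : derivationA X.
Proof. by have /asboolP := vfieldAP X. Qed.

Lemma vfieldA_pder X xi : point_derivation xi (fun f => (X f : smoothA M A) xi).
Proof.
have [aX sX lX] := vfieldA_der X; split=> [f g|r f|f g].
- by rewrite aX smoothAE.
- by rewrite sX smoothAE mulr_algl.
- by rewrite lX !smoothAE !prolong_funE.
Qed.

Definition near_basept xi : M := sval (cid (near_base xi)).

Lemma near_baseptP xi : near_at xi (near_basept xi).
Proof. by rewrite /near_basept; case: cid. Qed.

Definition local_coord c q i : smooth M :=
  if pselect (exists g : smooth M, \forall x \near q, g x = c.2 x 0 i) is left h
  then sval (cid h) else 0.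

Lemma local_coordP c q i : atlas M c -> c.1 q ->
  \forall x \near q, local_coord c q i x = c.2 x 0 i.
Proof.
move=> ac cq; rewrite /local_coord; case: pselect => [h|[]]; first by case: cid.
exact: chart_coord_ex.
Qed.

(* The coordinates of [X] at [xi] in the chart of M^A induced by [c]. *)
Definition direction c X xi : V :=
  \matrix_(i, j) coord e j ((X (local_coord c (near_basept xi) i) : smoothA M A) xi).

Lemma directionE c X xi q g i : atlas M c -> c.1 q -> near_at xi q ->
  (\forall x \near q, g x = c.2 x 0 i) ->
  forall j, direction c X xi i j = coord e j ((X g : smoothA M A) xi).
Proof.
move=> ac cq xq gc j; rewrite mxE; congr (coord e j _).
have bq := near_at_unique (near_baseptP xi) xq.
apply: (pder_local_eq (vfieldA_pder X xi) xq).
by rewrite bq; apply: filterS2 gc (local_coordP i ac cq) => x -> ->.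
Qed.

(** The near point [xi] itself serves as default of the inverse chart; by [near_inv_default] it has
    no influence on the domain of the chart. *)
Definition chart_derive c X (F : near_point M A -> A) xi : A :=
  deriveA (direction c X xi) (F \o near_inv c xi) ((near_chart A c).2 xi).

Lemma near_inv_default c xi0 xi1 v : atlas M c -> near_dom (A := A) c v ->
  near_inv c xi0 v = near_inv c xi1 v.
Proof.
move=> ac dv; have [c0 e0] := near_invP xi0 ac dv; have [c1 e1] := near_invP xi1 ac dv.
by apply: near_chart_inj ac c0 c1 _; rewrite e0 e1.
Qed.

Lemma nbhs_near_dom c xi q (D : set M) : atlas M c -> c.1 q -> near_at xi q -> nbhs q D ->
  \forall v \near (near_chart A c).2 xi, exists q', [/\ D q', c.1 q' & abody v = c.2 q'].
Proof.
move=> ac cq xq; rewrite nbhsE => -[W [oW Wq] WD].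
pose D' := W `&` c.1.
have oD : open (c.2 @` D').
  by apply: open_chart_image => [//||x []//]; apply: openI => //; exact: atlas_open.
have : nbhs ((near_chart A c).2 xi) (abody @^-1` (c.2 @` D')).
  apply: open_nbhs_nbhs; split; first exact: open_abody.
  by rewrite /= (abody_near_chart ac cq xq); exists q.
apply: filterS => v [x [Wx cx] xv]; exists x; split=> //; exact: WD.
Qed.

Lemma near_dom_at c xi q : atlas M c -> c.1 q -> near_at xi q ->
  near_dom c ((near_chart A c).2 xi).
Proof. by move=> ac cq xq; apply: near_dom_chart => //; exists q. Qed.

Lemma chart_deriveE c X (F : near_point M A -> A) xi xi0 q :
  atlas M c -> c.1 q -> near_at xi q ->
  chart_derive c X F xi =
  deriveA (direction c X xi) (F \o near_inv c xi0) ((near_chart A c).2 xi).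
Proof.
move=> ac cq xq; apply: deriveA_near_eq.
have od := @open_near_dom _ _ M A c ac.
apply: filterS (open_nbhs_nbhs (conj od (near_dom_at ac cq xq))) => v dv.
by rewrite /= (near_inv_default xi xi0 ac dv).
Qed.

Lemma CkA_prolong c xi0 f k : atlas M c ->
  CkA k (near_dom c) ((fun xi => xi f) \o near_inv c xi0).
Proof.
by move=> ac; have /asboolP/near_atlasP := @prolong_smooth _ _ M A f; exact.
Qed.

(** As a function of [f], the left side is a derivation along [xi], and so is the right side. They
    agree on coordinates by the definition of [direction], hence everywhere by [pder_eq0]. *)
Lemma chart_derive_prolong c X f xi q : atlas M c -> c.1 q -> near_at xi q ->
  chart_derive c X (fun xi => xi f) xi = (X f : smoothA M A) xi.
Proof.
move=> ac cq xq.
have dv := near_dom_at ac cq xq.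
have C1 g := @CkA_prolong c xi g 1 ac.
pose E g := chart_derive c X (fun xi => xi g) xi.
have K g : near_inv c xi ((near_chart A c).2 xi) g = xi g.
  by rewrite near_invK//; exists q.
have dE : point_derivation xi E.
  split=> [g h|r g|g h].
  - rewrite /E /chart_derive -(deriveAD _ (C1 g) (C1 h) dv).
    by apply: eq_deriveA => v; rewrite /= rmorphD.
  - rewrite /E /chart_derive -(@deriveA_lin _ _ _ _ _ _ _ (fun a => r *: a) _ (C1 g) dv).
      by apply: eq_deriveA => v; rewrite /= near_Z.
    move=> a; rewrite {1}(coord_vbasis (memvf a)) scaler_sumr; apply: eq_bigr => i _.
    by rewrite !scalerA mulrC.
  - rewrite /E /chart_derive -[in RHS](K g) -[in RHS](K h) -(deriveAM _ (C1 g) (C1 h) dv).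
    by apply: eq_deriveA => v; rewrite /= rmorphM.
have [W [g [th [fr Wq Wc gW]]]] := frame_exists ac cq.
have dZ := pder_lin 1 (-1) (vfieldA_pder X xi) dE.
have := pder_eq0 fr Wq xq dZ; rewrite /= => H.
have {}H := H _ f; rewrite mul1r mulN1r in H.
apply/eqP; rewrite eq_sym -subr_eq0; apply/eqP; apply: H => i.
rewrite mul1r mulN1r; apply/eqP; rewrite subr_eq0; apply/eqP.
apply: coord_inj => j; rewrite coord_deriveA.
have oW : open W by case: fr.
have gc : \forall x \near q, g i x = c.2 x 0 i.
  by apply: filterS (open_nbhs_nbhs (conj oW Wq)) => x; exact: gW.
rewrite -(directionE X ac cq xq gc).
move: (direction c X xi) => w; set v0 := (near_chart A c).2 xi.
have -> : 'D_w (fun u => coord e j (((fun xi => xi (g i)) \o near_inv c xi) u)) v0 =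
    'D_w (fun v : V => v i j) v0.
  apply: near_eq_derive.
  apply: filterS (nbhs_near_dom ac cq xq (open_nbhs_nbhs (conj oW Wq))).
  move=> v [q' [Wq' cq' vq']] /=.
  have xq' := near_inv_at xi ac cq' vq'.
  have gc' : \forall x \near q', g i x = c.2 x 0 i.
    by apply: filterS (open_nbhs_nbhs (conj oW Wq')) => x; exact: gW.
  have dv' : near_dom c v by exists q'.
  rewrite -(acoord_near_chart xq' gc') coord_acoord.
  by have [_ ->] := near_invP xi ac dv'.
exact/esym/derive_coord.
Qed.

(** The chain rule for the change of charts [T]: its derivative carries [direction c X xi] to
    [direction d X xi], by [chart_derive_prolong] applied to the coordinate functions of [d]. *)
Lemma chart_derive_indep c d X F xi q : atlas M c -> atlas M d -> c.1 q -> d.1 q ->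
  near_at xi q -> chart_derive c X F xi = chart_derive d X F xi.
Proof.
move=> ac ad cq dq xq.
have [W [g [th [fr Wq Wd gW]]]] := frame_exists ad dq.
have oW : open W by case: fr.
(* [T] is written with global functions [g] extending the coordinates of [d], so it is defined
   everywhere and is the change of charts above [W]. *)
pose T (v : V) : V := \matrix_(i, j) coord e j (near_inv c xi v (g i)).
have od := @open_near_dom _ _ M A d ad.
have v0c := near_dom_at ac cq xq; have v0d := near_dom_at ad dq xq.
have gd q' i : W q' -> \forall x \near q', g i x = d.2 x 0 i.
  by move=> Wq'; apply: filterS (open_nbhs_nbhs (conj oW Wq')) => x; exact: gW.
have T0 : T ((near_chart A c).2 xi) = (near_chart A d).2 xi.
  apply/matrixP => i j; rewrite mxE near_invK//; last by exists q.
  by rewrite -(acoord_near_chart xq (gd q i Wq)) coord_acoord.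
apply: coord_inj => j; rewrite !coord_deriveA.
have CT a b : Ck 1 (near_dom c) (fun v => T v a b).
  by under eq_fun do rewrite mxE; exact: (@CkA_prolong c xi (g a) 1 ac).
have CF : Ck 1 (near_dom d) (fun v => coord e j (F (near_inv d xi v))).
  exact: (@CkA_smoothA _ _ M A F d xi 1 ad).
have D := @is_derive_comp_mx _ _ _ _ T (near_dom d) _ ((near_chart A c).2 xi)
  (direction c X xi) od CF.
rewrite T0 in D; have {D}[|_] := D v0d.
  by move=> a b; have /CkP[_ /(_ (direction c X xi))[+ _]] := CT a b; exact.
have -> : 'D_(direction c X xi) ((fun v => coord e j (F (near_inv d xi v))) \o T)
     ((near_chart A c).2 xi) =
   'D_(direction c X xi) (fun v => coord e j ((F \o near_inv c xi) v)) ((near_chart A c).2 xi).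
  apply: near_eq_derive.
  apply: filterS (nbhs_near_dom ac cq xq (open_nbhs_nbhs (conj oW Wq))).
  move=> v [q' [Wq' cq' vq']] /=; congr (coord e j (F _)).
  have xq' := near_inv_at xi ac cq' vq'.
  have -> : T v = (near_chart A d).2 (near_inv c xi v).
    apply/matrixP => a b; rewrite mxE.
    by rewrite -(acoord_near_chart xq' (gd q' a Wq')) coord_acoord.
  by rewrite near_invK//; exists q' => //; exact: Wd.
move=> ->; rewrite (derive_sum_coord _ od CF v0d).
apply: eq_bigr => a _; apply: eq_bigr => b _; congr (_ * _).
rewrite (directionE X ad dq xq (gd q a Wq)).
rewrite -(chart_derive_prolong X (g a) ac cq xq) coord_deriveA.
by congr ('D_ _ _ _); apply/funext => v; rewrite mxE.
Qed.

End Extension.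

(** * Existence and rules of calculus of the extension *)

Section ExtensionExists.
Context {R : realType} {n : nat} {M : manifold R n} {A : weilAlgebra R}.
Local Notation e := (vbasis {:A}).
Local Notation V := 'M[R]_(n, \dim {:A}).
Implicit Types (c d : chart M 'rV[R]_n) (p q : M) (xi : near_point M A) (v : V).
Implicit Types (F G : smoothA M A) (X Y : vfieldA M A) (f g : smooth M).

Definition chart_at p : chart M 'rV[R]_n := sval (cid2 (atlas_cover p)).

Lemma chart_atP p : atlas M (chart_at p) /\ (chart_at p).1 p.
Proof. by rewrite /chart_at; case: cid2. Qed.

Definition ext_fun X F xi : A := chart_derive (chart_at (near_basept xi)) X F xi.

Lemma ext_funE c X F xi q : atlas M c -> c.1 q -> near_at xi q ->
  ext_fun X F xi = chart_derive c X F xi.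
Proof.
move=> ac cq xq; have [aq bq] := chart_atP (near_basept xi).
rewrite (near_at_unique (near_baseptP xi) xq) in aq bq.
rewrite /ext_fun (near_at_unique (near_baseptP xi) xq).
exact: chart_derive_indep aq ac bq cq xq.
Qed.

Lemma ext_fun_smooth X F :
  (ext_fun X F : near_point M A -> A^o) \in smoothA_pred (M := M) (A := A).
Proof.
apply/asboolP/near_atlasP => c xi0 k ac; apply: CkA_local => v [q cq qv].
have od := @open_near_dom _ _ M A c ac.
have [W [g [th [fr Wq Wc gW]]]] := frame_exists ac cq.
have oW : open W by case: fr.
have oN : open (abody (A := A) @^-1` (c.2 @` W)).
  by apply: open_abody; apply: open_chart_image.
have Nd : abody (A := A) @^-1` (c.2 @` W) `<=` near_dom c.
  by move=> w [x Wx xw]; exists x => //; exact: Wc.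
exists (abody @^-1` (c.2 @` W)); split=> //; first by exists q.
(* The functions used in [direction] change with the base point; the functions [g] of one frame
   compute it for all near points above [W], which makes the smooth dependence visible. *)
apply: (@CkA_eq _ _ _ _ _ (fun w => \sum_j (\sum_a \sum_b
    coord e b ((X (g a) : smoothA M A) (near_inv c xi0 w)) *
    'D_(delta_mx a b) (fun u => coord e j (F (near_inv c xi0 u))) w) *: e`_j)) => //.
  move=> w Nw; have [q' Wq' qw'] := Nw; have cq' := Wc _ Wq'.
  have xq' := near_inv_at xi0 ac cq' (esym qw').
  rewrite /= (ext_funE X F ac cq' xq') (chart_deriveE X F xi0 ac cq' xq').
  have [_ ew] := near_invP xi0 ac (Nd _ Nw).
  apply: eq_bigr => j _; congr (_ *: _); rewrite ew.
  have CF := @CkA_smoothA _ _ M A F c xi0 1 ac j.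
  rewrite (derive_sum_coord _ od CF (Nd _ Nw)).
  apply: eq_bigr => a _; apply: eq_bigr => b _; congr (_ * _).
  apply/esym/(directionE X ac cq' xq').
  by apply: filterS (open_nbhs_nbhs (conj oW Wq')) => x; exact: gW.
apply: CkA_sum => // j; apply: CkA_scale => //.
apply: Ck_sum => // a; apply: Ck_sum => // b; apply: CkM => //.
  by apply: Ck_sub Nd _; exact: (@CkA_smoothA _ _ M A (X (g a)) c xi0 k ac b).
have /CkP[_ /(_ (delta_mx a b))[_]] := @CkA_smoothA _ _ M A F c xi0 k.+1 ac j.
exact: Ck_sub.
Qed.

Definition ext_map X F : smoothA M A := SmoothA (ext_fun_smooth X F).

Lemma ext_map_chart c X F xi q : atlas M c -> c.1 q -> near_at xi q ->
  ext_map X F xi = chart_derive c X F xi.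
Proof. exact: ext_funE. Qed.

Lemma ext_mapP X : is_extension X (ext_map X).
Proof.
have C F xi : exists c q, [/\ atlas M c, c.1 q, near_at xi q,
    CkA 1 (near_dom c) (F \o near_inv c xi) & near_dom c ((near_chart A c).2 xi)].
  have xp := near_baseptP xi; have [ac cp] := chart_atP (near_basept xi).
  exists (chart_at (near_basept xi)), (near_basept xi); split=> //.
    exact: CkA_smoothA.
  exact: near_dom_at ac cp xp.
(* The derivative commutes with every real linear map of A. This yields A-linearity and, below,
   preservation of real-valued functions. *)
have L (L : A -> A) F G : (forall a, L a = \sum_i coord e i a *: L e`_i) ->
    (forall xi, G xi = L (F xi)) -> forall xi, ext_map X G xi = L (ext_map X F xi).
  move=> LE GL xi; have [c [q [ac cq xq CF dv]]] := C F xi.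
  rewrite !(ext_map_chart _ _ ac cq xq) /chart_derive.
  rewrite -(deriveA_lin _ LE CF dv); by apply: eq_deriveA => v; rewrite /= GL.
split.
- move=> a F G; apply: smoothA_eq => xi; rewrite !smoothAE.
  rewrite -(L (fun x => a * x) F (a *: F)) => [|b|//]; last first.
    rewrite {1}(coord_vbasis (memvf b)) mulr_sumr; apply: eq_bigr => i _.
    by rewrite scalerAr.
  have [c [q [ac cq xq CF dv]]] := C (a *: F) xi.
  have CG := CkA_smoothA G xi 1 ac.
  rewrite !(ext_map_chart _ _ ac cq xq) /chart_derive -(deriveAD _ CF CG dv).
  by apply: eq_deriveA => v.
- move=> F G; apply: smoothA_eq => xi; rewrite !smoothAE.
  have [c [q [ac cq xq CF dv]]] := C F xi.
  have CG := CkA_smoothA G xi 1 ac.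
  have K (H : smoothA M A) : (H \o near_inv c xi) ((near_chart A c).2 xi) = H xi.
    by rewrite /= near_invK//; exists q.
  rewrite !(ext_map_chart _ _ ac cq xq) /chart_derive -(K F) -(K G).
  by rewrite -(deriveAM _ CF CG dv); apply: eq_deriveA => v.
- move=> F rF xi; exists (body (ext_map X F xi)).
  (* A real-valued function is fixed by the projection onto the real scalars, so its derivative is
     fixed too. *)
  apply: (L (fun x => (body x)%:A)) => [b|x].
    rewrite {1}(coord_vbasis (memvf b)) body_sum scaler_suml; apply: eq_bigr => i _.
    by rewrite bodyZ scalerA.
  by have [r ->] := rF x; rewrite body_real.
- move=> f; apply: smoothA_eq => xi.
  have [c [q [ac cq xq CF dv]]] := C (prolong_fun A f) xi.
  rewrite (ext_map_chart _ _ ac cq xq) -(chart_derive_prolong X f ac cq xq).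
  rewrite /chart_derive; by apply: eq_deriveA => v; rewrite /= prolong_funE.
Qed.

(** Once an extension exists, the choice operator returns one; from here on only the properties in
    [is_extension] are used. *)
Lemma extensionP X : is_extension X (extension X).
Proof. by rewrite /extension; apply: (xgetPex _ (ex_intro _ _ (ext_mapP X))). Qed.

Lemma extensionD X F G : extension X (F + G) = extension X F + extension X G.
Proof. by have := extension_linear (extensionP X) 1 F G; rewrite !scale1r. Qed.

Lemma extensionZ X (a : A) F : extension X (a *: F) = a *: extension X F.
Proof.
have l := extension_linear (extensionP X).
have e0 : extension X 0 = 0.
  by have := l (-1) 0 0; rewrite scaler0 addr0 scaleN1r addNr.
by have := l a F 0; rewrite !addr0 e0 addr0.
Qed.

Lemma extensionM X F G : extension X (F * G) = extension X F * G + F * extension X G.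
Proof. exact: extension_leibniz (extensionP X) F G. Qed.

Lemma extension_prolongE X f : extension X (prolong_fun A f) = X f.
Proof. exact: extension_prolong (extensionP X) f. Qed.

Lemma prolong_funM f g : prolong_fun A (f * g) = prolong_fun A f * prolong_fun A g.
Proof. by apply: smoothA_eq => xi; rewrite smoothAE !prolong_funE rmorphM. Qed.

Lemma prolong_funD f g : prolong_fun A (f + g) = prolong_fun A f + prolong_fun A g.
Proof. by apply: smoothA_eq => xi; rewrite smoothAE !prolong_funE rmorphD. Qed.

Lemma prolong_funZ (r : R) f : prolong_fun A (r *: f) = (r%:A : A) *: prolong_fun A f.
Proof.
by apply: smoothA_eq => xi; rewrite smoothAE !prolong_funE near_Z mulr_algl.
Qed.

Lemma prolong_vfieldE (th : vfield M) f :
  prolong_vfield A th f = prolong_fun A (th f).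
Proof.
rewrite /prolong_vfield.
have P : ((fun f => prolong_fun A (th f)) : smooth M -> (smoothA M A)^o)
    \in vfieldA_pred (M := M) (A := A).
  apply/asboolP; have [aX sX lX] := vfield_der th; split=> [u v|r u|u v].
  - by rewrite aX prolong_funD.
  - by rewrite sX prolong_funZ.
  - by rewrite lX prolong_funD !prolong_funM.
have := insubdK (0 : vfieldA M A) P.
by move=> /(congr1 (fun F : smooth M -> (smoothA M A)^o => F f)).
Qed.

Lemma vbracketAE X Y f : vbracketA X Y f = extension X (Y f) - extension Y (X f).
Proof.
rewrite /vbracketA.
have P : ((fun f => extension X (Y f) - extension Y (X f)) : smooth M -> (smoothA M A)^o)
    \in vfieldA_pred (M := M) (A := A).
  apply/asboolP; have [aX sX lX] := vfieldA_der X; have [aY sY lY] := vfieldA_der Y.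
  split=> [u v|r u|u v].
  - by rewrite aX aY !extensionD opprD addrACA.
  - by rewrite sX sY !extensionZ -scalerBr.
  - rewrite lX lY !extensionD !extensionM !extension_prolongE.
    apply: smoothA_eq => xi; rewrite !smoothAE; ring.
have := insubdK (0 : vfieldA M A) P.
by move=> /(congr1 (fun F : smooth M -> (smoothA M A)^o => F f)).
Qed.

End ExtensionExists.

(** * Prolongation of forms *)

Section FormAlgebra.
Context {S : comPzRingType} {V : lmodType S}.
Implicit Types (x y z : V) (a b s : S).

Lemma form_multilinear p (w : altform V p) : multilinear w.
Proof. by have /asboolP[] := formP w. Qed.

Lemma form_skew p (w : altform V p) : skew_symmetric w.
Proof. by have /asboolP[] := formP w. Qed.

Lemma ord2P (P : 'I_2 -> Prop) : P 0 -> P 1 -> forall k, P k.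
Proof.
move=> P0 P1 [[|[|//]] k].
  by rewrite (_ : Ordinal k = 0)//; exact: val_inj.
by rewrite (_ : Ordinal k = 1)//; exact: val_inj.
Qed.

Lemma pair_vectE (v : 'I_2 -> V) : v = pair_vect (v 0) (v 1).
Proof. by apply/funext; exact: ord2P. Qed.

Lemma cons_vect1E x (v : 'I_1 -> V) : cons_vect x v = pair_vect x (v 0).
Proof.
apply/funext; apply: ord2P; first by rewrite /cons_vect unlift_none.
rewrite /cons_vect (_ : 1 = lift ord0 (0 : 'I_1)); first by rewrite liftK.
exact: val_inj.
Qed.

Lemma form2Dl (w : altform V 2) a x y z :
  w (pair_vect (a *: x + y) z) = a * w (pair_vect x z) + w (pair_vect y z).
Proof.
have E u : pair_vect u z = dfwith (pair_vect x z) 0 u.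
  by apply/funext; apply: ord2P; [rewrite dfwithin|rewrite dfwithout].
by have := form_multilinear w (pair_vect x z) 0 a x y; rewrite -!E.
Qed.

Lemma form2C (w : altform V 2) x y : w (pair_vect y x) = - w (pair_vect x y).
Proof.
rewrite -(form_skew w (pair_vect x y) (isT : (0 : 'I_2) != 1)); congr (form_fun w _).
by apply/funext; apply: ord2P; rewrite /= ?tpermL ?tpermR.
Qed.

Lemma form2_0l (w : altform V 2) z : w (pair_vect 0 z) = 0.
Proof.
have := form2Dl w 1 0 0 z; rewrite scale1r addr0 mul1r => h.
by apply: (addrI (w (pair_vect 0 z))); rewrite addr0 -h.
Qed.

Lemma form2_suml (w : altform V 2) I (r : seq I) (a : I -> S) (t : I -> V) z :
  w (pair_vect (\sum_(i <- r) a i *: t i) z) = \sum_(i <- r) a i * w (pair_vect (t i) z).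
Proof.
elim: r => [|i r IH]; first by rewrite !big_nil form2_0l.
by rewrite !big_cons form2Dl IH.
Qed.

Lemma form2_sumr (w : altform V 2) I (r : seq I) (a : I -> S) (t : I -> V) z :
  w (pair_vect z (\sum_(i <- r) a i *: t i)) = \sum_(i <- r) a i * w (pair_vect z (t i)).
Proof.
rewrite form2C form2_suml -sumrN; apply: eq_bigr => i _.
by rewrite [in RHS]form2C mulrN.
Qed.

Lemma form2Zl (w : altform V 2) a x z : w (pair_vect (a *: x) z) = a * w (pair_vect x z).
Proof. by rewrite -[a *: x]addr0 form2Dl form2_0l addr0. Qed.

Lemma form2Zr (w : altform V 2) a x z : w (pair_vect z (a *: x)) = a * w (pair_vect z x).
Proof. by rewrite form2C form2Zl [in RHS]form2C mulrN. Qed.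

(** A frame spans only locally, but [s *: x] and [s *: y] are global combinations of it when [s] is
    a bump. The factor [s] comes out twice and disappears upon evaluation where it is 1. *)
Lemma form2_cut (w : altform V 2) I (r : seq I) s x y (a b : I -> S) (t : I -> V) :
  s *: x = \sum_(i <- r) a i *: t i -> s *: y = \sum_(i <- r) b i *: t i ->
  s * (s * w (pair_vect x y)) =
  \sum_(i <- r) \sum_(j <- r) a i * (b j * w (pair_vect (t i) (t j))).
Proof.
move=> sx sy; rewrite -form2Zr -form2Zl sx sy form2_suml; apply: eq_bigr => i _.
by rewrite form2_sumr mulr_sumr.
Qed.

Lemma form1_sum (w : altform V 1) I (r : seq I) (a : I -> S) (t : I -> V) :
  w (fun=> \sum_(i <- r) a i *: t i) = \sum_(i <- r) a i * w (fun=> t i).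
Proof.
have L b x y : w (fun=> b *: x + y) = b * w (fun=> x) + w (fun=> y).
  have E u : (fun=> u) = dfwith (fun=> x) 0 u :> ('I_1 -> V).
    by apply/funext => k; rewrite (ord1 k) dfwithin.
  by have := form_multilinear w (fun=> x) 0 b x y; rewrite -!E.
have w0 : w (fun=> 0) = 0.
  have := L 1 0 0; rewrite scale1r addr0 mul1r => h.
  by apply: (addrI (w (fun=> 0))); rewrite addr0 -h.
by elim: r => [|i r IH]; rewrite ?big_nil// !big_cons L IH.
Qed.

Lemma interior_linear (w : altform V 2) : linear (interior_product w).
Proof.
move=> a x y; apply/val_inj/funext => v /=.
by rewrite cons_vect1E form2Dl -!cons_vect1E.
Qed.

End FormAlgebra.

(** * Expansion of fields and forms in a frame *)

Section LocalForms.
Context {R : realType} {n : nat} {M : manifold R n} {A : weilAlgebra R}.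
Implicit Types (p q : M) (xi : near_point M A).
Implicit Types (F G : smoothA M A) (X Y : vfieldA M A).
Implicit Types (W : set M) (g : 'I_n -> smooth M) (th : 'I_n -> vfield M).

Lemma vfield_scaleE (s : smooth M) (X : vfield M) f : (s *: X : vfield M) f = s * X f.
Proof. by []. Qed.

Lemma vfield_sumE I (r : seq I) (X : I -> vfield M) f :
  (\sum_(i <- r) X i) f = \sum_(i <- r) (X i f : smooth M).
Proof.
elim: r => [|i r IH]; first by rewrite !big_nil.
rewrite !big_cons -IH; by [].
Qed.

Lemma vfield_eq (X Y : vfield M) : (forall f x, (X f : smooth M) x = (Y f : smooth M) x) -> X = Y.
Proof. by move=> XY; apply/val_inj/funext => f; apply: smooth_eq => x; exact: XY. Qed.

Lemma vfieldA_scaleE F X f : (F *: X : vfieldA M A) f = F * X f.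
Proof. by []. Qed.

Lemma vfieldA_sumE I (r : seq I) (X : I -> vfieldA M A) f :
  (\sum_(i <- r) X i) f = \sum_(i <- r) (X i f : smoothA M A).
Proof.
elim: r => [|i r IH]; first by rewrite !big_nil.
rewrite !big_cons -IH; by [].
Qed.

Lemma vfieldA_eq X Y :
  (forall f xi, (X f : smoothA M A) xi = (Y f : smoothA M A) xi) -> X = Y.
Proof. by move=> XY; apply/val_inj/funext => f; apply: smoothA_eq => x; exact: XY. Qed.

Lemma vfield_cut W g th (s : smooth M) (X : vfield M) : is_frame W g th ->
  (forall x, ~ W x -> s x = 0) -> s *: X = \sum_i (s * X (g i)) *: th i.
Proof.
move=> fr s0; apply: vfield_eq => f x; rewrite vfield_sumE vfield_scaleE !smoothE.
have [Wx|/s0 sx] := pselect (W x).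
  rewrite (frame_vfield X f fr Wx) mulr_sumr; apply: eq_bigr => i _.
  by rewrite vfield_scaleE !smoothE mulrA.
by rewrite sx mul0r big1// => i _; rewrite vfield_scaleE !smoothE sx !mul0r.
Qed.

Lemma vfieldA_frame W g th X f xi p : is_frame W g th -> W p -> near_at xi p ->
  (X f : smoothA M A) xi = \sum_i (X (g i) : smoothA M A) xi * xi (th i f).
Proof. by move=> fr Wp xp; exact: (pder_frame f fr Wp xp (vfieldA_pder X xi)). Qed.

(** The closed set [K] ensures that [s] vanishes on a whole neighbourhood of each base point outside
    it; a near point sees germs, so vanishing at the base point alone would not give xi(s) = 0. *)
Lemma vfieldA_cut W g th (s : smooth M) (K : set M) X : is_frame W g th ->
  closed K -> K `<=` W -> (forall x, ~ K x -> s x = 0) ->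
  prolong_fun A s *: X =
  \sum_i (prolong_fun A s * X (g i)) *: prolong_vfield A (th i).
Proof.
move=> fr cK KW s0; apply: vfieldA_eq => f xi.
rewrite vfieldA_sumE vfieldA_scaleE !smoothAE prolong_funE.
have [p xp] := near_baseP xi; have [Kp|nKp] := pselect (K p).
  rewrite (vfieldA_frame X f fr (KW _ Kp) xp) mulr_sumr; apply: eq_bigr => i _.
  by rewrite vfieldA_scaleE !smoothAE !prolong_funE prolong_vfieldE prolong_funE mulrA.
have -> : xi s = 0.
  apply: near_local xp _; apply: filterS (open_nbhs_nbhs (conj (closed_openC cK) nKp)).
  by move=> x; exact: s0.
rewrite mul0r big1// => i _.
rewrite vfieldA_scaleE !smoothAE !prolong_funE.
have -> : xi s = 0.
  apply: near_local xp _; apply: filterS (open_nbhs_nbhs (conj (closed_openC cK) nKp)).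
  by move=> x; exact: s0.
by rewrite !mul0r.
Qed.

Lemma frame_bump W g th p : is_frame W g th -> W p -> exists (s : smooth M) (K : set M),
  [/\ \forall x \near p, s x = 1, closed K, K `<=` W & forall x, ~ K x -> s x = 0].
Proof. by move=> [oW _ _] Wp; apply: bump; exact: open_nbhs_nbhs. Qed.

Lemma form_frame W g th (Omega : altform (vfield M) 2) (X Y : vfield M) q :
  is_frame W g th -> W q ->
  (Omega (pair_vect X Y) : smooth M) q = \sum_i \sum_j (X (g i) : smooth M) q *
    ((Y (g j) : smooth M) q * (Omega (pair_vect (th i) (th j)) : smooth M) q).
Proof.
move=> fr Wq; have [s [K [s1 cK KW s0]]] := frame_bump fr Wq.
have s0' x : ~ W x -> s x = 0 by move=> nW; apply: s0 => /KW.
have := form2_cut Omega (vfield_cut X fr s0') (vfield_cut Y fr s0').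
move=> /(congr1 (fun h : smooth M => h q)).
rewrite !smoothE (nbhs_singleton s1) !mul1r => ->; apply: eq_bigr => i _.
rewrite smoothE; apply: eq_bigr => j _.
by rewrite !smoothE (nbhs_singleton s1) !mul1r.
Qed.

Lemma near_bump1 (s : smooth M) xi p : near_at xi p -> (\forall x \near p, s x = 1) -> xi s = 1.
Proof.
by move=> xp s1; rewrite -[RHS](rmorph1 xi); apply: near_local_eq xp _.
Qed.

(** An A-form of degree 2 is thus determined by its values on prolonged fields, hence a prolongation
    of Omega by its defining property. *)
Lemma formA_frame W g th (w : altform (vfieldA M A) 2) X Y xi p :
  is_frame W g th -> W p -> near_at xi p ->
  (w (pair_vect X Y) : smoothA M A) xi = \sum_i \sum_j (X (g i) : smoothA M A) xi *
    ((Y (g j) : smoothA M A) xi * (w (pair_vect (prolong_vfield A (th i))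
      (prolong_vfield A (th j))) : smoothA M A) xi).
Proof.
move=> fr Wp xp; have [s [K [s1 cK KW s0]]] := frame_bump fr Wp.
have xs := near_bump1 xp s1.
have := form2_cut w (vfieldA_cut X fr cK KW s0) (vfieldA_cut Y fr cK KW s0).
move=> /(congr1 (fun h : smoothA M A => h xi)).
rewrite !smoothAE prolong_funE xs !mul1r => ->; apply: eq_bigr => i _.
rewrite smoothAE; apply: eq_bigr => j _.
by rewrite !smoothAE prolong_funE xs !mul1r.
Qed.

Lemma form1A_frame W g th (w : altform (vfieldA M A) 1) X xi p :
  is_frame W g th -> W p -> near_at xi p ->
  (w (fun=> X) : smoothA M A) xi = \sum_i (X (g i) : smoothA M A) xi *
    (w (fun=> prolong_vfield A (th i)) : smoothA M A) xi.
Proof.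
move=> fr Wp xp; have [s [K [s1 cK KW s0]]] := frame_bump fr Wp.
have xs := near_bump1 xp s1.
have := form1_sum w (index_enum 'I_n) (fun i => prolong_fun A s * X (g i))
  (fun i => prolong_vfield A (th i)).
rewrite -(vfieldA_cut X fr cK KW s0).
(* The one-term sum takes the scalar [prolong_fun A s] out of the 1-form. *)
have := form1_sum w [:: tt] (fun=> prolong_fun A s) (fun=> X).
rewrite !big_seq1 => -> /(congr1 (fun h : smoothA M A => h xi)).
rewrite !smoothAE prolong_funE xs !mul1r => ->; apply: eq_bigr => i _.
by rewrite !smoothAE prolong_funE xs !mul1r.
Qed.

Lemma frame_at p : exists F : set M * ('I_n -> smooth M) * ('I_n -> vfield M),
  is_frame F.1.1 F.1.2 F.2 /\ F.1.1 p.
Proof.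
have [c ac cp] := atlas_cover p; have [W [g [th [fr Wp _ _]]]] := frame_exists ac cp.
by exists (W, g, th).
Qed.

End LocalForms.

(** * Construction and local formula of Omega^A *)

Section ProlongForm.
Context {R : realType} {n : nat} {M : manifold R n} {A : weilAlgebra R}.
Implicit Types (p q : M) (xi : near_point M A).
Implicit Types (F G : smoothA M A) (X Y : vfieldA M A).
Implicit Types (W : set M) (g : 'I_n -> smooth M) (th : 'I_n -> vfield M).
Variable Omega : altform (vfield M) 2.

Definition omega th i j : smooth M := Omega (pair_vect (th i) (th j)).

Definition frame_value g th X Y xi : A :=
  \sum_i \sum_j (X (g i) : smoothA M A) xi *
    ((Y (g j) : smoothA M A) xi * xi (omega th i j)).

(** The tensor transformation law: the derivatives xi(th_i(g'_k)) express the components of [X] and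
    [Y] in the second frame, and the coefficients of Omega in the first frame through those in the
    second. *)
Lemma frame_value_indep W g th W' g' th' X Y xi p : is_frame W g th -> W p ->
  is_frame W' g' th' -> W' p -> near_at xi p ->
  frame_value g th X Y xi = frame_value g' th' X Y xi.
Proof.
move=> fr Wp fr' Wp' xp; rewrite /frame_value.
have E i j : xi (omega th i j) = \sum_k \sum_l xi (th i (g' k)) *
    (xi (th j (g' l)) * xi (omega th' k l)).
  rewrite (@near_local_eq _ _ _ _ xi p _
     (\sum_k \sum_l th i (g' k) * (th j (g' l) * omega th' k l)) xp).
    rewrite rmorph_sum; apply: eq_bigr => k _; rewrite rmorph_sum.
    by apply: eq_bigr => l _; rewrite !rmorphM.
  have oW' : open W' by case: fr'.
  apply: filterS (open_nbhs_nbhs (conj oW' Wp')) => q Wq.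
  rewrite /omega (form_frame Omega (th i) (th j) fr' Wq) !smoothE.
  apply: eq_bigr => k _; rewrite smoothE; apply: eq_bigr => l _.
  by rewrite !smoothE.
transitivity (\sum_i \sum_j \sum_k \sum_l
   ((X (g i) : smoothA M A) xi * xi (th i (g' k))) *
   (((Y (g j) : smoothA M A) xi * xi (th j (g' l))) * xi (omega th' k l))).
  apply: eq_bigr => i _; apply: eq_bigr => j _; rewrite E !mulr_sumr.
  apply: eq_bigr => k _; rewrite !mulr_sumr; apply: eq_bigr => l _; ring.
transitivity (\sum_k \sum_l \sum_i \sum_j
   ((X (g i) : smoothA M A) xi * xi (th i (g' k))) *
   (((Y (g j) : smoothA M A) xi * xi (th j (g' l))) * xi (omega th' k l))).
  under eq_bigr do rewrite exchange_big /=.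
  rewrite exchange_big /=; apply: eq_bigr => k _.
  under eq_bigr do rewrite exchange_big /=.
  by rewrite exchange_big.
apply: eq_bigr => k _; apply: eq_bigr => l _.
rewrite (vfieldA_frame X (g' k) fr Wp xp) (vfieldA_frame Y (g' l) fr Wp xp).
rewrite mulr_suml; apply: eq_bigr => i _.
by rewrite mulr_suml mulr_sumr.
Qed.

Lemma prolong_form_ex : exists w : altform (vfieldA M A) 2, is_prolong_form Omega w.
Proof.
have [Fr FrP] := boolp.choice (@frame_at R n M).
pose fg p := (Fr p).1.2; pose ft p := (Fr p).2; pose fW p := (Fr p).1.1.
have frP p : is_frame (fW p) (fg p) (ft p) /\ fW p p by exact: FrP.
(* The frame is chosen at the base point of each near point, with no relation between neighbouring
   choices; [w0E] removes the dependence on it. *)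
pose w0 X Y xi : A :=
  frame_value (fg (near_basept xi)) (ft (near_basept xi)) X Y xi.
have w0E W g th X Y xi p : is_frame W g th -> W p -> near_at xi p ->
    w0 X Y xi = frame_value g th X Y xi.
  move=> fr Wp xp; have e := near_at_unique (near_baseptP xi) xp.
  have [fr' Wp'] := frP (near_basept xi).
  rewrite /w0; rewrite e in fr' Wp' *; exact: frame_value_indep fr' Wp' fr Wp xp.
(* Above a neighbourhood of [p] the single frame chosen at [p] computes [w0], as an explicit smooth
   function. *)
have sw X Y : (w0 X Y : near_point M A -> A^o) \in smoothA_pred (M := M) (A := A).
  apply: smoothA_local => xi p xp; have [fr Wp] := frP p.
  exists (\sum_i \sum_j X (fg p i) * (Y (fg p j) * prolong_fun A (omega (ft p) i j))).
  exists (fW p); split; first by have [oW _ _] := fr; exact: open_nbhs_nbhs.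
  move=> xi' q xq Wq; rewrite (w0E _ _ _ X Y xi' q fr Wq xq) /frame_value !smoothAE.
  apply: eq_bigr => i _; rewrite smoothAE; apply: eq_bigr => j _.
  by rewrite !smoothAE prolong_funE.
pose w (v : 'I_2 -> vfieldA M A) : (smoothA M A)^o := SmoothA (sw (v 0) (v 1)).
have swap X Y xi : w0 Y X xi = - w0 X Y xi.
  have [fr Wp] := frP (near_basept xi).
  rewrite /w0 /frame_value exchange_big -sumrN; apply: eq_bigr => i _.
  rewrite -sumrN; apply: eq_bigr => j _.
  rewrite /omega form2C rmorphN; ring.
have lin (a : smoothA M A) X Y Z xi : w0 (a *: X + Y) Z xi = a xi * w0 X Z xi + w0 Y Z xi.
  rewrite /w0 /frame_value mulr_sumr -big_split /=; apply: eq_bigr => i _.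
  rewrite mulr_sumr -big_split /=; apply: eq_bigr => j _.
  transitivity ((a xi * (X (fg (near_basept xi) i) : smoothA M A) xi +
      (Y (fg (near_basept xi) i) : smoothA M A) xi) *
     ((Z (fg (near_basept xi) j) : smoothA M A) xi * xi (omega (ft (near_basept xi)) i j))).
    by [].
  by ring.
have wP : w \in @form_pred (smoothA M A) (vfieldA M A) 2.
  apply/asboolP; split=> [v i a X Y|v i j].
    apply: smoothA_eq => xi; rewrite !smoothAE /=; move: i; apply: ord2P.
      by rewrite !dfwithin !dfwithout// lin.
    (* Linearity in the second argument is reduced to the first by skew symmetry. *)
    by rewrite !dfwithin !dfwithout// swap lin opprD -mulrN -!swap.
  move=> ij; apply: smoothA_eq => xi; rewrite smoothAE /=.
  move: i j ij; do 2 (apply: ord2P => //); rewrite ?tpermL ?tpermR -?swap//= => _;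
    by rewrite ?tpermR ?tpermL swap.
exists (AltForm wP) => theta; apply: smoothA_eq => xi.
rewrite prolong_funE /=; have xp := near_baseptP xi.
have [fr Wp] := frP (near_basept xi).
set p := near_basept xi in xp fr Wp *.
(* Near the base point Omega(theta) equals its expansion in the frame, and [xi] sees germs only. *)
rewrite (@near_local_eq _ _ _ _ xi p _
   (\sum_k \sum_l theta 0 (fg p k) * (theta 1 (fg p l) * omega (ft p) k l)) xp).
  rewrite rmorph_sum /w0 /frame_value; apply: eq_bigr => k _; rewrite rmorph_sum.
  by apply: eq_bigr => l _; rewrite !rmorphM !prolong_vfieldE !prolong_funE.
have [oW _ _] := fr.
apply: filterS (open_nbhs_nbhs (conj oW Wp)) => q Wq.
rewrite [in LHS](pair_vectE theta) (form_frame Omega (theta 0) (theta 1) fr Wq) !smoothE.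
apply: eq_bigr => k _; rewrite smoothE; apply: eq_bigr => l _.
by rewrite !smoothE.
Qed.

Lemma prolong_formP : is_prolong_form Omega (prolong_form A Omega).
Proof. by have [w wP] := prolong_form_ex; exact: (xgetPex _ (ex_intro _ _ wP)). Qed.

Lemma prolong_form_frame W g th X Y xi p : is_frame W g th -> W p -> near_at xi p ->
  (prolong_form A Omega (pair_vect X Y) : smoothA M A) xi = frame_value g th X Y xi.
Proof.
move=> fr Wp xp; rewrite (formA_frame _ X Y fr Wp xp).
apply: eq_bigr => i _; apply: eq_bigr => j _; congr (_ * (_ * _)).
have := prolong_formP (pair_vect (th i) (th j)).
rewrite (_ : (fun k => _) = pair_vect (prolong_vfield A (th i)) (prolong_vfield A (th j))).
  by move=> ->; rewrite prolong_funE.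
by apply/funext; exact: ord2P.
Qed.

End ProlongForm.

(** * Nondegeneracy *)

Section Nondegenerate.
Context {R : realType} {n : nat} {M : manifold R n} {A : weilAlgebra R}.
Implicit Types (p q : M) (xi : near_point M A).
Implicit Types (F G : smoothA M A) (X Y Z : vfieldA M A).
Implicit Types (W : set M) (g : 'I_n -> smooth M) (th : 'I_n -> vfield M).

Lemma smooth_inverse (f : smooth M) p : f p != 0 ->
  exists u : smooth M, \forall x \near p, u x * f x = 1.
Proof.
move=> fp; have [ac cp] := chart_atP p; set c := chart_at p in ac cp.
have oc : open (c.2 @` c.1) by apply: open_chart_image => //; exact: atlas_open.
have CF := Cinf_chart_inv p f ac.
pose N := (c.2 @` c.1) `&` (f \o chart_inv c p) @^-1` [set r | r != 0].
have oN : open N.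
  apply: (open_preimage oc) => [|v cv]; first by apply: open_neq.
  exact: Ck0 (CF 0) v cv.
have Np : N (c.2 p) by split; [exists p|rewrite /= chart_invK].
have CH k : Ck k N (fun v => ((f \o chart_inv c p) v)^-1).
  apply: Ck_inv => // [v []//|].
  by apply: Ck_sub (CF k) => v [].
have [u uE] := smooth_extend ac cp oN Np CH; exists u.
have Nn := nbhs_chart ac cp oN Np.
near=> x.
have [cx [_ fx]] : (c.1 `&` c.2 @^-1` N) x by near: x.
rewrite /= chart_invK// in fx.
have -> : u x = ((f \o chart_inv c p) (c.2 x))^-1 by near: x.
by rewrite /= chart_invK// mulVf.
Unshelve. all: by end_near. Qed.

Lemma smooth_detE (B : 'M[smooth M]_n) p :
  (\det B) p = \det (\matrix_(i, j) B i j p).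
Proof.
have prodE (s : seq 'I_n) (u : 'I_n -> smooth M) :
    (\prod_(i <- s) u i) p = \prod_(i <- s) u i p.
  by elim: s => [|i s IH]; rewrite ?big_nil// !big_cons smoothE IH.
rewrite /determinant smoothE; apply: eq_bigr => s _.
rewrite smoothE prodE; congr (_ * _); last by apply: eq_bigr => i _; rewrite mxE.
by case: (odd_perm s); rewrite ?expr1 ?expr0.
Qed.

Variable Omega : altform (vfield M) 2.
Hypothesis nondeg : forall (x : M) (X : vfield M),
  (forall Y : vfield M, (Omega (pair_vect X Y) : smooth M) x = 0) ->
  forall f, (X f : smooth M) x = 0.
Local Notation omega := (omega Omega).
Local Notation OmegaA := (prolong_form A Omega).

(** A kernel vector v gives the field sum_i v_i th_i, which pairs to 0 with every field at [p].
    Nondegeneracy kills it there, and its components on the coordinates are the v_i. *)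
Lemma omega_det W g th p : is_frame W g th -> W p ->
  \det (\matrix_(i, j) omega th i j p) != 0.
Proof.
move=> fr Wp; apply/negP => /det0P[v v0 vO].
pose X : vfield M := \sum_i (v 0 i *: (1 : smooth M)) *: th i.
have [_ thg _] := fr.
have XE f : (X f : smooth M) p = \sum_i v 0 i * (th i f : smooth M) p.
  rewrite vfield_sumE smoothE; apply: eq_bigr => i _.
  by rewrite vfield_scaleE !smoothE mulr1.
have Xg k : (X (g k) : smooth M) p = v 0 k.
  rewrite XE (bigD1 k)//= thg// eqxx mulr1 big1 ?addr0// => i ik.
  by rewrite thg// (negbTE ik) mulr0.
have H : forall Y : vfield M, (Omega (pair_vect X Y) : smooth M) p = 0.
  move=> Y; rewrite (form_frame Omega X Y fr Wp) exchange_big big1// => j _ /=.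
  have := congr1 (fun B : 'rV[R]_n => B 0 j) vO; rewrite !mxE => e.
  transitivity ((Y (g j) : smooth M) p * \sum_i v 0 i * (\matrix_(i, j) omega th i j p) i j).
    by rewrite mulr_sumr; apply: eq_bigr => i _; rewrite Xg mxE mulrCA.
  by rewrite e mulr0.
move/eqP: v0; apply; apply/rowP => k.
by rewrite -Xg (nondeg H) mxE.
Qed.

(** The adjugate matrix over the ring C^oo(M) times a local inverse of the determinant. Both
    products are recorded: one serves injectivity and the other surjectivity. *)
Lemma omega_inverse W g th p : is_frame W g th -> W p ->
  exists h : 'I_n -> 'I_n -> smooth M, \forall x \near p, forall i l,
    \sum_k omega th i k x * h k l x = (i == l)%:R /\
    \sum_k h i k x * omega th k l x = (i == l)%:R.
Proof.
move=> fr Wp; pose B : 'M[smooth M]_n := \matrix_(i, j) omega th i j.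
have Bp : (\det B) p != 0.
  rewrite smooth_detE; have := omega_det fr Wp; congr (\det _ != 0).
  by apply/matrixP => i j; rewrite !mxE.
have [u uE] := smooth_inverse Bp.
exists (fun k l => u * (\adj B) k l).
near=> x.
have ux : u x * (\det B) x = 1 by near: x.
move=> i l; split.
  have := congr1 (fun C : 'M[smooth M]_n => C i l) (mul_mx_adj B).
  rewrite !mxE => /(congr1 (fun f : smooth M => f x)); rewrite smoothE => e.
  transitivity (u x * \sum_k (B i k * (\adj B) k l) x).
    rewrite mulr_sumr; apply: eq_bigr => k _; rewrite !smoothE [B i k]mxE.
    by rewrite mulrCA.
  by rewrite e; case: (i == l); rewrite ?mulr1n ?mulr0n ?ux// smoothE mulr0.
have := congr1 (fun C : 'M[smooth M]_n => C i l) (mul_adj_mx B).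
rewrite !mxE => /(congr1 (fun f : smooth M => f x)); rewrite smoothE => e.
transitivity (u x * \sum_k ((\adj B) i k * B k l) x).
  rewrite mulr_sumr; apply: eq_bigr => k _; rewrite !smoothE [B k l]mxE.
  by rewrite mulrA.
by rewrite e; case: (i == l); rewrite ?mulr1n ?mulr0n ?ux// smoothE mulr0.
Unshelve. all: by end_near. Qed.

Lemma near_matrix_id (a b : 'I_n -> 'I_n -> smooth M) xi p i l : near_at xi p ->
  (\forall x \near p, \sum_k a i k x * b k l x = (i == l)%:R) ->
  \sum_k xi (a i k) * xi (b k l) = (i == l)%:R.
Proof.
move=> xp ab; transitivity (xi (\sum_k a i k * b k l)).
  by rewrite rmorph_sum; apply: eq_bigr => k _; rewrite rmorphM.
rewrite (@near_local_eq _ _ _ _ xi p _ ((i == l)%:R *: (1 : smooth M)) xp).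
  by rewrite near_cst scaler_nat.
apply: filterS ab => x; rewrite !smoothE mulr1 => <-.
by apply: eq_bigr => k _; rewrite smoothE.
Qed.

Lemma OmegaA_frame_r W g th Z xi p k : is_frame W g th -> W p -> near_at xi p ->
  (OmegaA (pair_vect Z (prolong_vfield A (th k))) : smoothA M A) xi =
  \sum_i (Z (g i) : smoothA M A) xi * xi (omega th i k).
Proof.
move=> fr Wp xp; rewrite (prolong_form_frame Omega _ _ fr Wp xp) /frame_value.
apply: eq_bigr => i _; rewrite (bigD1 k)//= big1 => [|j jk].
  by rewrite addr0 prolong_vfieldE prolong_funE (near_frame_delta _ _ fr Wp xp) eqxx mul1r.
rewrite prolong_vfieldE prolong_funE (near_frame_delta _ _ fr Wp xp) eq_sym (negbTE jk).
by rewrite mul0r mulr0.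
Qed.

Lemma OmegaA_frame_l W g th T xi p l : is_frame W g th -> W p -> near_at xi p ->
  (OmegaA (pair_vect (prolong_vfield A (th l)) T) : smoothA M A) xi =
  \sum_j xi (omega th l j) * (T (g j) : smoothA M A) xi.
Proof.
move=> fr Wp xp; rewrite (prolong_form_frame Omega _ _ fr Wp xp).
rewrite /frame_value (bigD1 l)//= [X in _ + X]big1 ?addr0 => [|i il].
  apply: eq_bigr => j _.
  by rewrite prolong_vfieldE prolong_funE (near_frame_delta _ _ fr Wp xp) eqxx mul1r mulrC.
apply: big1 => j _.
by rewrite prolong_vfieldE prolong_funE (near_frame_delta _ _ fr Wp xp) eq_sym (negbTE il) mul0r.
Qed.

(** Evaluating a near point on the inverse matrix of coefficients inverts the system for the
    components of [Z] in the frame. The statement concerns a single [xi], as the comparison of local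
    solutions requires. *)
Lemma OmegaA_injective Z xi :
  (forall T, (OmegaA (pair_vect Z T) : smoothA M A) xi = 0) ->
  forall f, (Z f : smoothA M A) xi = 0.
Proof.
move=> Z0 f; have xp := near_baseptP xi; have [[[W g] th] [/= fr Wp]] := frame_at (near_basept xi).
have [h hE] := omega_inverse fr Wp.
rewrite (vfieldA_frame Z f fr Wp xp) big1// => l _.
suff -> : (Z (g l) : smoothA M A) xi = 0 by rewrite mul0r.
transitivity (\sum_i (Z (g i) : smoothA M A) xi * (i == l)%:R).
  by rewrite (bigD1 l)//= eqxx mulr1 big1 ?addr0// => i il; rewrite (negbTE il) mulr0.
transitivity (\sum_i \sum_k ((Z (g i) : smoothA M A) xi * xi (omega th i k)) * xi (h k l)).
  apply: eq_bigr => i _; rewrite -(@near_matrix_id (omega th) h xi _ i l xp).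
    by rewrite mulr_sumr; apply: eq_bigr => k _; rewrite mulrA.
  by apply: filterS hE => x /(_ i l)[].
rewrite exchange_big big1// => k _ /=.
by rewrite -mulr_suml -(OmegaA_frame_r Z k fr Wp xp) Z0 mul0r.
Qed.

Lemma OmegaA_local_surj (eta : altform (vfieldA M A) 1) p :
  exists (X : vfieldA M A) (D : set M), nbhs p D /\
    forall xi q, near_at xi q -> D q -> forall T,
      (OmegaA (pair_vect X T) : smoothA M A) xi = (eta (fun=> T) : smoothA M A) xi.
Proof.
have [[[W g] th] [/= fr Wp]] := frame_at p.
have [h hE] := omega_inverse fr Wp.
have [s [K [s1 cK KW s0]]] := frame_bump fr Wp.
(* The solution of sum_l a_l omega_lj^A = eta(th_j^A), obtained from the inverse matrix [h]; the
   cut-off [s] in [X] confines it to the frame. *)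
pose a l : smoothA M A := \sum_k (eta (fun=> prolong_vfield A (th k)) : smoothA M A) *
  prolong_fun A (h k l).
pose X : vfieldA M A := \sum_l (prolong_fun A s * a l) *: prolong_vfield A (th l).
have [oW _ _] := fr.
pose P := [set x | s x = 1 /\ forall i l,
    \sum_k omega th i k x * h k l x = (i == l)%:R /\
    \sum_k h i k x * omega th k l x = (i == l)%:R].
have Pp : nbhs p P by apply: filterI.
(* The interior is taken so that the identities in [P] hold near every base point in question and
   can be evaluated by its near points. *)
exists X, (W `&` P°); split.
  by apply: filterI; [exact: open_nbhs_nbhs|exact: nbhs_interior].
move=> xi q xq [Wq Pq] T.
have xs : xi s = 1 by apply: near_bump1 xq _; apply: filterS Pq => x [].
rewrite /X form2_suml !smoothAE (form1A_frame eta T fr Wq xq).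
transitivity (\sum_l \sum_j \sum_k ((T (g j) : smoothA M A) xi *
   (eta (fun=> prolong_vfield A (th k)) : smoothA M A) xi) * (xi (h k l) * xi (omega th l j))).
  apply: eq_bigr => l _.
  rewrite -[LHS]/((prolong_fun A s xi * a l xi) *
    (OmegaA (pair_vect (prolong_vfield A (th l)) T) : smoothA M A) xi).
  rewrite prolong_funE xs mul1r.
  rewrite (OmegaA_frame_l T l fr Wq xq) /a smoothAE mulr_sumr; apply: eq_bigr => j _.
  rewrite mulr_suml; apply: eq_bigr => k _; rewrite smoothAE prolong_funE; ring.
rewrite exchange_big; apply: eq_bigr => j _ /=.
rewrite exchange_big /=.
have E k : \sum_l xi (h k l) * xi (omega th l j) = (k == j)%:R.
  apply: (near_matrix_id xq); apply: filterS Pq => x [_ H].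
  by case: (H k j).
rewrite (bigD1 j)//= -mulr_sumr E eqxx mulr1 big1 ?addr0// => k kj.
by rewrite -mulr_sumr E (negbTE kj) mulr0.
Qed.

(* Injectivity makes the local solutions agree on overlaps, hence glue. *)
Lemma OmegaA_surjective (eta : altform (vfieldA M A) 1) :
  exists X : vfieldA M A, forall T, OmegaA (pair_vect X T) = eta (fun=> T).
Proof.
have [L /boolp.choice[D LD]] := boolp.choice (OmegaA_local_surj eta).
have LE p q xi f : near_at xi q -> D p q -> D q q ->
    (L q f : smoothA M A) xi = (L p f : smoothA M A) xi.
  move=> xq Dp Dq; apply/eqP; rewrite -subr_eq0; apply/eqP.
  have K T : (OmegaA (pair_vect (-1 *: L p + L q) T) : smoothA M A) xi = 0.
    rewrite form2Dl.
    transitivity (- 1 * (OmegaA (pair_vect (L p) T) : smoothA M A) xi +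
      (OmegaA (pair_vect (L q) T) : smoothA M A) xi); first by [].
    by rewrite ((LD p).2 xi q xq Dp) ((LD q).2 xi q xq Dq) mulN1r addNr.
  transitivity (((-1 *: L p + L q) f : smoothA M A) xi); last exact: OmegaA_injective.
  transitivity (- 1 * (L p f : smoothA M A) xi + (L q f : smoothA M A) xi); last by [].
  by rewrite mulN1r addrC.
have Dp p : D p p by exact: nbhs_singleton (LD p).1.
pose x0 f xi : A^o := (L (near_basept xi) f : smoothA M A) xi.
have x0E f xi p q : near_at xi q -> D p q -> x0 f xi = (L p f : smoothA M A) xi.
  move=> xq Dpq; rewrite /x0 (near_at_unique (near_baseptP xi) xq).
  exact: LE xq Dpq (Dp q).
have sx f : x0 f \in smoothA_pred (M := M) (A := A).
  apply: smoothA_local => xi p xp; exists (L p f), (D p); split; first exact: (LD p).1.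
  by move=> xi' q xq Dq; exact: x0E xq Dq.
pose X0 f : (smoothA M A)^o := SmoothA (sx f).
have XP : X0 \in vfieldA_pred (M := M) (A := A).
  apply/asboolP; split=> [f h|r f|f h]; apply: smoothA_eq => xi; rewrite !smoothAE /= /x0;
    have [aX sX lX] := vfieldA_der (L (near_basept xi)).
  - by rewrite aX.
  - by rewrite sX.
  - by rewrite lX.
exists (VFieldA XP) => T; apply: smoothA_eq => xi.
have xp := near_baseptP xi; have [[[W g] th] [/= fr Wp]] := frame_at (near_basept xi).
(* At [xi] the glued field has the same values as the local solution chosen there, and the frame
   formula shows that the pairing depends on these values only. *)
rewrite -((LD (near_basept xi)).2 xi _ xp (Dp _)).
by rewrite !(prolong_form_frame Omega _ _ fr Wp xp).
Qed.

(** A right inverse is chosen from surjectivity; it is also a left inverse because the difference of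
    the two fields pairs to 0 with every field. *)
Lemma interior_bijective : bijective (interior_product OmegaA).
Proof.
have S (eta : altform (vfieldA M A) 1) : exists X, interior_product OmegaA X = eta.
  have [X XE] := OmegaA_surjective eta; exists X; apply/val_inj/funext => v /=.
  rewrite cons_vect1E XE; congr (form_fun eta _).
  by apply/funext => k; rewrite (ord1 k).
have [inv invE] := boolp.choice S; exists inv => // X.
apply: vfieldA_eq => f xi; apply/eqP; rewrite -subr_eq0; apply/eqP.
have K T : (OmegaA (pair_vect (-1 *: X + inv (interior_product OmegaA X)) T) : smoothA M A) xi = 0.
  rewrite form2Dl.
  have := congr1 (fun w : altform (vfieldA M A) 1 => w (fun=> T)) (invE (interior_product OmegaA X)).
  rewrite /= !cons_vect1E => ->.
  transitivity (- 1 * (OmegaA (pair_vect X T) : smoothA M A) xi +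
    (OmegaA (pair_vect X T) : smoothA M A) xi); first by [].
  by rewrite mulN1r addNr.
transitivity (((-1 *: X + inv (interior_product OmegaA X)) f : smoothA M A) xi);
  last exact: OmegaA_injective.
transitivity (- 1 * (X f : smoothA M A) xi +
  (inv (interior_product OmegaA X) f : smoothA M A) xi); last by [].
by rewrite mulN1r addrC.
Qed.

End Nondegenerate.

(** * Closedness *)

Lemma cochain_diff2 {S : comPzRingType} {V : lmodType S} (act : V -> S -> S)
    (br : V -> V -> V) (w : altform V 2) (X : 'I_3 -> V) :
  let x := X 0 in let y := X 1 in let z := X (inord 2) in
  cochain_diff act br w X =
  act x (w (pair_vect y z)) - act y (w (pair_vect x z)) + act z (w (pair_vect x y))
  - w (pair_vect (br x y) z) + w (pair_vect (br x z) y) - w (pair_vect (br y z) x).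
Proof.
move=> x y z; rewrite /cochain_diff.
have i0 : (ord0 : 'I_3) = 0 by exact: val_inj.
have i1 : lift ord0 (ord0 : 'I_2) = 1 by exact: val_inj.
have i2 : lift ord0 (lift ord0 (ord0 : 'I_1)) = inord 2 by apply: val_inj; rewrite /= inordK.
have e3 : enum 'I_3 = [:: 0; 1; inord 2].
  by rewrite !enum_ordSl enum_ord0 /= i0 i1 i2.
have X0 : (fun k : 'I_2 => X (lift (0 : 'I_3) k)) = pair_vect y z.
  apply/funext; apply: ord2P; congr X; apply: val_inj => //=; by rewrite inordK.
have X1 : (fun k : 'I_2 => X (lift (1 : 'I_3) k)) = pair_vect x z.
  apply/funext; apply: ord2P; congr X; apply: val_inj => //=; by rewrite inordK.
have X2 : (fun k : 'I_2 => X (lift (inord 2 : 'I_3) k)) = pair_vect x y.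
  by apply/funext; apply: ord2P; congr X; apply: val_inj => /=; rewrite /bump inordK.
have v2 : (inord 2 : 'I_3) = 2%N :> nat by rewrite inordK.
have n20 : ((inord 2 : 'I_3) == 0) = false by rewrite -val_eqE /= v2.
have n21 : ((inord 2 : 'I_3) == 1) = false by rewrite -val_eqE /= v2.
have n02 : ((0 : 'I_3) == inord 2) = false by rewrite eq_sym.
have n12 : ((1 : 'I_3) == inord 2) = false by rewrite eq_sym.
(* Removing two of the three indices leaves a one-element list, so the argument of the form in a
   bracket term is a pair. *)
have P (u : V) (i j k : 'I_3) : [seq X l | l <- enum 'I_3 & (l != i) && (l != j)] = [:: X k] ->
    (fun m : 'I_2 => nth 0 (u :: [seq X l | l <- enum 'I_3 & (l != i) && (l != j)]) m) =
    pair_vect u (X k).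
  by move=> ->; apply/funext; exact: ord2P.
have S3 (u : 'I_3 -> S) : \sum_i u i = u 0 + u 1 + u (inord 2).
  by rewrite !big_ord_recl big_ord0 addr0 i0 i1 i2 addrA.
have S3c (c : pred 'I_3) (u : 'I_3 -> S) : \sum_(i | c i) u i =
    (if c 0 then u 0 else 0) + (if c 1 then u 1 else 0) + (if c (inord 2) then u (inord 2) else 0).
  by rewrite big_mkcond S3.
rewrite !S3 !S3c X0 X1 X2 /= v2 /=.
rewrite (P _ 0 1 (inord 2)); last by rewrite e3 /= ?eqxx ?n20 ?n21.
rewrite (P _ 0 (inord 2) 1); last by rewrite e3 /= ?eqxx ?n20 ?n21 ?n02 ?n12.
rewrite (P _ 1 (inord 2) 0); last by rewrite e3 /= ?eqxx ?n20 ?n21 ?n02 ?n12.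
rewrite -/x -/y -/z !addr0 !add0r expr0 expr1.
have s2 : (-1) ^+ 2 = 1 :> S by rewrite sqrrN expr1n.
have s3 : (-1) ^+ 3 = -1 :> S by rewrite exprS s2 mulr1.
rewrite -[(0 + 2)%N]/2%N -[(1 %% 3 + 2)%N]/3%N s2 s3.
by rewrite !mul1r !mulN1r !addrA.
Qed.

Section Closed.
Context {R : realType} {n : nat} {M : manifold R n} {A : weilAlgebra R}.
Implicit Types (p q : M) (xi : near_point M A).
Implicit Types (F G : smoothA M A) (X Y Z : vfieldA M A).
Implicit Types (W : set M) (g : 'I_n -> smooth M) (th : 'I_n -> vfield M).

(** For a bump [s] supported in [W], the products of its prolongation with [F] and with [G]
    coincide. In the Leibniz rule at [xi], the term with X(s) vanishes because [s] is constant near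
    [p]. *)
Lemma extension_local W g th X F G xi p : is_frame W g th -> W p -> near_at xi p ->
  (forall xi' q, near_at xi' q -> W q -> F xi' = G xi') ->
  (extension X F : smoothA M A) xi = (extension X G : smoothA M A) xi.
Proof.
move=> fr Wp xp FG; have [s [K [s1 cK KW s0]]] := frame_bump fr Wp.
have e : prolong_fun A s * F = prolong_fun A s * G.
  apply: smoothA_eq => xi'; rewrite !smoothAE prolong_funE.
  have [q xq] := near_baseP xi'; have [Kq|nKq] := pselect (K q).
    by rewrite (FG xi' q xq (KW _ Kq)).
  have -> : xi' s = 0.
    apply: near_local xq _; apply: filterS (open_nbhs_nbhs (conj (closed_openC cK) nKq)).
    by move=> x; exact: s0.
  by rewrite !mul0r.
have Xs : (X s : smoothA M A) xi = 0.
  rewrite -[RHS](pder1 (vfieldA_pder X xi)).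
  exact: (pder_local_eq (vfieldA_pder X xi) xp).
have E H : (extension X (prolong_fun A s * H) : smoothA M A) xi =
    (extension X H : smoothA M A) xi.
  rewrite extensionM extension_prolongE !smoothAE Xs mul0r add0r prolong_funE.
  by rewrite (near_bump1 xp s1) mul1r.
by rewrite -E e E.
Qed.

Variable Omega : altform (vfield M) 2.
Local Notation omega := (omega Omega).
Local Notation OmegaA := (prolong_form A Omega).

(* The bracket terms of the exterior derivative vanish on a coordinate frame. *)
Lemma omega_closed W g th p i j k : is_frame W g th -> W p ->
  closed_form (fun X : vfield M => (X : smooth M -> smooth M)) (@vbracket R n M) Omega ->
  (th k (omega th i j) : smooth M) p - (th i (omega th k j) : smooth M) p +
  (th j (omega th k i) : smooth M) p = 0.
Proof.
move=> fr Wp cl.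
have [oW thg _] := fr.
have br a b (Y : vfield M) : (Omega (pair_vect (vbracket (th a) (th b)) Y) : smooth M) p = 0.
  rewrite (form_frame Omega _ _ fr Wp) big1// => l _; rewrite big1// => m _.
  suff -> : (vbracket (th a) (th b) (g l) : smooth M) p = 0 by rewrite mul0r.
  (* By duality [th d (g l)] is constant near [p], so the frame fields commute on coordinates. *)
  have Z c d : (th c (th d (g l)) : smooth M) p = 0.
    rewrite (@vfield_local_eq _ _ _ (th c) _ ((d == l)%:R *: (1 : smooth M)) p).
      by have [_ sc _] := vfield_der (th c); rewrite sc (derivation1 (vfield_der (th c))) scaler0.
    by apply: filterS (open_nbhs_nbhs (conj oW Wp)) => q Wq; rewrite thg// smoothE mulr1.
  transitivity ((th a (th b (g l)) : smooth M) p - (th b (th a (g l)) : smooth M) p); first by [].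
  by rewrite (Z a b) (Z b a) subr0.
pose X (m : 'I_3) : vfield M := if m == 0 then th k else if m == 1 then th i else th j.
have := cl X; rewrite cochain_diff2.
have n20 : ((inord 2 : 'I_3) == 0) = false by rewrite -val_eqE /= inordK.
have n21 : ((inord 2 : 'I_3) == 1) = false by rewrite -val_eqE /= inordK.
rewrite /X /= n20 n21 => /(congr1 (fun f : smooth M => f p)).
rewrite /omega => e; rewrite -[RHS]e.
transitivity ((th k (Omega (pair_vect (th i) (th j))) : smooth M) p
  - (th i (Omega (pair_vect (th k) (th j))) : smooth M) p
  + (th j (Omega (pair_vect (th k) (th i))) : smooth M) p
  - (Omega (pair_vect (vbracket (th k) (th i)) (th j)) : smooth M) p
  + (Omega (pair_vect (vbracket (th k) (th j)) (th i)) : smooth M) p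
  - (Omega (pair_vect (vbracket (th i) (th j)) (th k)) : smooth M) p); last by [].
by rewrite !br !subr0 addr0.
Qed.

Definition pairing th xi (u v : 'I_n -> A) : A :=
  \sum_i \sum_j u i * (v j * xi (omega th i j)).

Lemma pairingB th xi u u' v :
  pairing th xi (fun i => u i - u' i) v = pairing th xi u v - pairing th xi u' v.
Proof.
rewrite /pairing -sumrB; apply: eq_bigr => i _; rewrite -sumrB; apply: eq_bigr => j _.
by rewrite mulrBl.
Qed.

Lemma pairingC th xi u v : pairing th xi v u = - pairing th xi u v.
Proof.
rewrite /pairing exchange_big -sumrN; apply: eq_bigr => i _; rewrite -sumrN.
by apply: eq_bigr => j _; rewrite /omega form2C rmorphN; ring.
Qed.

(** With [u], [v], [w] the components of X, Y, Z, this is the part of the derivative of Omega^A(Y,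
    Z) along X in which the coefficients of Omega are differentiated. *)
Definition triple th xi (u v w : 'I_n -> A) : A :=
  \sum_i \sum_j \sum_k u k * (v i * w j) * xi (th k (omega th i j)).

Definition components g X xi (i : 'I_n) : A := (X (g i) : smoothA M A) xi.
Definition dcomponents g X Y xi (i : 'I_n) : A :=
  (extension X (Y (g i)) : smoothA M A) xi.

(** The local formula for Omega^A(Y, Z) may be differentiated in its place by [extension_local]; the
    product rule gives one term for each of its three factors. *)
Lemma extension_OmegaA W g th X Y Z xi p : is_frame W g th -> W p -> near_at xi p ->
  (extension X (OmegaA (pair_vect Y Z)) : smoothA M A) xi =
  pairing th xi (dcomponents g X Y xi) (components g Z xi) +
  pairing th xi (components g Y xi) (dcomponents g X Z xi) +
  triple th xi (components g X xi) (components g Y xi) (components g Z xi).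
Proof.
move=> fr Wp xp.
pose G : smoothA M A := \sum_i \sum_j Y (g i) * (Z (g j) * prolong_fun A (omega th i j)).
rewrite (@extension_local W g th X _ G xi p fr Wp xp); last first.
  move=> xi' q xq Wq; rewrite (prolong_form_frame Omega Y Z fr Wq xq) /G !smoothAE.
  apply: eq_bigr => i _; rewrite smoothAE; apply: eq_bigr => j _.
  by rewrite !smoothAE prolong_funE.
have ext0 : extension X 0 = 0.
  by have := extensionZ X (0 : A) (0 : smoothA M A); rewrite !scale0r.
have ext_sum (r : seq 'I_n) (u : 'I_n -> smoothA M A) :
    extension X (\sum_(i <- r) u i) = \sum_(i <- r) extension X (u i).
  elim: r => [|i r IH]; first by rewrite !big_nil ext0.
  by rewrite !big_cons extensionD IH.
rewrite /G ext_sum smoothAE /pairing /triple -!big_split /=; apply: eq_bigr => i _.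
rewrite ext_sum smoothAE -!big_split /=; apply: eq_bigr => j _.
rewrite !extensionM extension_prolongE !smoothAE prolong_funE.
rewrite (vfieldA_frame X (omega th i j) fr Wp xp) /components /dcomponents.
rewrite !mulrDr mulrA -!addrA; congr (_ + (_ + _)).
rewrite !mulr_sumr; apply: eq_bigr => k _; ring.
Qed.

Lemma OmegaA_pairing W g th X Y xi p : is_frame W g th -> W p -> near_at xi p ->
  (OmegaA (pair_vect X Y) : smoothA M A) xi =
  pairing th xi (components g X xi) (components g Y xi).
Proof. exact: prolong_form_frame. Qed.

Lemma components_bracket g X Y xi :
  components g (vbracketA X Y) xi =
  (fun i => dcomponents g X Y xi i - dcomponents g Y X xi i).
Proof. by apply/funext => i; rewrite /components vbracketAE smoothAE. Qed.

(** Renaming the summation indices gives all three sums the weight u_k v_i w_j. The coefficients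
    then combine into the image under [xi] of a function that vanishes near [p] by
    [omega_closed]. *)
Lemma triple_cyclic W g th xi p u v w : is_frame W g th -> W p -> near_at xi p ->
  closed_form (fun X : vfield M => (X : smooth M -> smooth M)) (@vbracket R n M) Omega ->
  triple th xi u v w - triple th xi v u w + triple th xi w u v = 0.
Proof.
move=> fr Wp xp cl.
have E i j k : xi (th k (omega th i j)) - xi (th i (omega th k j)) + xi (th j (omega th k i)) = 0.
  rewrite -rmorphB -rmorphD; apply: (near_local xp).
  have [oW _ _] := fr.
  apply: filterS (open_nbhs_nbhs (conj oW Wp)) => q Wq.
  exact: (omega_closed i j k fr Wq cl).
have swap (F : 'I_n -> 'I_n -> 'I_n -> A) :
    \sum_i \sum_j \sum_k F i j k = \sum_i \sum_j \sum_k F k j i.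
  rewrite exchange_big [RHS]exchange_big; apply: eq_bigr => j _ /=.
  by rewrite exchange_big.
have cyc (F : 'I_n -> 'I_n -> 'I_n -> A) :
    \sum_i \sum_j \sum_k F i j k = \sum_i \sum_j \sum_k F k i j.
  by rewrite exchange_big [RHS]exchange_big /= [RHS]swap [RHS]exchange_big.
have T1 : triple th xi v u w = \sum_i \sum_j \sum_k u k * (v i * w j) * xi (th i (omega th k j)).
  rewrite /triple swap; do 3 (apply: eq_bigr => ? _); ring.
have T2 : triple th xi w u v = \sum_i \sum_j \sum_k u k * (v i * w j) * xi (th j (omega th k i)).
  rewrite /triple cyc; do 3 (apply: eq_bigr => ? _); ring.
rewrite T1 T2 /triple -sumrB -big_split big1// => i _ /=.
rewrite -sumrB -big_split big1// => j _ /=.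
rewrite -sumrB -big_split big1// => k _ /=.
by rewrite -mulrBr -mulrDr E mulr0.
Qed.

Lemma OmegaA_closed :
  closed_form (fun X : vfield M => (X : smooth M -> smooth M)) (@vbracket R n M) Omega ->
  closed_form (@extension R n M A) (@vbracketA R n M A) OmegaA.
Proof.
move=> cl X; rewrite cochain_diff2; set x := X 0; set y := X 1; set z := X (inord 2).
apply: smoothA_eq => xi; have xp := near_baseptP xi.
have [[[W g] th] [/= fr Wp]] := frame_at (near_basept xi).
transitivity ((extension x (OmegaA (pair_vect y z)) : smoothA M A) xi
  - (extension y (OmegaA (pair_vect x z)) : smoothA M A) xi
  + (extension z (OmegaA (pair_vect x y)) : smoothA M A) xi
  - (OmegaA (pair_vect (vbracketA x y) z) : smoothA M A) xi
  + (OmegaA (pair_vect (vbracketA x z) y) : smoothA M A) xi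
  - (OmegaA (pair_vect (vbracketA y z) x) : smoothA M A) xi); first by [].
rewrite !(extension_OmegaA _ _ _ fr Wp xp) !(OmegaA_pairing _ _ fr Wp xp).
rewrite !components_bracket !pairingB.
have := triple_cyclic (components g x xi) (components g y xi) (components g z xi) fr Wp xp cl.
move: (triple th xi _ _ _) (triple th xi _ _ _) (triple th xi _ _ _) => t1 t2 t3 t0.
(* Three of the six bracket pairings carry the differentiated components in the first slot where
   their counterparts carry them in the second. Once these are flipped, all pairings cancel and the
   cyclic sum of [triple] terms remains. *)
rewrite (pairingC _ _ (components g y xi) (dcomponents g x z xi)).
rewrite (pairingC _ _ (components g x xi) (dcomponents g y z xi)).
rewrite (pairingC _ _ (components g x xi) (dcomponents g z y xi)).
transitivity (0 : A); last by [].
rewrite -[RHS]t0; ring.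
Qed.

End Closed.

Theorem corollary11 (R : realType) (n : nat) (M : manifold R n)
    (Omega : altform (vfield M) 2) (hOmega : symplectic Omega)
    (A : weilAlgebra R) :
  symplecticA (prolong_form A Omega).
Proof.
have [cl nd] := hOmega; split.
- exact: OmegaA_closed cl.
- exact: interior_linear.
- exact: interior_bijective nd.
Qed.
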